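(* Let $N$ be a norm on $\mathbb{M}^{n\times n}_{\rm sym}$ such that $N(a\odot b)=|a\odot b|$ for all $a,b\in\mathbb{R}^n$. Assume that for every bounded open set $\Omega\subset\mathbb{R}^n$ with Lipschitz boundary and every $u\in BD(\Omega)$ there exists a sequence $\{u_k\}_{k\in\mathbb{N}}$ in $PR(\mathbb{R}^n)$ such that $$u_k\to u\ \text{ strongly in } L^1(\Omega;\mathbb{R}^n)\qquad\text{and}\qquad N(Eu_k)(\Omega)\to N(Eu)(\Omega).$$ Then $N=|\cdot|_{\rm sym-S}$, i.e. $N(A)=|A|_{\rm sym-S}$ for all $A\in\mathbb{M}^{n\times n}_{\rm sym}$.
   Context: Matrices: $\mathbb{M}^{n\times n}_{\rm sym}$ and $\mathbb{M}^{n\times n}_{\rm skew}$ are the spaces of real symmetric and skew-symmetric $n\times n$ matrices, $|A|=\sqrt{\operatorname{tr}(A^TA)}$ is the Frobenius norm, and $a\odot b:=(ab^T+ba^T)/2$ for $a,b\in\mathbb{R}^n$. For $A\in\mathbb{M}^{n\times n}_{\rm sym}$ with eigenvalues $\lambda_1,\dots,\lambda_n$, the symmetric Schatten $1$-norm is $$|A|_{\rm sym-S}:=\sqrt{\tfrac12\Big(\sum_{i=1}^n|\lambda_i|\Big)^2+\tfrac12\Big(\sum_{i=1}^n\lambda_i\Big)^2},$$ which is a norm on $\mathbb{M}^{n\times n}_{\rm sym}$. Spaces: $\mathcal{M}(\Omega;X)$ denotes the bounded $X$-valued Radon measures on $\Omega$, and $BD(\Omega)=\{u\in L^1(\Omega;\mathbb{R}^n):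 Eu:=(Du+Du^T)/2\in\mathcal{M}(\Omega;\mathbb{M}^{n\times n}_{\rm sym})\}$, where $Du$ is the distributional gradient. Variation with respect to a norm: for a norm $N$ on a finite-dimensional space $X$ and $\mu\in\mathcal{M}(\Omega;X)$, $N(\mu)$ is the nonnegative finite Borel measure $N(\mu):=N\big(\frac{d\mu}{d|\mu|}\big)|\mu|$, where $|\mu|$ is the total variation with respect to the Frobenius norm; equivalently $N(\mu)(B)=\sup\sum_{i=1}^kN(\mu(B_i))$ over all finite Borel partitions of $B$. If $Eu$ is not a bounded Radon measure on $\Omega$, its variation on $\Omega$ is understood to be $+\infty$. Piecewise rigid body motions: $PR(\mathbb{R}^n)$ is the set of functions $u:\mathbb{R}^n\to\mathbb{R}^n$ for which there exist a countable family $\{P_i\}_{i\in\mathbb{N}}$ of polyhedral sets (finite unions of finite intersections of open or closed half-spaces) with pairwise disjoint interiors and $\mathbb{R}^n=\bigcup_iP_i$, matrices $A_i\in\mathbb{M}^{n\times n}_{\rm skew}$ and vectors $b_i\in\mathbb{R}^n$ such that for all $i$, $u(x)=A_ix+b_i$ for almost every $x\in P_i$. *)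

(* Defs.v *)
From HB Require Import structures.
From mathcomp Require Import all_boot all_order all_algebra.
From mathcomp Require Import all_classical all_reals all_analysis.
From mathcomp Require Import measurable_realfun.

Set Implicit Arguments.
Unset Strict Implicit.
Unset Printing Implicit Defensive.

Import Order.TTheory GRing.Theory Num.Theory.
Import numFieldNormedType.Exports.

Local Open Scope classical_set_scope.
Local Open Scope ring_scope.

(* R^n is 'rV[R]_n, so that A x is x *m A^T and the outer product a b^T is
   a^T *m b.  Its sigma-algebra is the Borel one. *)
HB.instance Definition _ (R : realType) (n : nat) :=
  @isMeasurable.Build (sigma_display (@open 'rV[R]_n)) 'rV[R]_n
    <<s (@open 'rV[R]_n) >> (@sigma_algebra0 _ setT open)
    (@sigma_algebraC _ open) (@sigma_algebra_bigcup _ setT open).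

Section borel_rV.
Context {R : realType}.

Lemma open_ball_rV n (U : set 'rV[R]_n) : open U ->
  U = \bigcup_(p in [set p : 'rV[rat]_n * nat |
        ball (map_mx ratr p.1 : 'rV[R]_n) (p.2.+1%:R^-1 : R) `<=` U])
      ball (map_mx ratr p.1 : 'rV[R]_n) (p.2.+1%:R^-1 : R).
Proof.
move=> oU; apply/seteqP; split; last by move=> x [p /= pU] /pU.
move=> x Ux; have /nbhs_ballP[e /= e0 eU] : nbhs x U by exact: open_nbhs_nbhs.
have [k ke] : exists k : nat, k.+1%:R^-1 < e / 2 :> R.
  have := near_infty_natSinv_lt (PosNum (divr_gt0 e0 (@ltr0n R 2))).
  by move=> [k _ /(_ k (leqnn k))] ke; exists k.
have k0 : 0 < k.+1%:R^-1 :> R by rewrite invr_gt0.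
have H (j : 'I_n) : {q : rat | `|x ord0 j - ratr q| < k.+1%:R^-1}.
  apply: cid.
  have : x ord0 j - k.+1%:R^-1 < x ord0 j + k.+1%:R^-1 by rewrite ltrD2l gtrN.
  move=> /rat_in_itvoo[q]; rewrite in_itv/= => /andP[q1 q2]; exists q.
  by rewrite distrC ltr_distl q1 q2.
pose q : 'rV[rat]_n := \row_j sval (H j).
have xq : ball (map_mx ratr q : 'rV[R]_n) k.+1%:R^-1 x.
  split => // i j; rewrite !mxE (ord1 i) -ball_normE/= distrC.
  exact: (svalP (H j)).
exists (q, k) => //= y qy; apply: eU.
apply: (@le_ball _ _ _ (k.+1%:R^-1 + k.+1%:R^-1)).
  by rewrite [leRHS]splitr lerD// ltW.
exact: ball_triangle (ball_sym xq) qy.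
Qed.

Lemma measurable_fun_rV d (T : measurableType d) n (f : T -> 'rV[R]_n) :
  (forall j, measurable_fun [set: T] (fun t => f t ord0 j : measurableTypeR R)) ->
  measurable_fun [set: T] f.
Proof.
move=> mf; apply: (@measurability _ _ T 'rV[R]_n setT f open) => //.
move=> _ [U oU <-]; rewrite setTI (open_ball_rV oU) preimage_bigcup.
rewrite bigcup_mkcond; apply: countable_bigcupT_measurable => // -[q k].
case: ifPn => _ /=; last exact: measurable0.
rewrite (_ : _ @^-1` _ = \bigcap_(j in [set: 'I_n])
    ((fun t => f t ord0 j) @^-1` ball (ratr (q ord0 j) : R) (k.+1%:R^-1 : R))).
  apply: fin_bigcap_measurable => // j _.
  rewrite -[X in measurable X]setTI; apply: mf => //.
  by apply: open_measurable; exact: ball_open.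
apply/seteqP; split => t /=.
  by move=> [_ h] j _ /=; have := h ord0 j; rewrite mxE.
move=> h; split => // i j; rewrite (ord1 i) mxE; exact: h.
Qed.

Lemma measurable_rV_coord n (j : 'I_n) :
  measurable_fun [set: 'rV[R]_n]
    (fun x : 'rV[R]_n => x ord0 j : measurableTypeR R).
Proof.
apply: (measurability _ (RGenOpens.measurableE R)).
move=> _ [_ [a [b ->] <-]]; rewrite setTI; apply: sub_sigma_algebra.
apply: open_comp; last exact: interval_open.
by move=> x _; exact: coord_continuous.
Qed.

Definition rV_cons n (p : measurableTypeR R * 'rV[R]_n) : 'rV[R]_n.+1 :=
  row_mx (p.1%:M : 'M[R]_1) p.2.

Definition rV_uncons n (x : 'rV[R]_n.+1) : measurableTypeR R * 'rV[R]_n :=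
  (x ord0 ord0, rsubmx (x : 'rV[R]_(1 + n))).

Lemma rV_cons0 n p : @rV_cons n p ord0 (lshift n (ord0 : 'I_1)) = p.1.
Proof.
by apply: etrans (row_mxEl _ _ _ _) _; rewrite mxE eqxx mulr1n.
Qed.

Lemma rV_consS n p j : @rV_cons n p ord0 (rshift 1 j) = p.2 ord0 j.
Proof. exact: row_mxEr. Qed.

Lemma rV_consK n : cancel (@rV_cons n) (@rV_uncons n).
Proof.
move=> [a x]; rewrite /rV_uncons row_mxKr; congr pair.
rewrite [X in _ ord0 X](_ : _ = lshift n (ord0 : 'I_1)); last exact: val_inj.
exact: rV_cons0.
Qed.

Lemma measurable_rV_cons n : measurable_fun setT (@rV_cons n).
Proof.
apply: measurable_fun_rV => j.
rewrite -(splitK (j : 'I_(1 + n))); case: (fintype.split (j : 'I_(1 + n))) => i /=.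
  rewrite (ord1 i); apply: (eq_measurable_fun fst); last exact: measurable_fst.
  by move=> p _; rewrite rV_cons0.
apply: (eq_measurable_fun (fun p : measurableTypeR R * 'rV[R]_n => p.2 ord0 i)).
  by move=> p _; rewrite rV_consS.
exact: (measurableT_comp (measurable_rV_coord i) measurable_snd).
Qed.

Lemma measurable_rV_uncons n : measurable_fun setT (@rV_uncons n).
Proof.
apply: measurable_fun_pair; first exact: measurable_rV_coord.
apply: measurable_fun_rV => j.
apply: (eq_measurable_fun (fun x : 'rV[R]_n.+1 => x ord0 (rshift 1 j))).
  by move=> x _; rewrite mxE.
exact: measurable_rV_coord.
Qed.

End borel_rV.

Section lebesgue_rV.
Local Open Scope ereal_scope.
Context {R : realType}.

Definition lebesgue_step n (m : {sigma_finite_measure set 'rV[R]_n -> \bar R}) :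
    set 'rV[R]_n.+1 -> \bar R :=
  pushforward (@lebesgue_measure R \x m) (@rV_cons R n).

Section lebesgue_step.
Variables (n : nat) (m : {sigma_finite_measure set 'rV[R]_n -> \bar R}).

Let step0 : lebesgue_step m set0 = 0.
Proof. by rewrite /lebesgue_step /pushforward preimage_set0 measure0. Qed.

Let step_ge0 A : 0 <= lebesgue_step m A.
Proof. by rewrite /lebesgue_step /pushforward. Qed.

Let step_sigma_additive : semi_sigma_additive (lebesgue_step m).
Proof.
move=> F mF tF mUF; rewrite /lebesgue_step /pushforward preimage_bigcup.
have mc (A : set 'rV[R]_n.+1) : measurable A -> measurable (@rV_cons R n @^-1` A).
  by move=> mA; rewrite -[X in measurable X]setTI; exact: measurable_rV_cons.
apply: measure_semi_sigma_additive; first by move=> i; exact: mc.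
- apply/trivIsetP => /= i j _ _ ij; rewrite -preimage_setI.
  by move/trivIsetP : tF => /(_ _ _ _ _ ij) ->//; rewrite preimage_set0.
- by rewrite -preimage_bigcup; exact: mc.
Qed.

HB.instance Definition _ := isMeasure.Build _ _ _
  (lebesgue_step m) step0 step_ge0 step_sigma_additive.

Let step_sigma_finite : sigma_finite setT (lebesgue_step m).
Proof.
have /sigma_finiteP[F [TF ndF Foo]] := sigma_finiteT (@lebesgue_measure R).
have /sigma_finiteP[G [TG ndG Goo]] := sigma_finiteT m.
exists (fun k => @rV_uncons R n @^-1` (F k `*` G k)).
  rewrite -preimage_bigcup (_ : \bigcup_k _ = setT) ?preimage_setT//.
  apply/seteqP; split => // -[a x] _.
  have [k _ Fka] : (\bigcup_k F k) a by rewrite -TF.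
  have [l _ Glx] : (\bigcup_l G l) x by rewrite -TG.
  exists (maxn k l) => //; split => /=.
    by move: a Fka; exact/subsetPset/ndF/leq_maxl.
  by move: x Glx; exact/subsetPset/ndG/leq_maxr.
move=> k; have [mF Fk] := Foo k; have [mG Gk] := Goo k; split.
  rewrite -[X in measurable X]setTI; apply: measurable_rV_uncons => //.
  exact: measurableX.
rewrite /lebesgue_step /pushforward -comp_preimage.
rewrite (_ : _ \o _ = id); last by apply/funext; exact: rV_consK.
by rewrite preimage_id product_measure1E// lte_mul_pinfty// ge0_fin_numE.
Qed.

HB.instance Definition _ := Measure_isSigmaFinite.Build _ _ _ (lebesgue_step m)
  step_sigma_finite.

End lebesgue_step.

(* n-dimensional Lebesgue measure on Borel sets, as an iterated product; see
   lebesgue_rV_box for its value on boxes *)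
Fixpoint lebesgue_rV n : {sigma_finite_measure set 'rV[R]_n -> \bar R} :=
  match n with
  | 0%N => \d_(0%R : 'rV[R]_0)
  | n'.+1 => lebesgue_step (lebesgue_rV n')
  end.

End lebesgue_rV.

Lemma measurable_rV_box (R : realType) n (a b : 'rV[R]_n) :
  measurable [set x : 'rV[R]_n | forall j, x ord0 j \in `[a ord0 j, b ord0 j]].
Proof.
rewrite (_ : mkset _ = \bigcap_(j in [set: 'I_n])
   ((fun x : 'rV[R]_n => x ord0 j) @^-1` `[a ord0 j, b ord0 j])).
  apply: fin_bigcap_measurable => // j _.
  by rewrite -[X in measurable X]setTI; exact: measurable_rV_coord.
by apply/seteqP; split => x /= h j; [move=> _; exact: h|exact: h].
Qed.

Lemma lebesgue_rV_box (R : realType) n (a b : 'rV[R]_n) :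
  (forall j, a ord0 j <= b ord0 j) ->
  lebesgue_rV n [set x : 'rV[R]_n | forall j, x ord0 j \in `[a ord0 j, b ord0 j]] =
  (\prod_j (b ord0 j - a ord0 j))%:E.
Proof.
elim: n => [|n IH] in a b *; move=> ab.
  rewrite big_ord0 /= diracE mem_set//= => j; by case: j.
rewrite /= /lebesgue_step /pushforward.
pose a' : 'rV_n := \row_j a ord0 (rshift 1 j).
pose b' : 'rV_n := \row_j b ord0 (rshift 1 j).
rewrite (_ : (@rV_cons R n) @^-1` _ = `[a ord0 ord0, b ord0 ord0] `*`
   [set x : 'rV[R]_n | forall j, x ord0 j \in `[a' ord0 j, b' ord0 j]]).
  rewrite product_measure1E //=; last exact: measurable_rV_box.
  rewrite lebesgue_measure_itv/= lte_fin IH; last by move=> j; rewrite !mxE.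
  rewrite big_ord_recl /=.
  have -> : \prod_j (b' ord0 j - a' ord0 j) =
    \prod_(i < n) (b ord0 (lift ord0 i) - a ord0 (lift ord0 i)).
    apply: eq_bigr => i _; rewrite !mxE.
    by rewrite (_ : rshift 1 i = lift ord0 i)//; exact: val_inj.
  rewrite EFinM; congr mule; case: ltP => // ba.
  by rewrite (@le_anti _ _ (a ord0 ord0) (b ord0 ord0)) ?subrr// ab ba.
have l0 : lshift n (ord0 : 'I_1) = ord0 by exact: val_inj.
apply/seteqP; split => -[x y] /= => [h|[h0 hS] j].
  split; first by have := h ord0; rewrite -l0 rV_cons0.
  by move=> j; have := h (rshift 1 j); rewrite rV_consS !mxE.
rewrite -(splitK (j : 'I_(1 + n))); case: (fintype.split _) => i /=.
  by rewrite (ord1 i) rV_cons0 l0.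
by rewrite rV_consS; have := hS i; rewrite !mxE.
Qed.

Section linear_algebra.
Context {R : realType}.

Definition dotp n (u v : 'rV[R]_n) : R := (u *m v^T) ord0 ord0.

(* on row vectors this is the Euclidean norm *)
Definition frob m n (A : 'M[R]_(m, n)) : R := Num.sqrt (\tr (A^T *m A)).

Definition odot n (a b : 'rV[R]_n) : 'M[R]_n :=
  2^-1 *: (a^T *m b + b^T *m a).

Definition sym_mx n : set 'M[R]_n := [set A | A^T = A].

Definition skew_mx n : set 'M[R]_n := [set A | A^T = - A].

(* the eigenvalues, listed with multiplicity; the list is unique up to order,
   and it exists as soon as the characteristic polynomial splits over R, which
   is the case for symmetric matrices *)
Definition eigenvalues n (A : 'M[R]_n) : seq R :=
  xget [::] [set s | char_poly A = \prod_(l <- s) ('X - l%:P)].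

Definition sym_schatten n (A : 'M[R]_n) : R :=
  Num.sqrt (2^-1 * (\sum_(l <- eigenvalues A) `|l|) ^+ 2 +
            2^-1 * (\sum_(l <- eigenvalues A) l) ^+ 2).

Definition norm_on_sym n (N : 'M[R]_n -> R) : Prop :=
  [/\ forall A, sym_mx A -> 0 <= N A,
      forall A, sym_mx A -> N A = 0 -> A = 0,
      forall (c : R) A, sym_mx A -> N (c *: A) = `|c| * N A &
      forall A B, sym_mx A -> sym_mx B -> N (A + B) <= N A + N B].

End linear_algebra.

Section BD.
Context {R : realType} {n : nat}.
Local Notation E := 'rV[R]_n.
Implicit Types (Omega : set E) (u : E -> E) (phi : E -> R).

(* near each boundary point x0, Omega is the part of a ball lying below the
   graph of a Lipschitz function over the hyperplane orthogonal to nu; that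
   function is extended to R^n as a constant along nu *)
Definition lipschitz_boundary Omega : Prop :=
  forall x0, (closure Omega `\` Omega°) x0 ->
  exists (nu : E) (g : E -> R) (L r : R),
    [/\ frob nu = 1, 0 < r,
        forall x y, `|g x - g y| <= L * frob (x - y),
        forall x t, g (x + t *: nu) = g x &
        forall y, frob (y - x0) < r -> Omega y <-> dotp y nu < g y].

(* Functions on Omega are represented by functions on R^n, whose values outside
   Omega are irrelevant, and classes in L^1 by Borel representatives. *)
Definition L1 Omega u : Prop :=
  forall j, (lebesgue_rV n).-integrable Omega (fun x => (u x ord0 j)%:E).

Definition cvg_L1 Omega (u_ : nat -> E -> E) u : Prop :=
  (forall k, L1 Omega (u_ k)) /\
  (\int[lebesgue_rV n]_(x in Omega) (frob (u_ k x - u x))%:E)%E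
    @[k --> \oo] --> 0%E.

Definition partial (j : 'I_n) phi : E -> R :=
  fun x => 'D_(delta_mx ord0 j) phi x.

Definition smooth phi : Prop :=
  forall (s : seq 'I_n) x, differentiable (foldr partial phi s) x.

Definition test_function Omega phi : Prop :=
  let supp := closure [set x | phi x != 0] in
  [/\ smooth phi, compact supp & supp `<=` Omega].

Definition dist_gradient Omega u (i j : 'I_n) phi : R :=
  - \int[lebesgue_rV n]_(x in Omega) (u x ord0 i * partial j phi x).

Definition dist_sym_gradient Omega u (i j : 'I_n) phi : R :=
  2^-1 * (dist_gradient Omega u i j phi + dist_gradient Omega u j i phi).

Definition charge_integral (nu : {charge set E -> \bar R}) (D : set E) phi : R :=
  let hP := cid (Hahn_decomposition nu) in
  let hN := cid (svalP hP) in
  \int[jordan_pos (svalP hN)]_(x in D) phi x -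
  \int[jordan_neg (svalP hN)]_(x in D) phi x.

(* A bounded Radon measure on Omega is a finite signed Borel measure; it is
   represented by a charge on R^n of which only the values on Borel subsets of
   Omega are used. *)
Definition mx_charge := 'I_n -> 'I_n -> {charge set E -> \bar R}.

Definition mx_charge_val (mu : mx_charge) (B : set E) : 'M[R]_n :=
  \matrix_(i, j) fine (mu i j B).

Definition is_sym_gradient Omega u (mu : mx_charge) : Prop :=
  (forall B, measurable B -> sym_mx (mx_charge_val mu B)) /\
  (forall phi, test_function Omega phi -> forall i j,
     charge_integral (mu i j) Omega phi = dist_sym_gradient Omega u i j phi).

Definition BD Omega u : Prop :=
  L1 Omega u /\ exists mu, is_sym_gradient Omega u mu.

(* supremum over the finite Borel partitions of B *)
Definition variation (N : 'M[R]_n -> R) (mu : mx_charge) (B : set E) : \bar R :=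
  ereal_sup [set v | exists (k : nat) (F : 'I_k -> set E),
    [/\ forall i, measurable (F i),
        trivIset setT F,
        \bigcup_i F i = B &
        v = (\sum_(i < k) N (mx_charge_val mu (F i)))%:E]].

(* The choice of mu is immaterial: Eu determines mu on Borel subsets of the open
   set Omega. *)
Definition sym_gradient_variation (N : 'M[R]_n -> R) Omega u : \bar R :=
  if pselect (exists mu, is_sym_gradient Omega u mu) is left h
  then variation N (sval (cid h)) Omega
  else +oo%E.

Definition half_space (H : set E) : Prop :=
  exists (v : E) (c : R), v != 0 /\
    (H = [set x | dotp x v < c] \/ H = [set x | dotp x v <= c]).

Definition polyhedral (P : set E) : Prop :=
  exists (k : nat) (m : 'I_k -> nat) (H : forall i, 'I_(m i) -> set E),
    (forall i j, half_space (H i j)) /\ P = \bigcup_i \bigcap_j H i j.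

Definition PR u : Prop :=
  exists (P : nat -> set E) (A : nat -> 'M[R]_n) (b : nat -> E),
    [/\ forall i, polyhedral (P i),
        forall i j, i != j -> (P i)° `&` (P j)° = set0,
        \bigcup_i P i = setT,
        forall i, skew_mx (A i) &
        forall i, {ae lebesgue_rV n, forall x, P i x -> u x = x *m (A i)^T + b i}].

End BD.

(* Main.v *)
(* Write p and - q for the sums of the positive and of the negative eigenvalues
   of A, so that the Schatten norm of A is sqrt (p^2 + q^2).

   Upper bound: A is a sum of matrices x e_i e_i^T - y e_j e_j^T with
   x, y >= 0, and each of these is a symmetrized rank-one matrix, on which N is
   the Frobenius norm; with weights proportional to the products of a positive
   and a negative eigenvalue the Frobenius norms add up to sqrt (p^2 + q^2).

   Lower bound: the matrix C = (p P_+ - q P_-) / sqrt (p^2 + q^2), with P_+ and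
   P_- the spectral projections, satisfies <C, A> = sqrt (p^2 + q^2) and
   <C, a (.) b> <= |a (.) b|.  Approximate u(x) = A x on a cube by piecewise
   rigid u_k.  The measure E u_k vanishes in the interior of each piece, hence
   lives on countably many hyperplanes.  On {x . v = c} its values are of the
   form m (.) v: if C v = 0, then testing <C, E u_k> with phi chi_l, where the
   cut-off chi_l depends on x . v only and shrinks to the hyperplane, produces no
   derivative of chi_l, so that the limit vanishes.  Therefore
   <C, E u_k>(phi) <= N(E u_k) for all test functions 0 <= phi <= 1; the left side
   passes to the limit in L^1 and yields <C, A> |cube| <= N(A) |cube|. *)

Require Import Defs.
From HB Require Import structures.
From mathcomp Require Import all_boot all_order all_algebra.
From mathcomp Require Import all_classical all_reals all_analysis.
From mathcomp Require Import measurable_realfun ring lra.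

Set Implicit Arguments.
Unset Strict Implicit.
Unset Printing Implicit Defensive.

Import Order.TTheory GRing.Theory Num.Theory.
Import numFieldNormedType.Exports.
Local Open Scope classical_set_scope.
Local Open Scope ring_scope.

(** * Symmetric matrices and the Schatten norm *)

Section linear_algebra.
Context {R : realType}.

(** The obstacle is that [<C, M> <= N M] is available only for [M = odot a b]; for general symmetric
    [M] it would already give the claim at [M = A]. So the bound must be used on [E u_k], where the
    values are rank one, before the limit replaces [u_k] by the linear field. Two different matrices
    are called C in the outline. The one that pairs to [sqrt (p^2 + q^2)] is, for invertible [A],
    the gradient of that function at [A]. The one with [C v = 0] is an arbitrary test matrix: it
    serves to identify the values of [E u_k] on a hyperplane, since a symmetric matrix orthogonal to
    all such C has the form [odot m v]. The rank-one structure thus comes from duality, and the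
    pieces may accumulate inside the cube. The variation is a supremum over finite partitions, while
    the hyperplanes are countably many. Finitely many disjoint slices, completed by the rest of the
    cube, form an admissible partition, and countable additivity carries the bound to all slices. *)

Lemma dotpE n (u v : 'rV[R]_n) : dotp u v = \sum_j u ord0 j * v ord0 j.
Proof. by rewrite /dotp mxE; apply: eq_bigr => j _; rewrite mxE. Qed.

Lemma dotpC n (u v : 'rV[R]_n) : dotp u v = dotp v u.
Proof. by rewrite !dotpE; apply: eq_bigr => j _; rewrite mulrC. Qed.

Lemma dotpDl n (u v w : 'rV[R]_n) : dotp (u + v) w = dotp u w + dotp v w.
Proof. by rewrite /dotp mulmxDl mxE. Qed.

Lemma dotpZl n a (u w : 'rV[R]_n) : dotp (a *: u) w = a * dotp u w.
Proof. by rewrite /dotp -scalemxAl mxE. Qed.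

Lemma dotpDr n (u v w : 'rV[R]_n) : dotp w (u + v) = dotp w u + dotp w v.
Proof. by rewrite dotpC dotpDl !(dotpC w). Qed.

Lemma dotpZr n a (u w : 'rV[R]_n) : dotp w (a *: u) = a * dotp w u.
Proof. by rewrite dotpC dotpZl (dotpC w). Qed.

Lemma dotp_ge0 n (u : 'rV[R]_n) : 0 <= dotp u u.
Proof. by rewrite dotpE sumr_ge0// => j _; rewrite -expr2 sqr_ge0. Qed.

Lemma dotp_eq0 n (u : 'rV[R]_n) : dotp u u = 0 -> u = 0.
Proof.
rewrite dotpE => /eqP; rewrite psumr_eq0; last first.
  by move=> j _; rewrite -expr2 sqr_ge0.
move=> /allP h; apply/rowP => j; rewrite mxE.
by have := h j (mem_index_enum _); rewrite /= -expr2 sqrf_eq0 => /eqP.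
Qed.

Lemma dotp_mulmx n (u v : 'rV[R]_n) (A : 'M[R]_n) :
  dotp (u *m A) v = dotp u (v *m A^T).
Proof. by rewrite /dotp trmx_mul trmxK mulmxA. Qed.

Lemma mulmx_tr_row n (u v : 'rV[R]_n) : u *m v^T = (dotp u v)%:M.
Proof. by rewrite [LHS]mx11_scalar. Qed.

Lemma CS_sum (I : finType) (a b : I -> R) :
  (\sum_i a i * b i) ^+ 2 <= (\sum_i a i ^+ 2) * (\sum_i b i ^+ 2).
Proof.
set sa := \sum_i a i ^+ 2; set sb := \sum_i b i ^+ 2; set s := \sum_i a i * b i.
have sb0 : 0 <= sb by apply: sumr_ge0 => i _; rewrite sqr_ge0.
have [sb_eq0|sbn0] := eqVneq sb 0.
  suff -> : s = 0 by rewrite sb_eq0 expr0n mulr0.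
  rewrite /s big1// => i _.
  move/eqP : sb_eq0; rewrite psumr_eq0; last by move=> j _; rewrite sqr_ge0.
  move=> /allP/(_ i (mem_index_enum _)) /=; rewrite sqrf_eq0 => /eqP ->.
  by rewrite mulr0.
have sbp : 0 < sb by rewrite lt_neqAle eq_sym sbn0.
have : 0 <= \sum_i (sb * a i - s * b i) ^+ 2.
  by apply: sumr_ge0 => i _; rewrite sqr_ge0.
have -> : \sum_i (sb * a i - s * b i) ^+ 2 = sb * (sb * sa - s ^+ 2).
  have -> : \sum_i (sb * a i - s * b i) ^+ 2 =
     \sum_i (sb ^+ 2 * (a i ^+ 2) + (- (2 * sb * s)) * (a i * b i)
       + s ^+ 2 * b i ^+ 2) by apply: eq_bigr => i _; ring.
  by rewrite !big_split/= -!mulr_sumr -/sa -/sb -/s; ring.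
by rewrite pmulr_rge0// subr_ge0 mulrC.
Qed.

Lemma frob_ge0 m n (A : 'M[R]_(m, n)) : 0 <= frob A.
Proof. exact: sqrtr_ge0. Qed.

Lemma frobE m n (A : 'M[R]_(m, n)) :
  frob A = Num.sqrt (\sum_j \sum_i A i j ^+ 2).
Proof.
rewrite /frob /mxtrace; congr Num.sqrt; apply: eq_bigr => j _.
by rewrite mxE; apply: eq_bigr => i _; rewrite mxE expr2.
Qed.

Lemma frob_row n (u : 'rV[R]_n) : frob u = Num.sqrt (dotp u u).
Proof.
rewrite frobE dotpE; congr Num.sqrt; apply: eq_bigr => j _.
by rewrite big_ord1 expr2.
Qed.

Lemma normr_coord_le_frob n (u : 'rV[R]_n) j : `|u ord0 j| <= frob u.
Proof.
rewrite frob_row -[leLHS]sqrtr_sqr ler_sqrt ?dotp_ge0// dotpE (bigD1 j)//=.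
rewrite expr2 lerDl sumr_ge0// => i _.
by rewrite -expr2 sqr_ge0.
Qed.

(** The norm that carries the topology of row vectors is the maximum norm, whereas [frob] is the
    Euclidean one. *)
Lemma rV_norm_le n (u : 'rV[R]_n) r : 0 <= r ->
  (forall j, `|u ord0 j| <= r) -> `|u| <= r.
Proof.
move=> r0 ur; have uE : `|u| = mx_norm u by [].
rewrite uE; have [->//|/mx_norm_neq0[[i j] /= ->]] := eqVneq (mx_norm u) 0.
by rewrite (ord1 i); exact: ur.
Qed.

Lemma rV_coord_le n (u : 'rV[R]_n) j : `|u ord0 j| <= `|u|.
Proof.
have -> : `|u| = mx_norm u by [].
by rewrite mx_normrE; apply/bigmax_geP; right => /=; exists (ord0, j).
Qed.

Lemma odotE n (a b : 'rV[R]_n) i j :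
  odot a b i j = 2^-1 * (a ord0 i * b ord0 j + b ord0 i * a ord0 j).
Proof. by rewrite !mxE !big_ord1 !mxE. Qed.

Lemma odot_sym n (a b : 'rV[R]_n) : sym_mx (odot a b).
Proof.
by rewrite /sym_mx/=; apply/matrixP => i j; rewrite mxE !odotE; ring.
Qed.

Lemma frob_odot_sqr n (a b : 'rV[R]_n) :
  \sum_j \sum_i odot a b i j ^+ 2 =
  2^-1 * (dotp a a * dotp b b + dotp a b ^+ 2).
Proof.
have -> : \sum_j \sum_i odot a b i j ^+ 2 = \sum_j \sum_i
    (4^-1 * ((a ord0 i * a ord0 i) * (b ord0 j * b ord0 j)) +
     2^-1 * ((a ord0 i * b ord0 i) * (a ord0 j * b ord0 j)) +
     4^-1 * ((b ord0 i * b ord0 i) * (a ord0 j * a ord0 j))).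
  by apply: eq_bigr => j _; apply: eq_bigr => i _; rewrite odotE; field.
have E (x : R) (f g : 'I_n -> R) : \sum_j \sum_i x * (f i * g j) =
    x * ((\sum_i f i) * \sum_j g j).
  rewrite !mulr_sumr; apply: eq_bigr => j _.
  by rewrite -mulr_sumr -mulr_suml.
under eq_bigr do rewrite !big_split/=.
by rewrite !big_split/= !E -!dotpE; field.
Qed.

Lemma frob_odot n (a b : 'rV[R]_n) :
  frob (odot a b) = Num.sqrt (2^-1 * (dotp a a * dotp b b + dotp a b ^+ 2)).
Proof. by rewrite frobE frob_odot_sqr. Qed.

Lemma continuous_sumr (T : topologicalType) (I : Type) (r : seq I)
    (F : I -> T -> R) : (forall i, continuous (F i)) ->
  continuous (fun x => \sum_(i <- r) F i x).
Proof.
move=> cF x; elim: r => [|i r IH].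
  by under eq_fun do rewrite big_nil; exact: cvg_cst.
under eq_fun do rewrite big_cons.
by apply: cvgD; [exact: cF|exact: IH].
Qed.

Lemma continuous_mulr (T : topologicalType) (f g : T -> R) :
  continuous f -> continuous g -> continuous (fun x => f x * g x).
Proof. by move=> cf cg x; apply: cvgM; [exact: cf|exact: cg]. Qed.

Lemma dotp_continuous n (A : 'M[R]_n) :
  continuous (fun x : 'rV[R]_n => dotp (x *m A) x).
Proof.
rewrite (_ : (fun x : 'rV[R]_n => _) = (fun x : 'rV[R]_n =>
   \sum_j (\sum_k x ord0 k * A k j) * x ord0 j)).
  2: by apply/funext => y; rewrite dotpE; apply: eq_bigr => j _; rewrite mxE.
have c1 j : continuous (fun x : 'rV[R]_n => \sum_k x ord0 k * A k j).
  apply: continuous_sumr => k; apply: continuous_mulr => x.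
    exact: coord_continuous.
  exact: cst_continuous.
apply: continuous_sumr => j; apply: continuous_mulr => // x.
exact: coord_continuous.
Qed.

(* a maximizer of the Rayleigh quotient *)
Lemma sym_mx_eigenvector n (A : 'M[R]_n.+1) : sym_mx A ->
  exists l x, dotp x x = 1 /\ x *m A = l *: x.
Proof.
rewrite /sym_mx/= => symA.
pose K := [set x : 'rV[R]_n.+1 | dotp x x = 1].
have cK : compact K.
  apply: bounded_closed_compact.
    exists 1; split => // M M1 x /= Kx; apply/ltW; apply: le_lt_trans M1.
    apply: rV_norm_le => // j.
    by rewrite (le_trans (normr_coord_le_frob x j))// frob_row Kx sqrtr1.
  have := @closed_comp _ _ (fun x : 'rV[R]_n.+1 => dotp (x *m 1%:M) x) [set 1].
  under eq_fun do rewrite mulmx1.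
  apply; last exact: closed_eq.
  move=> x _; have := @dotp_continuous n.+1 1%:M x.
  by under eq_fun do rewrite mulmx1.
have K0 : K !=set0.
  exists (delta_mx ord0 ord0); rewrite /K/= dotpE (bigD1 ord0)//= big1.
    by rewrite !mxE !eqxx mulr1 addr0.
  by move=> j /negbTE j0; rewrite !mxE j0 andbF mulr0.
have [|x Kx xmax] := @compact_EVT_max _ R (fun x : 'rV[R]_n.+1 => dotp (x *m A) x) _ K0 cK.
  by apply: continuous_subspaceT; exact: dotp_continuous.
have {}Kx : dotp x x = 1 by move: Kx; rewrite inE.
set l := dotp (x *m A) x in xmax.
exists l, x; split => //.
have {}xmax y : 0 <= dotp (l *: y - y *m A) y.
  have [/eqP y0|yn0] := boolP (dotp y y == 0).
    by rewrite (dotp_eq0 y0) scaler0 mul0mx subrr /dotp mul0mx mxE.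
  have yp : 0 < dotp y y by rewrite lt_neqAle eq_sym yn0 dotp_ge0.
  have sp : 0 < Num.sqrt (dotp y y) by rewrite sqrtr_gt0.
  have := xmax ((Num.sqrt (dotp y y))^-1 *: y).
  rewrite inE /K/= dotpZl dotpZr mulrA -expr2 exprVn sqr_sqrtr ?dotp_ge0//.
  rewrite mulVf// => /(_ erefl).
  rewrite -scalemxAl dotpZl dotpZr mulrA -expr2 exprVn sqr_sqrtr ?dotp_ge0//.
  rewrite mulrC ler_pdivrMr// => h.
  by rewrite -scaleN1r dotpDl !dotpZl mulN1r subr_ge0.
(* [B] is positive semidefinite and vanishes at [(x, x)], so [x] lies in its kernel; this is the
   eigenvector equation. *)
pose B u v := dotp (l *: u - u *m A) v.
have BE u v : B u v = l * dotp u v - dotp (u *m A) v.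
  by rewrite /B -scaleN1r dotpDl !dotpZl mulN1r.
have BC u v : B u v = B v u by rewrite !BE dotp_mulmx symA !(dotpC u).
suff Bx y : B x y = 0.
  by apply/esym/subr0_eq/dotp_eq0; exact: Bx.
set b := B x y; set c := B y y.
have c0 : 0 <= c by exact: xmax.
have h t : 0 <= 2 * t * b + t ^+ 2 * c.
  have : 0 <= B (x + t *: y) (x + t *: y) by exact: xmax.
  suff -> : B (x + t *: y) (x + t *: y) =
     B x x + t * B x y + t * B y x + t ^+ 2 * B y y.
    have -> : B x x = 0 by rewrite BE Kx mulr1 subrr.
    by rewrite (BC y x) -/b -/c; move=> ?; lra.
  by rewrite !BE mulmxDl -scalemxAl !(dotpDl, dotpDr, dotpZl, dotpZr); ring.
have c1 : 0 < c + 1 by rewrite ltr_wpDl.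
(* This [t] makes the quadratic negative unless [b = 0]; the denominator is [c + 1] because [c] may
   vanish. *)
have := h (- b / (c + 1)).
have -> : 2 * (- b / (c + 1)) * b + (- b / (c + 1)) ^+ 2 * c =
  - (b ^+ 2 * ((c + 2) / (c + 1) ^+ 2)) by field; rewrite gt_eqF.
rewrite oppr_ge0 pmulr_lle0; last by rewrite divr_gt0 ?exprn_gt0// ltr_wpDl.
by move=> b2; apply/eqP; rewrite -sqrf_eq0 eq_le b2 sqr_ge0.
Qed.

(** The reflection along [x - e] exchanges the unit vectors [x] and [e]. Being a symmetric
    involution, it conjugates symmetric matrices to symmetric ones. *)
Lemma householder n (x : 'rV[R]_n.+1) : dotp x x = 1 ->
  exists Q : 'M[R]_n.+1, [/\ Q^T = Q, Q *m Q = 1%:M & delta_mx ord0 ord0 *m Q = x].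
Proof.
move=> x1; pose e : 'rV[R]_n.+1 := delta_mx ord0 ord0.
have e1 : dotp e e = 1.
  rewrite dotpE (bigD1 ord0)//= big1 ?mxE ?eqxx ?mulr1 ?addr0//.
  by move=> j /negbTE j0; rewrite !mxE j0 andbF mulr0.
have [xe|xe] := eqVneq x e.
  by exists 1%:M; split; rewrite ?trmx1 ?mulmx1.
pose w := x - e; pose k := dotp w w.
have k0 : k != 0 by apply: contra xe => /eqP/dotp_eq0/subr0_eq ->.
have kE : k = 2 - 2 * dotp e x.
  rewrite /k /w -scaleN1r !(dotpDl, dotpDr, dotpZl, dotpZr) x1 e1 (dotpC x e).
  ring.
have ewE : dotp e w = - (k / 2).
  by rewrite /w -scaleN1r dotpDr dotpZr e1 kE; field.
exists (1%:M - (2 / k) *: (w^T *m w)); split.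
- by rewrite linearB/= linearZ/= trmx_mul trmxK trmx1.
- set X := _ *: _; have XX : X *m X = X + X.
    rewrite /X -scalemxAl -scalemxAr.
    rewrite -[w^T *m w *m _]mulmxA (mulmxA w) mulmx_tr_row -/k mul_scalar_mx.
    rewrite -scalemxAr !scalerA -scalerDl; congr (_ *: _); field.
    exact: k0.
  rewrite mulmxBl !mulmxBr XX !mul1mx !mulmx1.
  by rewrite opprB addrK subrK.
rewrite mulmxBr mulmx1 -scalemxAr mulmxA mulmx_tr_row ewE mul_scalar_mx scalerA.
have -> : 2 / k * - (k / 2) = -1 by field.
by rewrite scaleN1r opprK /w addrC subrK.
Qed.

(** Deflation: conjugating by the reflection that takes the first basis vector to a unit eigenvector
    splits off a one-by-one block, and induction applies to the other block. The rows of [P] are the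
    eigenvectors. *)
Lemma sym_mx_diag n (A : 'M[R]_n) : sym_mx A ->
  exists (P : 'M[R]_n) (d : 'rV[R]_n),
    P *m P^T = 1%:M /\ A = P^T *m diag_mx d *m P.
Proof.
elim: n A => [|n IH] A symA.
  by exists 1%:M, 0; split; apply/matrixP => -[].
have [l [x [x1 xA]]] := sym_mx_eigenvector symA.
have [Q [QT QQ eQ]] := householder x1.
pose B : 'M[R]_(1 + n) := Q *m A *m Q.
have symB : B^T = B by rewrite !trmx_mul QT symA mulmxA.
have rB : delta_mx ord0 ord0 *m B = l *: delta_mx ord0 ord0 :> 'rV[R]_n.+1.
  by rewrite !mulmxA eQ xA -scalemxAl -eQ -mulmxA QQ mulmx1.
have B0 j : B ord0 j = l * (j == ord0)%:R.
  by have /rowP/(_ j) := rB; rewrite -rowE !mxE.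
have B0' j : B j ord0 = l * (j == ord0)%:R.
  by rewrite -B0 -[in LHS]symB mxE.
have : B = Q *m A *m Q by [].
clearbody B => BQ.
have l0 (i : 'I_1) : lshift n i = ord0 by apply: val_inj; rewrite ord1.
have r0 (i : 'I_n) : (rshift 1 i == ord0 :> 'I_(1 + n)) = false by [].
have BE : B = block_mx l%:M 0 0 (drsubmx B).
  rewrite -[LHS]submxK; congr block_mx; apply/matrixP => i j; rewrite !mxE.
  - by rewrite !l0 B0 eqxx mulr1 (ord1 i) (ord1 j) eqxx mulr1n.
  - by rewrite l0 B0 r0 mulr0.
  - by rewrite l0 B0' r0 mulr0.
have [|P [d [PP Pd]]] := IH (drsubmx B).
  by rewrite /sym_mx/= trmx_drsub symB.
pose P1 : 'M[R]_(1 + n) := block_mx 1%:M 0 0 P.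
have P1T : P1^T = block_mx 1%:M 0 0 P^T by rewrite tr_block_mx !trmx0 trmx1.
have PP1 : P1 *m P1^T = 1%:M.
  rewrite P1T mulmx_block !(mul0mx, mulmx0, mulmx1, addr0, add0r) PP.
  by rewrite -scalar_mx_block.
have PD1 : P1^T *m diag_mx (row_mx l%:M d) *m P1 = B.
  rewrite P1T diag_mx_row !mulmx_block.
  rewrite !(mul0mx, mulmx0, mulmx1, mul1mx, addr0, add0r) -Pd [RHS]BE.
  by congr block_mx; apply/matrixP => i j; rewrite !mxE !ord1 eqxx mulr1n.
exists (P1 *m Q : 'M[R]_n.+1), (row_mx l%:M d : 'rV[R]_n.+1); split.
  rewrite trmx_mul QT !mulmxA -(mulmxA P1) QQ mulmx1.
  exact: PP1.
rewrite trmx_mul QT.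
transitivity (Q *m B *m Q).
  by rewrite BQ !mulmxA QQ mul1mx -mulmxA QQ mulmx1.
by rewrite -PD1 !mulmxA.
Qed.

End linear_algebra.

(** * The Schatten norm in an eigenbasis: upper bound for [N] and dual matrix *)

Section schatten.
Context {R : realType}.

Definition mxdot n (C M : 'M[R]_n) : R := \sum_i \sum_j C i j * M i j.

Lemma mxdotE n (C M : 'M[R]_n) : mxdot C M = \tr (C^T *m M).
Proof.
rewrite /mxdot exchange_big/= /mxtrace; apply: eq_bigr => j _.
by rewrite mxE; apply: eq_bigr => i _; rewrite mxE.
Qed.

Lemma mxdot_diag_eq0 n (C : 'M[R]_n) : mxdot C C = 0 -> C = 0.
Proof.
have s0 i : 0 <= \sum_j C i j * C i j.
  by apply: sumr_ge0 => j _; rewrite -expr2 sqr_ge0.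
move=> /eqP; rewrite psumr_eq0// => /allP h; apply/matrixP => i j.
have := h i (mem_index_enum _); rewrite psumr_eq0; last first.
  by move=> k _; rewrite -expr2 sqr_ge0.
move=> /allP/(_ j (mem_index_enum _)).
by rewrite /= -expr2 sqrf_eq0 mxE => /eqP.
Qed.

Lemma mxdot_odot n (C : 'M[R]_n) a b : sym_mx C ->
  mxdot C (odot a b) = dotp (a *m C) b.
Proof.
move=> symC; have CE i j : C i j = C j i by rewrite -[in LHS]symC mxE.
transitivity (2^-1 * (\sum_i \sum_j C i j * (a ord0 i * b ord0 j)
    + \sum_i \sum_j C i j * (b ord0 i * a ord0 j))).
  rewrite -big_split/= mulr_sumr; apply: eq_bigr => i _.
  rewrite -big_split/= mulr_sumr; apply: eq_bigr => j _.
  by rewrite odotE; ring.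
set S := (X in X + _); have -> : \sum_i \sum_j C i j * (b ord0 i * a ord0 j) = S.
  rewrite exchange_big/=; apply: eq_bigr => i _; apply: eq_bigr => j _.
  by rewrite CE; ring.
transitivity S; first by field.
rewrite dotpE /S exchange_big/=.
apply: eq_bigr => j _; rewrite mxE mulr_suml; apply: eq_bigr => i _.
by ring.
Qed.

(* the compression of M to the orthogonal complement of v is symmetric and
   annihilates v, hence is orthogonal to M *)
Lemma odot_orthogonal n (M : 'M[R]_n) (v : 'rV[R]_n) : sym_mx M -> v != 0 ->
  (forall C, sym_mx C -> v *m C = 0 -> mxdot C M = 0) ->
  exists m, M = odot m v.
Proof.
move=> symM v0 h; set k := dotp v v.
have k0 : k != 0 by apply: contra v0 => /eqP/dotp_eq0 ->.
set V := v^T *m v; pose Q := 1%:M - k^-1 *: V.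
have symV : V^T = V by rewrite trmx_mul trmxK.
have QT : Q^T = Q by rewrite linearB/= linearZ/= symV trmx1.
have vV : v *m V = k *: v by rewrite mulmxA mulmx_tr_row mul_scalar_mx.
have vQ : v *m Q = 0.
  by rewrite mulmxBr mulmx1 -scalemxAr vV scalerA mulVf// scale1r subrr.
have VQ : V *m Q = 0 by rewrite -mulmxA vQ mulmx0.
have QQ : Q *m Q = Q.
  by rewrite [in LHS]/Q mulmxBl mul1mx -scalemxAl VQ scaler0 subr0.
have QMQ0 : Q *m M *m Q = 0.
  have symC : (Q *m M *m Q)^T = Q *m M *m Q by rewrite !trmx_mul QT symM mulmxA.
  have vC : v *m (Q *m M *m Q) = 0 by rewrite !mulmxA vQ !mul0mx.
  apply: mxdot_diag_eq0; rewrite -[RHS](h _ symC vC) !mxdotE symC.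
  by rewrite mulmxA mxtrace_mulC !mulmxA QQ -(mulmxA (Q *m M)) QQ.
set s := dotp (v *m M) v.
have VMV : V *m M *m V = s *: V.
  rewrite /V -!mulmxA (mulmxA M) (mulmxA v) (mulmxA v) mulmx_tr_row -/s.
  by rewrite mul_scalar_mx -scalemxAr.
(* Expanding [Q *m M *m Q = 0] gives [M = (V M + M V) / k - s V / k^2], and [m] is read off from
   this. *)
pose m := (2 / k) *: (v *m M) - (s / k ^+ 2) *: v; exists m.
have mT : m^T *m v = (2 / k) *: (M *m V) - (s / k ^+ 2) *: V.
  have -> : m^T = (2 / k) *: (v *m M)^T - (s / k ^+ 2) *: v^T.
    by apply/matrixP => i j; rewrite !mxE.
  by rewrite trmx_mul symM mulmxBl -!scalemxAl mulmxA.
have vm : v^T *m m = (2 / k) *: (V *m M) - (s / k ^+ 2) *: V.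
  by rewrite mulmxBr -!scalemxAr mulmxA.
rewrite /odot mT vm.
have QMQ : Q *m M *m Q =
    (M - k^-1 *: (V *m M)) - k^-1 *: (M *m V - k^-1 *: (s *: V)).
  rewrite /Q mulmxBl mul1mx -scalemxAl mulmxBr mulmx1 -scalemxAr mulmxBl.
  by rewrite -scalemxAl VMV.
rewrite -[LHS]subr0 -QMQ0 QMQ.
by apply/matrixP => i j; rewrite !mxE; field.
Qed.

(** [eigenvalues] is an arbitrary choice among the lists that factor the characteristic polynomial;
    by unique factorization a sum over it does not depend on the choice. *)
Lemma prod_XsubC_perm_eq (s t : seq R) :
  \prod_(x <- s) ('X - x%:P) = \prod_(x <- t) ('X - x%:P) -> perm_eq s t.
Proof.
elim: s t => [|a s IH] t st.
  have := congr1 (fun p : {poly R} => size p) st.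
  by rewrite !size_prod_XsubC => -[]; case: t {st}.
have at_ : a \in t.
  by rewrite -root_prod_XsubC -st root_prod_XsubC mem_head.
rewrite (permPr (perm_to_rem at_)) perm_cons; apply: IH.
move: st; rewrite big_cons (perm_big _ (perm_to_rem at_)) big_cons.
by apply: mulfI; rewrite polyXsubC_eq0.
Qed.

Lemma char_poly_diag n (P : 'M[R]_n) (d : 'rV[R]_n) : P *m P^T = 1%:M ->
  char_poly (P^T *m diag_mx d *m P) = \prod_j ('X - (d ord0 j)%:P).
Proof.
move=> PP; have PP' : P^T *m P = 1%:M by apply: mulmx1C.
pose Q := map_mx polyC P; pose D := diag_mx d.
have QT : Q^T = map_mx polyC P^T by apply/matrixP => i j; rewrite !mxE.
have QQ : Q^T *m Q = 1%:M by rewrite QT /Q -map_mxM PP' map_mx1.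
have E : char_poly_mx (P^T *m D *m P) = Q^T *m char_poly_mx D *m Q.
  rewrite /char_poly_mx mulmxBr mulmxBl mul_mx_scalar -scalemxAl QQ scalemx1.
  by rewrite QT /Q -!map_mxM.
rewrite /char_poly E !det_mulmx mulrC mulrA -det_mulmx (mulmx1C QQ) det1 mul1r.
rewrite -/(char_poly D) char_poly_trig; last exact: diag_mx_is_trig.
by apply: eq_bigr => j _; rewrite /D mxE eqxx mulr1n.
Qed.

Lemma sum_eigenvalues n (P : 'M[R]_n) (d : 'rV[R]_n) (f : R -> R) :
  P *m P^T = 1%:M ->
  \sum_(l <- eigenvalues (P^T *m diag_mx d *m P)) f l = \sum_j f (d ord0 j).
Proof.
move=> PP; rewrite -(big_map (fun j => d ord0 j) xpredT f).
apply: perm_big; rewrite /eigenvalues; case: xgetP => [s _ /= sE|/(_ _)].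
  by apply: prod_XsubC_perm_eq; rewrite -sE char_poly_diag// big_map.
(* The default value of [xget] is excluded: the diagonal entries provide a factorization. *)
move=> /(_ [seq d ord0 j | j <- index_enum 'I_n]); apply: contra_notP => _ /=.
by rewrite big_map char_poly_diag.
Qed.

Section diagonalized.
Variables (n : nat) (P : 'M[R]_n) (d : 'rV[R]_n).
Hypothesis PP : P *m P^T = 1%:M.
Let A := P^T *m diag_mx d *m P.
Let pos := \sum_j Num.max (d ord0 j) 0.
Let neg := \sum_j Num.max (- d ord0 j) 0.

Lemma posnegE x : x = Num.max x 0 - Num.max (- x) 0 :> R.
Proof. by case: (ltrP 0 x) => ?; case: (ltrP 0 (- x)) => ?; lra. Qed.

Lemma pos_ge0 : 0 <= pos.
Proof. by apply: sumr_ge0 => j _; rewrite le_max lexx orbT. Qed.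

Lemma neg_ge0 : 0 <= neg.
Proof. by apply: sumr_ge0 => j _; rewrite le_max lexx orbT. Qed.

(** The absolute eigenvalues add up to [pos + neg] and the eigenvalues to [pos - neg]; the
    parallelogram identity removes the cross terms. *)
Lemma sym_schatten_diag : sym_schatten A = Num.sqrt (pos ^+ 2 + neg ^+ 2).
Proof.
rewrite /sym_schatten !sum_eigenvalues//; congr Num.sqrt.
have -> : \sum_j `|d ord0 j| = pos + neg.
  rewrite -big_split/=; apply: eq_bigr => j _.
  have [d0|d0] := ltrP 0 (d ord0 j).
    by rewrite gtr0_norm// max_r ?addr0// oppr_le0 ltW.
  by rewrite ler0_norm// max_l ?add0r// oppr_ge0.
have -> : \sum_j d ord0 j = pos - neg.
  by rewrite -sumrB; apply: eq_bigr => j _; rewrite {1}(posnegE (d ord0 j)).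
by field.
Qed.

Lemma dotp_row i j : dotp (row i P) (row j P) = (i == j)%:R.
Proof.
have /matrixP/(_ i j) := PP; rewrite !mxE => <-.
by rewrite dotpE; apply: eq_bigr => k _; rewrite !mxE.
Qed.

Lemma diag_sum (b : 'rV[R]_n) :
  P^T *m diag_mx b *m P = \sum_i b ord0 i *: odot (row i P) (row i P).
Proof.
apply/matrixP => i j; rewrite summxE mxE; apply: eq_bigr => k _.
by rewrite [in RHS]mxE odotE mul_mx_diag !mxE; field.
Qed.

Section norm.
Variable N : 'M[R]_n -> R.
Hypothesis normN : norm_on_sym N.
Hypothesis N_odot : forall a b : 'rV[R]_n, N (odot a b) = frob (odot a b).

Lemma sym_mxZ c (M : 'M[R]_n) : sym_mx M -> sym_mx (c *: M).
Proof. by rewrite /sym_mx/= linearZ/= => ->. Qed.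

Lemma sym_mxD (M M' : 'M[R]_n) : sym_mx M -> sym_mx M' -> sym_mx (M + M').
Proof. by rewrite /sym_mx/= linearD/= => -> ->. Qed.

Lemma sym_mx0 : sym_mx (0 : 'M[R]_n).
Proof. by rewrite /sym_mx/= trmx0. Qed.

Lemma sym_mx_sum (I : Type) (r : seq I) (F : I -> 'M[R]_n) :
  (forall i, sym_mx (F i)) -> sym_mx (\sum_(i <- r) F i).
Proof.
move=> symF; elim/big_ind : _ => //; [exact: sym_mx0|exact: sym_mxD].
Qed.

Lemma norm0 : N 0 = 0.
Proof.
case: normN => _ _ NZ _.
by rewrite -(scale0r (0 : 'M[R]_n)) NZ ?normr0 ?mul0r//; exact: sym_mx0.
Qed.

Lemma norm_sum (I : Type) (r : seq I) (F : I -> 'M[R]_n) :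
  (forall i, sym_mx (F i)) -> N (\sum_(i <- r) F i) <= \sum_(i <- r) N (F i).
Proof.
case: normN => _ _ _ ND symF; elim: r => [|i r IH].
  by rewrite !big_nil norm0.
rewrite !big_cons (le_trans (ND _ _ _ _))// ?lerD2l//.
exact: sym_mx_sum.
Qed.

Let E i := odot (row i P) (row i P).

Lemma norm_odot_row i : N (E i) = 1.
Proof.
rewrite N_odot frob_odot dotp_row eqxx mulr1 expr1n.
by rewrite (_ : 2^-1 * (1 + 1) = 1) ?sqrtr1//; field.
Qed.

(* [a odot b] with [a = sqrt x e_i + sqrt y e_j] and [b = sqrt x e_i - sqrt y e_j] *)
Lemma norm_odot_sub i j x y : i != j -> 0 <= x -> 0 <= y ->
  N (x *: E i - y *: E j) = Num.sqrt (x ^+ 2 + y ^+ 2).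
Proof.
move=> ij x0 y0; set u := Num.sqrt x; set v := Num.sqrt y.
have uE : u ^+ 2 = x by rewrite sqr_sqrtr.
have vE : v ^+ 2 = y by rewrite sqr_sqrtr.
pose a := u *: row i P + v *: row j P; pose b := u *: row i P + (- v) *: row j P.
have -> : x *: E i - y *: E j = odot a b.
  apply/matrixP => k l; rewrite -uE -vE odotE !mxE !big_ord1 !mxE.
  by field.
rewrite N_odot frob_odot /a /b !(dotpDl, dotpDr, dotpZl, dotpZr).
rewrite !dotp_row !eqxx (negbTE ij) eq_sym (negbTE ij); congr Num.sqrt.
by rewrite -uE -vE /= mulr1n mulr0n; field.
Qed.

Lemma norm_le_sym_schatten : N A <= sym_schatten A.
Proof.
case: (normN) => _ _ NZ ND.
pose dp i := Num.max (d ord0 i) 0; pose dm i := Num.max (- d ord0 i) 0.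
have dp0 i : 0 <= dp i by rewrite le_max lexx orbT.
have dm0 i : 0 <= dm i by rewrite le_max lexx orbT.
have symE i : sym_mx (E i) by exact: odot_sym.
have AE : A = \sum_i dp i *: E i - \sum_i dm i *: E i.
  rewrite /A diag_sum -sumrB; apply: eq_bigr => i _.
  by rewrite -scalerBl {1}(posnegE (d ord0 i)).
have nneg (f : 'I_n -> R) : (forall i, 0 <= f i) -> N (\sum_i f i *: E i) <= \sum_i f i.
  move=> f0; apply: le_trans (norm_sum _ _) _ => [i|]; first exact: sym_mxZ.
  by apply: ler_sum => i _; rewrite NZ// norm_odot_row mulr1 ger0_norm.
rewrite sym_schatten_diag.
have S0 (f : 'I_n -> R) : (forall i, 0 <= f i) -> \sum_i f i = 0 -> forall i, f i = 0.
  move=> f0 /eqP; rewrite psumr_eq0// => /allP h i.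
  by apply/eqP; exact: h (mem_index_enum _).
(* The weights below divide by [p] and [q]. If one of them vanishes, [A] is semidefinite and the
   triangle inequality over the spectral decomposition suffices. *)
have [p0|pn0] := eqVneq pos 0.
  rewrite AE big1 ?sub0r; last by move=> i _; rewrite (S0 _ dp0)// scale0r.
  rewrite -scaleN1r NZ; last by apply: sym_mx_sum => i; exact: sym_mxZ.
  rewrite normrN1 mul1r p0 expr0n add0r sqrtr_sqr ger0_norm ?neg_ge0//.
  exact: nneg.
have [q0|qn0] := eqVneq neg 0.
  rewrite AE [X in _ - X]big1 ?subr0; last by move=> i _; rewrite (S0 _ dm0)// scale0r.
  rewrite q0 expr0n addr0 sqrtr_sqr ger0_norm ?pos_ge0//.
  exact: nneg.
set p := pos in pn0 *; set q := neg in qn0 *.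
have p0 : 0 < p by rewrite lt_neqAle eq_sym pn0 pos_ge0.
have q0 : 0 < q by rewrite lt_neqAle eq_sym qn0 neg_ge0.
set S := Num.sqrt _.
have SS : S ^+ 2 = p ^+ 2 + q ^+ 2 by rewrite sqr_sqrtr// addr_ge0 ?sqr_ge0.
(* The sum over [j] must restore [dp i *: E i] and the sum over [i] must restore [dm j *: E j],
   which dictates the divisors [q] and [p]. Then [N (G i j) = dp i * dm j * sqrt (1/q^2 + 1/p^2)],
   and these add up to [S]. *)
pose G i j := (dp i * dm j / q) *: E i - (dp i * dm j / p) *: E j.
have symG i j : sym_mx (G i j).
  by rewrite /G -scaleNr; apply: sym_mxD; exact: sym_mxZ.
have {}AE : A = \sum_i \sum_j G i j.
  rewrite AE; under [RHS]eq_bigr do rewrite sumrB; rewrite sumrB; congr (_ - _).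
    apply: eq_bigr => i _; rewrite -scaler_suml; congr (_ *: _).
    by rewrite -mulr_suml -mulr_sumr -/neg -/q mulfK.
  rewrite exchange_big/=; apply: eq_bigr => j _; rewrite -scaler_suml.
  by rewrite -mulr_suml -mulr_suml -/pos -/p; congr (_ *: _); field.
rewrite AE; apply: le_trans (norm_sum _ _) _; first by move=> i; exact: sym_mx_sum.
apply: (@le_trans _ _ (\sum_i \sum_j (dp i * dm j * (S / (p * q))))).
  apply: ler_sum => i _; apply: le_trans (norm_sum _ _) _ => //.
  apply: ler_sum => j _.
  have c0 : 0 <= dp i * dm j * (S / (p * q)).
    by rewrite !mulr_ge0// ?sqrtr_ge0// invr_ge0 mulr_ge0// ltW.
  (* On the diagonal [G] vanishes, an eigenvalue having no positive and negative part at once; the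
     rank-one identity covers only distinct indices. *)
  have [ij|ij] := eqVneq i j.
    rewrite /G -ij; suff -> : dp i * dm i = 0.
      by rewrite !mul0r !scale0r subrr norm0.
    rewrite /dp /dm; have [di|di] := ltrP 0 (d ord0 i); last by rewrite mul0r.
    by rewrite [X in _ * X]max_r ?mulr0// oppr_le0 ltW.
  rewrite norm_odot_sub//; try by rewrite !mulr_ge0// invr_ge0 ltW.
  rewrite -[leRHS]ger0_norm// -[leRHS]sqrtr_sqr ler_wsqrtr//.
  rewrite !exprMn !exprVn SS le_eqVlt; apply/orP; left; apply/eqP.
  by field; rewrite pn0 qn0.
under eq_bigr do rewrite -mulr_suml -mulr_sumr -/neg -/q.
rewrite -!mulr_suml -/pos -/p le_eqVlt; apply/orP; left; apply/eqP.
by field; rewrite pn0 qn0.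
Qed.

End norm.

(** Split the inner product of [a] and [b], in the eigenbasis, into [x + y] according to the sign of
    the eigenvalue. The pairing is [(p x - q y) / S <= sqrt (x^2 + y^2)], and [x^2 + y^2] is the
    mean of [(x + y)^2] and [(x - y)^2]. The former is [(dotp a b)^2]; the latter is at most
    [|a|^2 |b|^2] by Cauchy-Schwarz, since flipping signs of coordinates of [a] preserves its
    length. The result is the squared Frobenius norm of [odot a b]. *)
Lemma sym_schatten_dual_diag : 0 < sym_schatten A ->
  exists B, [/\ sym_mx B, mxdot B A = sym_schatten A &
    forall a b, mxdot B (odot a b) <= frob (odot a b)].
Proof.
rewrite sym_schatten_diag; set p := pos; set q := neg; set S := Num.sqrt _ => S0.
have SS : S ^+ 2 = p ^+ 2 + q ^+ 2 by rewrite sqr_sqrtr// addr_ge0 ?sqr_ge0.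
have Sn0 : S != 0 by rewrite gt_eqF.
pose c : 'rV[R]_n := \row_i (if 0 <= d ord0 i then p / S else - (q / S)).
pose B := P^T *m diag_mx c *m P.
have symB : sym_mx B by rewrite /sym_mx/= !trmx_mul trmxK tr_diag_mx mulmxA.
exists B; split => //.
  have -> : mxdot B A = \sum_i c ord0 i * d ord0 i.
    rewrite mxdotE symB /B /A !mulmxA -(mulmxA (P^T *m diag_mx c)) PP mulmx1.
    rewrite mxtrace_mulC !mulmxA PP mul1mx mulmx_diag mxtrace_diag.
    by apply: eq_bigr => i _; rewrite mxE.
  transitivity ((p ^+ 2 + q ^+ 2) / S); last first.
    by rewrite -SS expr2 mulfK.
  rewrite (_ : p ^+ 2 = p * pos)// (_ : q ^+ 2 = q * neg)// /pos /neg !mulr_sumr.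
  rewrite -big_split/= mulr_suml; apply: eq_bigr => i _; rewrite mxE.
  case: (lerP 0 (d ord0 i)) => di.
    by rewrite [Num.max (- _) _]max_r ?oppr_le0//; field.
  by rewrite [Num.max (- _) _]max_l ?oppr_ge0 ?(ltW di)//; field.
move=> a b; rewrite mxdot_odot// frob_odot.
pose f i := (a *m P^T) ord0 i; pose g i := (b *m P^T) ord0 i.
have PP' : P^T *m P = 1%:M by apply: mulmx1C.
have dE (u v : 'rV[R]_n) : dotp u v = dotp (u *m P^T) (v *m P^T).
  by rewrite dotp_mulmx trmxK -mulmxA PP' mulmx1.
have -> : dotp (a *m B) b = \sum_i c ord0 i * (f i * g i).
  rewrite dotp_mulmx symB /B !mulmxA dotpC dotp_mulmx dotpC dotpE.
  by apply: eq_bigr => i _; rewrite mul_mx_diag [X in _ * X = _]mxE /f /g; ring.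
have -> : dotp a a = \sum_i f i ^+ 2.
  by rewrite dE dotpE; apply: eq_bigr => i _; rewrite expr2.
have -> : dotp b b = \sum_i g i ^+ 2.
  by rewrite dE dotpE; apply: eq_bigr => i _; rewrite expr2.
rewrite (dE a b) dotpE.
pose x := \sum_i if 0 <= d ord0 i then f i * g i else 0.
pose y := \sum_i if 0 <= d ord0 i then 0 else f i * g i.
have -> : \sum_i c ord0 i * (f i * g i) = (p * x - q * y) / S.
  rewrite /x /y !mulr_sumr -sumrB mulr_suml; apply: eq_bigr => i _; rewrite mxE.
  by case: ifP => _; field.
have -> : \sum_j (a *m P^T) ord0 j * (b *m P^T) ord0 j = x + y.
  by rewrite /x /y -big_split/=; apply: eq_bigr => i _; case: ifP => _; rewrite ?addr0 ?add0r.
have xy : (x - y) ^+ 2 <= (\sum_i f i ^+ 2) * (\sum_i g i ^+ 2).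
  have -> : x - y = \sum_i (if 0 <= d ord0 i then f i else - f i) * g i.
    rewrite /x /y -sumrB; apply: eq_bigr => i _.
    by case: ifP => _; rewrite ?subr0 ?sub0r ?mulNr.
  apply: le_trans (CS_sum _ _) _; rewrite le_eqVlt; apply/orP; left; apply/eqP.
  by congr (_ * _); apply: eq_bigr => i _; case: ifP; rewrite ?sqrrN.
apply: le_trans (ler_norm _) _; rewrite -[leLHS]sqrtr_sqr ler_wsqrtr//.
apply: (@le_trans _ _ (x ^+ 2 + y ^+ 2)); last by lra.
rewrite exprMn exprVn SS ler_pdivrMr -?SS ?exprn_gt0// SS -subr_ge0.
rewrite (_ : _ - _ = (p * y + q * x) ^+ 2) ?sqr_ge0//; ring.
Qed.

End diagonalized.

Lemma norm_le_schatten n (N : 'M[R]_n -> R) (A : 'M[R]_n) : norm_on_sym N ->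
  (forall a b : 'rV[R]_n, N (odot a b) = frob (odot a b)) ->
  sym_mx A -> N A <= sym_schatten A.
Proof.
move=> normN N_odot /sym_mx_diag[P [d [PP ->]]].
exact: norm_le_sym_schatten.
Qed.

Lemma sym_schatten_dual n (A : 'M[R]_n) : sym_mx A -> 0 < sym_schatten A ->
  exists B, [/\ sym_mx B, mxdot B A = sym_schatten A &
    forall a b, mxdot B (odot a b) <= frob (odot a b)].
Proof.
move=> /sym_mx_diag[P [d [PP ->]]]; exact: sym_schatten_dual_diag.
Qed.

End schatten.

(** * Signed measures and charge integrals *)

Lemma cvg_sumr (R : realType) (S : Type) (F : set_system S) (FF : Filter F)
    (I : Type) (r : seq I) (u : I -> S -> R) (a : I -> R) :
  (forall i, u i x @[x --> F] --> a i) ->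
  \sum_(i <- r) u i x @[x --> F] --> \sum_(i <- r) a i.
Proof.
move=> ua; elim: r => [|i r IH].
  rewrite big_nil (_ : (fun x => _) = cst 0); first exact: cvg_cst.
  by apply/funext => x; rewrite big_nil.
rewrite big_cons (_ : (fun x => _) = (fun x => u i x + \sum_(i <- r) u i x)).
  by apply: cvgD; [exact: ua|exact: IH].
by apply/funext => x; rewrite big_cons.
Qed.

Section signed_additive.
Context d (T : measurableType d) (R : realType).
Implicit Types (lam : set T -> R) (A B D K Z : set T).

(** The real-valued counterpart of a charge, as a predicate: linear combinations of matrix entries
    and restrictions inherit it without a new charge being built. *)
Definition signed_additive lam :=
  [/\ lam set0 = 0,
      forall A B, measurable A -> measurable B -> A `&` B = set0 ->
        lam (A `|` B) = lam A + lam B &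
      forall F : (set T)^nat, (forall k, measurable (F k)) -> trivIset setT F ->
        (\sum_(k < m) lam (F k)) @[m --> \oo] --> lam (\bigcup_k F k)].

Lemma signed_additive_charge (nu : {charge set T -> \bar R}) :
  signed_additive (fun B => fine (nu B)).
Proof.
split.
- by rewrite charge0.
- by move=> A B mA mB AB; rewrite chargeU// fineD// fin_num_measure.
- move=> F mF tF; have mUF : measurable (\bigcup_k F k) by exact: bigcup_measurable.
  have := @charge_semi_sigma_additive _ _ _ nu F mF tF mUF.
  rewrite -[nu (\bigcup_n F n)]fineK ?fin_num_measure// => /fine_cvg.
  apply: cvg_trans; apply: near_eq_cvg; near=> m => /=.
  rewrite -sum_fine ?big_mkord// => i _; exact: fin_num_measure.
Unshelve. all: by end_near. Qed.

Lemma signed_additiveZ (c : R) lam :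
  signed_additive lam -> signed_additive (fun B => c * lam B).
Proof.
move=> [l0 lU lF]; split=> [|A B mA mB AB|F mF tF].
- by rewrite l0 mulr0.
- by rewrite lU// mulrDr.
- under eq_fun do rewrite -mulr_sumr.
  by apply: cvgMr; exact: lF.
Qed.

Lemma signed_additive_sum (I : Type) (r : seq I) (lam : I -> set T -> R) :
  (forall i, signed_additive (lam i)) ->
  signed_additive (fun B => \sum_(i <- r) lam i B).
Proof.
move=> h; split=> [|A B mA mB AB|F mF tF].
- by rewrite big1// => i _; have [] := h i.
- by rewrite -big_split/=; apply: eq_bigr => i _; have [_ ->] := h i.
- rewrite (_ : (fun m => _) =
      (fun m : nat => \sum_(i <- r) \sum_(k < m) lam i (F k))).
    by apply: cvg_sumr => i; have [_ _] := h i; exact.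
  by apply/funext => m; rewrite exchange_big.
Qed.

Lemma signed_additive_restr lam K : measurable K ->
  signed_additive lam -> signed_additive (fun B => lam (B `&` K)).
Proof.
move=> mK [l0 lU lF]; split=> [|A B mA mB AB|F mF tF].
- by rewrite set0I.
- rewrite setIUl lU//; [exact: measurableI|exact: measurableI|].
  by rewrite setIACA AB set0I.
- rewrite setI_bigcupl; apply: lF => [k|]; first exact: measurableI.
  exact: trivIset_setIr.
Qed.

(** For a signed [lam], the value zero on [Z] does not pass to subsets; this is the vanishing of the
    total variation on [Z]. *)
Definition null_on lam Z := forall B, measurable B -> B `<=` Z -> lam B = 0.

Lemma null_on_bigcup lam (Z : (set T)^nat) : signed_additive lam ->
  (forall m, measurable (Z m)) -> (forall m, null_on lam (Z m)) ->
  null_on lam (\bigcup_m Z m).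
Proof.
move=> [_ _ lF] mZ nZ B mB BZ.
have BE : B = \bigcup_m (B `&` seqDU Z m).
  by rewrite -setI_bigcupr -seqDU_bigcup_eq; apply/esym/setIidPl.
have mS m : measurable (seqDU Z m).
  by apply: measurableD => //; exact: bigsetU_measurable.
have := lF (fun m => B `&` seqDU Z m) (fun m => measurableI _ _ mB (mS m)).
rewrite -BE => /(_ (trivIset_setIl (trivIset_seqDU Z))).
rewrite (_ : (fun m : nat => \sum_(k < m) _) = cst 0).
  by move=> h; apply/esym; exact: (cvg_unique _ (@cvg_cst _ _ _ _ _) h).
apply/funext => m; rewrite big1// => k _; apply: nZ; first exact: measurableI.
exact: subset_trans (@subIsetr _ _ _) (@subDsetl _ _ _).
Qed.

Lemma signed_additiveDI lam A B : signed_additive lam ->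
  measurable A -> measurable B -> lam A = lam (A `&` B) + lam (A `\` B).
Proof.
move=> [_ lU _] mA mB; rewrite -lU; first by rewrite setUIDK.
- exact: measurableI.
- exact: measurableD.
- by rewrite setDE setIACA setICr setI0.
Qed.

(** The sets on which [lam] vanishes form a Dynkin class; stability under complements comes from
    [lam setT = 0]. *)
Lemma signed_additive_eq0 lam (G : set (set T)) : signed_additive lam ->
  @measurable _ T = <<s G >> -> setI_closed G -> lam setT = 0 ->
  (forall A, G A -> lam A = 0) -> forall B, measurable B -> lam B = 0.
Proof.
move=> sl mG GI lT lG B; rewrite mG; move: B.
apply: (dynkin_induction mG GI) => //.
- move=> S mS lS; have := signed_additiveDI sl measurableT mS.
  by rewrite lT setTI lS add0r setTD => <-.
- move=> F mF tF lF; have [_ _ /(_ F mF tF)] := sl.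
  rewrite (_ : (fun m : nat => \sum_(k < m) _) = cst 0).
    by move=> h; apply/esym; exact: (cvg_unique _ (@cvg_cst _ _ _ _ _) h).
  by apply/funext => m; rewrite big1.
Qed.

(** Turns a bound on finitely many disjoint slices, the form that a variation over finite partitions
    can supply, into a bound on a set covered by countably many of them up to a null set. *)
Lemma signed_additive_le lam (K : (set T)^nat) Z G V : signed_additive lam ->
  (forall m, measurable (K m)) -> measurable G -> measurable Z ->
  null_on lam Z -> G `<=` Z `|` \bigcup_m K m ->
  (forall m, \sum_(k < m) lam (G `&` seqDU K k) <= V) -> lam G <= V.
Proof.
move=> sl mK mG mZ nZ GZK bnd; have [_ _ lF] := sl.
have mU : measurable (\bigcup_m K m) by exact: bigcup_measurable.
have mS m : measurable (seqDU K m).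
  by apply: measurableD => //; exact: bigsetU_measurable.
rewrite (signed_additiveDI sl mG mU) (nZ (_ `\` _)) ?addr0; last 2 first.
- exact: measurableD.
- by move=> x [/GZK[//|]].
have := lF (fun m => G `&` seqDU K m) (fun m => measurableI _ _ mG (mS m)).
rewrite -setI_bigcupr -seqDU_bigcup_eq.
move=> /(_ (trivIset_setIl (trivIset_seqDU K))) h.
rewrite -(cvg_lim _ h)//; apply: limr_le; first by apply: cvgP h.
by apply: nearW => m; exact: bnd.
Qed.

End signed_additive.

(** * Integration of bounded functions against charges *)

Section bounded_measurable.
Context d (T : measurableType d) (R : realType).
Implicit Types (f g : T -> R) (D : set T).

Definition bounded_measurable f :=
  measurable_fun setT f /\ exists M, forall x, `|f x| <= M.

Lemma bounded_measurable_integrable (mu : {finite_measure set T -> \bar R}) D f :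
  measurable D -> bounded_measurable f -> mu.-integrable D (EFin \o f).
Proof.
move=> mD [mf [M fM]]; apply: (measurable_bounded_integrable mD).
- by rewrite ltey_eq fin_num_measure.
- exact: measurable_funTS.
- exists M; split; first exact: num_real.
  by move=> N MN x _ /=; apply: le_trans (fM x) (ltW MN).
Qed.

Lemma Rintegral_dominated_cvg (mu : {measure set T -> \bar R}) D
    (f_ : nat -> T -> R) f g : measurable D ->
  (forall k, measurable_fun D (f_ k)) -> measurable_fun D f ->
  (forall x, D x -> f_ k x @[k --> \oo] --> f x) ->
  mu.-integrable D (EFin \o g) ->
  (forall k x, D x -> `|f_ k x| <= g x) ->
  \int[mu]_(x in D) f_ k x @[k --> \oo] --> \int[mu]_(x in D) f x.
Proof.
move=> mD mf_ mf f_f ig f_g.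
have mE h : measurable_fun D h -> measurable_fun D (EFin \o h).
  by move=> mh; exact/measurable_EFinP.
have [|||||iF _] := @dominated_convergence _ _ _ mu D mD
  (fun k => EFin \o f_ k) (EFin \o f) (EFin \o g).
- by move=> k; exact: mE.
- exact: mE.
- by apply: aeW => x Dx; apply: cvg_EFin; [exact: nearW|exact: f_f].
- exact: ig.
- by apply: aeW => x k Dx; rewrite lee_fin; exact: f_g.
rewrite -[X in _ --> X -> _]fineK; first by move/fine_cvg.
exact: integrable_fin_num.
Qed.

End bounded_measurable.

Section charge_integral.
Context {R : realType} {n : nat}.
Local Notation E := 'rV[R]_n.
Implicit Types (nu : {charge set E -> \bar R}) (D B : set E) (f g : E -> R).

(** Exposes the Hahn decomposition that [charge_integral] chooses; a single one serves all [D] and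
    [f], so that linearity and limits reduce to two finite measures. *)
Lemma charge_integral_jordan nu : exists P Q (h : hahn_decomposition nu P Q),
  forall D f, charge_integral nu D f =
    \int[jordan_pos h]_(x in D) f x - \int[jordan_neg h]_(x in D) f x.
Proof.
by exists _, _, (svalP (cid (svalP (cid (Hahn_decomposition nu))))).
Qed.

(** If [p] and [q] are the Jordan parts, then [p + mu2 = q + mu1] as measures, and the integrals
    against both sides agree. This frees explicit computations from the chosen decomposition. *)
Lemma charge_integralE nu D f (mu1 mu2 : {finite_measure set E -> \bar R}) :
  measurable D -> bounded_measurable f ->
  (forall B, measurable B -> nu B = (mu1 B - mu2 B)%E) ->
  charge_integral nu D f =
    \int[mu1]_(x in D) f x - \int[mu2]_(x in D) f x.
Proof.
move=> mD bf nuE; have [P [Q [h ->]]] := charge_integral_jordan nu.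
set p := jordan_pos h; set q := jordan_neg h.
have pqE B : measurable B -> (p B + mu2 B = q B + mu1 B)%E.
  move=> mB; have pf : p B \is a fin_num by exact: fin_num_measure.
  have qf : q B \is a fin_num by exact: fin_num_measure.
  have m1f : mu1 B \is a fin_num by exact: fin_num_measure.
  have m2f : mu2 B \is a fin_num by exact: fin_num_measure.
  have nuB : nu B = (p B - q B)%E.
    by rewrite (jordan_decomp h mB) /cadd/= cscaleN1.
  have := nuE B mB; rewrite nuB.
  rewrite -(fineK pf) -(fineK qf) -(fineK m1f) -(fineK m2f) -!EFinD => -[] H.
  by congr (_%:E); lra.
have EI : (\int[measure_add p mu2]_(x in D) (f x)%:E =
           \int[measure_add q mu1]_(x in D) (f x)%:E)%E.
  apply: eq_measure_integral => A mA _; apply: etrans (measure_addE _ _ _) _.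
  by rewrite pqE//; exact/esym/measure_addE.
have iI (m : {finite_measure set E -> \bar R}) : m.-integrable D (EFin \o f).
  exact: bounded_measurable_integrable.
move: EI; rewrite !integral_measure_add//; try exact: iI.
have fI (m : {finite_measure set E -> \bar R}) :
    (\int[m]_(x in D) (f x)%:E = (\int[m]_(x in D) f x)%:E)%E.
  by rewrite /Rintegral fineK//; apply: integrable_fin_num => //; exact: iI.
by rewrite !fI -!EFinD => -[]; lra.
Qed.

Lemma charge_integral_indic nu D B : measurable D -> measurable B ->
  charge_integral nu D \1_B = fine (nu (B `&` D)).
Proof.
move=> mD mB; have [P [Q [h ->]]] := charge_integral_jordan nu.
set p := jordan_pos h; set q := jordan_neg h.
have mBD : measurable (B `&` D) by exact: measurableI.
have pf : p (B `&` D) \is a fin_num by exact: fin_num_measure.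
have qf : q (B `&` D) \is a fin_num by exact: fin_num_measure.
have -> : nu (B `&` D) = (p (B `&` D) - q (B `&` D))%E.
  by rewrite (jordan_decomp h mBD) /cadd/= cscaleN1.
by rewrite /Rintegral !integral_indic// fineB.
Qed.

Lemma charge_integralZ nu D c f : measurable D -> bounded_measurable f ->
  charge_integral nu D (fun x => c * f x) = c * charge_integral nu D f.
Proof.
move=> mD bf; have [P [Q [h hE]]] := charge_integral_jordan nu; rewrite !hE !RintegralZl ?mulrBr//;
  exact: bounded_measurable_integrable.
Qed.

Lemma charge_integralD nu D f g : measurable D ->
  bounded_measurable f -> bounded_measurable g ->
  charge_integral nu D (fun x => f x + g x) =
    charge_integral nu D f + charge_integral nu D g.
Proof.
move=> mD bf bg; have [P [Q [h hE]]] := charge_integral_jordan nu; rewrite !hE !RintegralD//;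
  try exact: bounded_measurable_integrable.
by rewrite opprD addrACA.
Qed.

Lemma charge_integral_cvg nu D (f_ : nat -> E -> R) f M : measurable D ->
  (forall k, measurable_fun setT (f_ k)) -> measurable_fun setT f ->
  (forall x, D x -> f_ k x @[k --> \oo] --> f x) ->
  (forall k x, `|f_ k x| <= M) ->
  charge_integral nu D (f_ k) @[k --> \oo] --> charge_integral nu D f.
Proof.
move=> mD mf_ mf f_f f_M.
have [P [Q [h hE]]] := charge_integral_jordan nu; rewrite hE.
under eq_cvg do rewrite hE.
have iM (mu : {finite_measure set E -> \bar R}) :
    mu.-integrable D (EFin \o (fun=> M)).
  by apply: bounded_measurable_integrable => //; split => //; exists `|M|.
apply: cvgB; apply: Rintegral_dominated_cvg (iM _) _ => //;
  by move=> *; exact: measurable_funTS.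
Qed.

End charge_integral.

(** * Smooth test functions *)

Section flat.
Context {R : realType}.
Implicit Types (P : {poly R}) (t : R).

(* the derivatives of [exp (- 1 / t)], t > 0, extended by 0, are all of this form *)
Definition flat P t : R := if 0 < t then P.[t^-1] * expR (- t^-1) else 0.

(** From [expR x >= 1 + x] at [x = s / m.+1], raised to the power [m.+1]. *)
Lemma expR_ge_powdiv (s : R) m : 0 <= s -> (s / m.+1%:R) ^+ m.+1 <= expR s.
Proof.
move=> s0; have m0 : 0 < m.+1%:R :> R by [].
rewrite -[in leRHS](divfK (lt0r_neq0 m0) s) expRM_natr.
apply: lerXn2r; rewrite ?nnegrE ?expR_ge0 ?divr_ge0//.
by rewrite (le_trans _ (expR_ge1Dx _))// lerDr.
Qed.

(** Quadratic decay makes the difference quotient at 0 vanish in the limit. Comparing the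
    exponential with the power [i.+2] instead of [i] leaves the factor [t ^+ 2] in the term of
    degree [i]. *)
Lemma flat_quadratic P : exists K, forall t, `|flat P t| <= K * t ^+ 2.
Proof.
pose K := \sum_(i < size P) `|P`_i| * i.+2%:R ^+ i.+2; exists K => t.
have K0 : 0 <= K by apply: sumr_ge0 => i _; rewrite mulr_ge0// exprn_ge0.
rewrite /flat; case: ifPn => t0; last by rewrite normr0 mulr_ge0// sqr_ge0.
set s := t^-1; have s0 : 0 < s by rewrite invr_gt0.
rewrite normrM (ger0_norm (expR_ge0 _)) horner_coef expRN ler_pdivrMr ?expR_gt0//.
apply: le_trans (ler_norm_sum _ _ _) _; rewrite /K -mulrA mulr_suml.
apply: ler_sum => i _; rewrite normrM normrX (gtr0_norm s0) -mulrA.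
rewrite ler_wpM2l//.
have -> : s ^+ i = s ^+ i.+2 * t ^+ 2.
  by rewrite -addn2 exprD -mulrA -exprMn /s mulVf ?expr1n ?mulr1// gt_eqF.
rewrite [leLHS]mulrC [leRHS]mulrCA ler_wpM2l ?sqr_ge0//.
have := expR_ge_powdiv i.+1 (ltW s0).
by rewrite expr_div_n ler_pdivrMr ?exprn_gt0// mulrC.
Qed.

(** The chain rule for [P(1/t) exp(- 1/t)] produces the factor [t^-2], which is the value of ['X^2]
    at [t^-1]. *)
Lemma is_derive_flat P t : is_derive t 1 (flat P) (flat ('X^2 * (P - P^`())) t).
Proof.
have [t0|t0|t0] := ltrgtP t 0.
- rewrite [X in is_derive _ _ _ X]/flat ltNge (ltW t0)/=.
  apply: (@near_eq_is_derive _ _ _ (cst 0)).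
  have : \forall x \near t, x < 0 by exact: lt_nbhsl.
  by apply: filterS => x x0; rewrite /flat ltNge (ltW x0).
- rewrite [X in is_derive _ _ _ X]/flat t0.
  have t_neq0 : t != 0 by rewrite gt_eqF.
  pose f : R -> R := (horner P \o GRing.inv) * (expR \o (-%R \o GRing.inv)).
  apply: (@near_eq_is_derive _ _ _ f).
    have : \forall x \near t, 0 < x by exact: lt_nbhsr.
    by apply: filterS => x x0; rewrite /flat x0.
  have dinv : is_derive t 1 (GRing.inv : R -> R) (- t ^- 2).
    have := @is_deriveV R id t 1 1 t_neq0 (is_derive_id _ _).
    by rewrite /GRing.scale/= mulr1.
  have d1 : is_derive t 1 (horner P \o GRing.inv) (- t ^- 2 * (P^`()).[t^-1]).
    by rewrite mulrC; exact: is_derive1_comp.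
  have d2 : is_derive t 1 (expR \o (-%R \o GRing.inv)) (t ^- 2 * expR (- t^-1)).
    have dN : is_derive t 1 (-%R \o (GRing.inv : R -> R)) (t ^- 2).
      by apply: is_derive_eq; rewrite opprK.
    by rewrite mulrC; exact: is_derive1_comp.
  apply: is_derive_eq.
  by rewrite /= !hornerE /GRing.scale/=; field.
- rewrite t0 [X in is_derive _ _ _ X]/flat ltxx.
  have [K hK] := flat_quadratic P.
  have K0 : 0 <= K by have := hK 1; rewrite expr1n mulr1; exact/le_trans/normr_ge0.
  have h : h^-1 *: (flat P (h *: 1 + 0) - flat P 0) @[h --> 0^'] --> (0 : R).
    apply/cvgrPdist_le => e e0; near=> u.
    have un0 : u != 0 by near: u; exact: nbhs_dnbhs_neq.
    rewrite sub0r normrN /flat ltxx subr0 -/(flat P _) normrZ normfV.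
    rewrite /GRing.scale/= mulr1 addr0 ler_pdivrMl ?normr_gt0//.
    apply: le_trans (hK _) _; rewrite -real_normK ?num_real// expr2 mulrCA ler_wpM2l//.
    have : `|u| <= e / (K + 1).
      near: u; apply: dnbhs0_le; by rewrite divr_gt0// ltr_wpDl.
    rewrite ler_pdivlMr ?ltr_wpDl// => ue.
    by have := normr_ge0 u; lra.
  split; first by apply/cvg_ex; exists 0.
  exact: cvg_lim.
Unshelve. all: by end_near. Qed.

End flat.

Section smooth_functions.
Context {R : realType} {n : nat}.
Local Notation E := 'rV[R]_n.
Implicit Types (f g phi : E -> R) (x v : E) (j : 'I_n).

Local Notation e_ j := (delta_mx ord0 j : E).

Lemma dotp_delta v j : dotp (e_ j) v = v ord0 j.
Proof.
rewrite dotpE (bigD1 j)//= big1 ?addr0; first by rewrite mxE !eqxx mul1r.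
by move=> i /negbTE ij; rewrite mxE ij andbF mul0r.
Qed.

Lemma is_diff_dotp v x : is_diff x (fun y => dotp y v) (fun y => dotp y v).
Proof.
have lin_dot : linear (fun y : E => dotp y v : R^o).
  by move=> a y z; rewrite dotpDl dotpZl.
pose L := GRing.isLinear.Build _ _ _ _ _ lin_dot.
pose F : {linear E -> R^o} := HB.pack (fun y : E => dotp y v : R^o) L.
have cF : continuous F.
  move=> y; rewrite /F/=.
  rewrite (_ : (fun y => _) = (fun y : E => \sum_j y ord0 j * v ord0 j)); last first.
    by apply/funext => z; exact: dotpE.
  move: y; apply: continuous_sumr => j; apply: continuous_mulr => y.
    exact: coord_continuous.
  exact: cst_continuous.
split; first exact: (linear_differentiable (f := F)).
exact: (diff_lin x cF).
Qed.

Lemma is_derive_dotp_affine v c x w :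
  is_derive x w (fun y => dotp y v + c) (dotp w v).
Proof.
have [d1 d2] := is_diff_dotp v x.
have dv : is_derive x w (fun y => dotp y v) (dotp w v).
  by split; [exact: diff_derivable|rewrite deriveE// d2].
have := is_deriveD dv (is_derive_cst c x w).
by rewrite addr0.
Qed.

Lemma differentiable_dotp_affine v c x :
  differentiable (fun y => dotp y v + c) x.
Proof.
have [d1 _] := is_diff_dotp v x.
exact: (differentiableD d1 (differentiable_cst c x)).
Qed.

Lemma partial_cst c j : partial j (fun=> c) = (fun=> 0 : R).
Proof. by apply/funext => x; rewrite /partial derive_cst. Qed.

Lemma partialD f g j : (forall x, differentiable f x) ->
  (forall x, differentiable g x) ->
  partial j (fun x => f x + g x) = (fun x => partial j f x + partial j g x).
Proof.
by move=> df dg; apply/funext => x; rewrite /partial deriveD//; exact: diff_derivable.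
Qed.

Lemma partialM f g j : (forall x, differentiable f x) ->
  (forall x, differentiable g x) ->
  partial j (fun x => f x * g x) =
    (fun x => f x * partial j g x + partial j f x * g x).
Proof.
move=> df dg; apply/funext => x; rewrite /partial deriveM; try exact: diff_derivable.
by rewrite /GRing.scale/= [in X in _ + X]mulrC.
Qed.

Lemma partial_dotp v c j : partial j (fun x => dotp x v + c) = (fun=> v ord0 j).
Proof.
apply/funext => x; rewrite /partial.
by have [_ ->] := is_derive_dotp_affine v c x (e_ j); rewrite dotp_delta.
Qed.

Lemma partial_flat P v c j : partial j (fun x => flat P (dotp x v + c)) =
  (fun x => v ord0 j * flat ('X^2 * (P - P^`())) (dotp x v + c)).
Proof.
apply/funext => x; rewrite /partial.
have d1 := differentiable_dotp_affine v c x.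
have [f1 f2] := is_derive_flat P (dotp x v + c).
have df : differentiable (flat P) (dotp x v + c) by exact/derivable1_diffP.
rewrite deriveE; last exact: differentiable_comp.
rewrite diff_comp//= -(deriveE _ d1).
have [_ ->] := is_derive_dotp_affine v c x (e_ j).
by rewrite dotp_delta diff1E// derive1E f2.
Qed.

(* a class of smooth functions that is visibly stable under partial derivatives *)
Inductive elem_smooth : (E -> R) -> Prop :=
| elem_cst c : elem_smooth (fun=> c)
| elem_add f g : elem_smooth f -> elem_smooth g ->
    elem_smooth (fun x => f x + g x)
| elem_mul f g : elem_smooth f -> elem_smooth g ->
    elem_smooth (fun x => f x * g x)
| elem_flat P v c : elem_smooth (fun x => flat P (dotp x v + c)).

Lemma elem_smooth_differentiable f x : elem_smooth f -> differentiable f x.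
Proof.
elim=> [c|{}f g _ df _ dg|{}f g _ df _ dg|P v c].
- exact: differentiable_cst.
- exact: differentiableD.
- exact: differentiableM.
- apply: differentiable_comp; first exact: differentiable_dotp_affine.
  by apply/derivable1_diffP; have [] := is_derive_flat P (dotp x v + c).
Qed.

Lemma elem_smooth_partial f j : elem_smooth f -> elem_smooth (partial j f).
Proof.
elim=> [c|{}f g ef df eg dg|{}f g ef df eg dg|P v c].
- by rewrite partial_cst; exact: elem_cst.
- rewrite partialD; [|by move=> x; exact: elem_smooth_differentiable..].
  exact: elem_add.
- rewrite partialM; [|by move=> x; exact: elem_smooth_differentiable..].
  by apply: elem_add; apply: elem_mul.
- by rewrite partial_flat; apply: elem_mul; [exact: elem_cst|exact: elem_flat].
Qed.

Lemma elem_smooth_smooth f : elem_smooth f -> smooth f.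
Proof.
move=> ef s x; apply: elem_smooth_differentiable.
by elim: s => //= j s IH; exact: elem_smooth_partial.
Qed.

Lemma elem_smooth_prod (I : Type) (r : seq I) (F : I -> E -> R) :
  (forall i, elem_smooth (F i)) -> elem_smooth (fun x => \prod_(i <- r) F i x).
Proof.
move=> eF; elim: r => [|i r IH].
  rewrite (_ : (fun x => _) = fun=> 1); first exact: elem_cst.
  by apply/funext => x; rewrite big_nil.
rewrite (_ : (fun x => _) = fun x => F i x * \prod_(i <- r) F i x).
  exact: elem_mul.
by apply/funext => x; rewrite big_cons.
Qed.

Lemma elem_smooth_continuous f : elem_smooth f -> continuous f.
Proof.
by move=> ef x; apply/differentiable_continuous/elem_smooth_differentiable.
Qed.

Lemma continuous_measurable_rV f : continuous f -> measurable_fun setT f.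
Proof.
move=> cf; apply: (measurability _ (RGenOpens.measurableE R)).
move=> _ [_ [a [b ->] <-]]; rewrite setTI; apply: sub_sigma_algebra.
apply: open_comp; last exact: interval_open.
by move=> x _; exact: cf.
Qed.

Lemma smooth_partial phi j : smooth phi -> smooth (partial j phi).
Proof.
by move=> sphi s x; have := sphi (rcons s j) x; rewrite foldr_rcons.
Qed.

Lemma smooth_differentiable phi x : smooth phi -> differentiable phi x.
Proof. by move=> /(_ [::]). Qed.

Lemma smooth_continuous phi : smooth phi -> continuous phi.
Proof. by move=> h x; exact/differentiable_continuous/smooth_differentiable. Qed.

End smooth_functions.

Lemma cvg_prodr (R : realType) (S : Type) (F : set_system S) (FF : Filter F)
    (I : Type) (r : seq I) (u : I -> S -> R) (a : I -> R) :
  (forall i, u i x @[x --> F] --> a i) ->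
  \prod_(i <- r) u i x @[x --> F] --> \prod_(i <- r) a i.
Proof.
move=> ua; elim: r => [|i r IH].
  rewrite big_nil (_ : (fun x => _) = cst 1); first exact: cvg_cst.
  by apply/funext => x; rewrite big_nil.
rewrite big_cons (_ : (fun x => _) = (fun x => u i x * \prod_(i <- r) u i x)).
  by apply: cvgM; [exact: ua|exact: IH].
by apply/funext => x; rewrite big_cons.
Qed.

Lemma open_forall (T : topologicalType) (I : finType) (A : I -> set T) :
  (forall i, open (A i)) -> open [set x | forall i, A i x].
Proof.
move=> oA; rewrite (_ : mkset _ = ~` \bigcup_(i in [set: I]) ~` A i).
  apply: closed_openC; apply: closed_bigcup; first exact: finite_finset.
  by move=> i _; exact: open_closedC.
rewrite setC_bigcup; apply/seteqP; split=> x h i; first by move=> _; rewrite setCK.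
by have := h i Logic.I; rewrite setCK.
Qed.

(** * Boxes as generators of the Borel sets *)

Section boxes.
Context {R : realType} {n : nat}.
Local Notation E := 'rV[R]_n.
Implicit Types (f g phi : E -> R) (a b x v : E) (j : 'I_n) (U : set E).

Definition obox a b : set E :=
  [set x | forall j, a ord0 j < x ord0 j < b ord0 j].

Definition cbox a b : set E :=
  [set x | forall j, x ord0 j \in `[a ord0 j, b ord0 j]].

Lemma compact_cbox a b : compact (cbox a b).
Proof.
apply: (@rV_compact _ _ (fun j => `[a ord0 j, b ord0 j]%classic)) => j.
exact: segment_compact.
Qed.

Lemma closed_cbox a b : closed (cbox a b).
Proof. by apply: compact_closed; [exact: norm_hausdorff|exact: compact_cbox]. Qed.

Lemma oboxI a b a' b' : obox a b `&` obox a' b' =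
  obox (\row_j Num.max (a ord0 j) (a' ord0 j)) (\row_j Num.min (b ord0 j) (b' ord0 j)).
Proof.
apply/seteqP; split=> x; last move=> h; first move=> [h h'] j.
  rewrite !mxE gt_max lt_min.
  by have /andP[-> ->] := h j; have /andP[-> ->] := h' j.
split=> j; have := h j; rewrite !mxE gt_max lt_min;
  by move=> /andP[/andP[h1 h2] /andP[h3 h4]]; rewrite ?h1 ?h2 ?h3 ?h4.
Qed.

Lemma ball_obox x r : 0 < r -> ball x r = obox (x - const_mx r) (x + const_mx r).
Proof.
move=> r0; apply/seteqP; split=> y.
  move=> [_ h] j; have := h ord0 j; rewrite -ball_normE/= !mxE distrC.
  by rewrite ltr_distl.
move=> h; split=> // i j; rewrite (ord1 i) -ball_normE/= distrC.
by have := h j; rewrite !mxE ltr_distl.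
Qed.

Lemma open_obox a b : open (obox a b).
Proof.
rewrite (_ : obox a b = [set x : E | forall j, x ord0 j \in `]a ord0 j, b ord0 j[]).
  apply: (@open_forall _ _ (fun j => [set x : E | x ord0 j \in `]a ord0 j, b ord0 j[])) => j.
  apply: (@open_comp _ _ (fun x : E => x ord0 j) `]a ord0 j, b ord0 j[%classic).
    2: exact: interval_open.
  by move=> x _; exact: coord_continuous.
by apply/seteqP; split=> x /= h j; have := h j; rewrite in_itv.
Qed.

Lemma open_measurable_rV U : open U -> measurable U.
Proof. exact: sub_sigma_algebra. Qed.

Definition boxes : set (set E) := [set B | exists a b, B = obox a b].

(** Unlike the balls of the maximum norm, boxes of arbitrary side lengths are stable under
    intersection, as Dynkin's lemma requires. *)
Lemma measurable_boxes : @measurable _ E = <<s boxes >>.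
Proof.
apply/seteqP; split; apply: smallest_sub.
- exact: smallest_sigma_algebra.
- move=> U oU; rewrite (open_ball_rV oU) bigcup_mkcond.
  have := @countable_bigcupT_measurable _ (g_sigma_algebraType boxes).
  apply => // -[q k]; case: ifPn => _ /=; last exact: measurable0.
  by apply: sub_sigma_algebra; rewrite ball_obox ?invr_gt0//; eexists; eexists.
- exact: sigma_algebra_measurable.
- by move=> _ [a [b ->]]; apply: open_measurable_rV; exact: open_obox.
Qed.

Lemma setI_closed_boxes : setI_closed boxes.
Proof.
by move=> _ _ [a [b ->]] [a' [b' ->]]; rewrite oboxI; eexists; eexists.
Qed.

(** The empty set is a separate alternative: it fills the indices that encode no ball inside [U],
    and for [n = 0] every [obox] is the whole space. *)
Lemma open_bigcup_obox U : open U -> exists F : (set E)^nat,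
  U = \bigcup_m F m /\ forall m, F m = set0 \/ exists a b, F m = obox a b.
Proof.
move=> oU.
pose B (p : 'rV[rat]_n * nat) := ball (map_mx ratr p.1 : E) (p.2.+1%:R^-1 : R).
pose F m := if unpickle m is Some p then
  (if `[<B p `<=` U>] then B p else set0) else set0.
exists F; split.
  rewrite [LHS](open_ball_rV oU); apply/seteqP; split=> x.
    move=> [p pU px]; exists (pickle p) => //.
    by rewrite /F pickleK; case: asboolP.
  move=> [m _]; rewrite /F; case: unpickle => // p.
  by case: asboolP => // pU px; exists p.
move=> m; rewrite /F; case: unpickle => [p|]; last by left.
case: asboolP => _; last by left.
by right; rewrite /B ball_obox ?invr_gt0//; eexists; eexists.
Qed.

End boxes.

(** * Smooth approximation of indicators of boxes and of hyperplanes *)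

Section bumps.
Context {R : realType} {n : nat}.
Local Notation E := 'rV[R]_n.
Implicit Types (f g phi : E -> R) (a b x v : E) (j : 'I_n) (U : set E) (t : R).

Lemma flat1E t : flat 1 t = if 0 < t then expR (- t^-1) else 0.
Proof. by rewrite /flat hornerC mul1r. Qed.

Lemma flat1_ge0 t : 0 <= flat 1 t.
Proof. by rewrite flat1E; case: ifP => // _; exact: expR_ge0. Qed.

Lemma flat1_le1 t : flat 1 t <= 1.
Proof.
rewrite flat1E; case: ifP => // t0.
by rewrite -[leRHS]expR0 ler_expR oppr_le0 invr_ge0 ltW.
Qed.

Lemma flat1_cvg t :
  flat 1 (m.+1%:R * t - 1) @[m --> \oo] --> ((0 < t)%R%:R : R).
Proof.
have [t0|t0] := ltrP 0 t; last first.
  rewrite (_ : (fun m => _) = cst 0); first exact: cvg_cst.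
  apply/funext => m; rewrite flat1E ltNge.
  by rewrite (_ : _ <= 0)// subr_le0 (@le_trans _ _ 0)// mulr_ge0_le0//.
apply/cvgrPdist_le => e e0; near=> m.
(* Then the argument [u] of [flat 1] is at least [1/e], and [1 - exp (- 1/u) <= 1/u <= e]. *)
have mt : e^-1 + 1 <= m.+1%:R * t.
  rewrite -ler_pdivrMr// (@le_trans _ _ (m%:R : R))// ?ler_nat//.
  by near: m; exact: nbhs_infty_ger.
have u0 : 0 < m.+1%:R * t - 1.
  by rewrite subr_gt0 (lt_le_trans _ mt)// ltrDr invr_gt0.
rewrite flat1E u0 ger0_norm; last first.
  by rewrite subr_ge0 -[leRHS]expR0 ler_expR oppr_le0 invr_ge0 ltW.
rewrite lerBlDr -lerBlDl (le_trans _ (expR_ge1Dx _))// lerD2l lerN2.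
by rewrite -[leRHS]invrK lef_pV2 ?posrE ?invr_gt0// lerBrDr.
Unshelve. all: by end_near. Qed.

(** The shift by -1 makes each factor vanish within distance [1 / m.+1] of its face, so the support
    is a compact subset of the open box. The arguments are spelled [dotp x v + c] to fit
    [elem_flat]. *)
Definition bump a b (m : nat) x : R := \prod_j
  (flat 1 (dotp x (m.+1%:R *: delta_mx ord0 j) + (- m.+1%:R * a ord0 j - 1)) *
   flat 1 (dotp x (- m.+1%:R *: delta_mx ord0 j) + (m.+1%:R * b ord0 j - 1))).

Lemma bumpE a b m x : bump a b m x = \prod_j
  (flat 1 (m.+1%:R * (x ord0 j - a ord0 j) - 1) *
   flat 1 (m.+1%:R * (b ord0 j - x ord0 j) - 1)).
Proof.
apply: eq_bigr => j _; rewrite !dotpZr dotpC dotp_delta.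
by congr (flat _ _ * flat _ _); ring.
Qed.

Lemma elem_smooth_bump a b m : elem_smooth (bump a b m).
Proof.
by apply: elem_smooth_prod => j; apply: elem_mul; exact: elem_flat.
Qed.

Lemma bump_ge0 a b m x : 0 <= bump a b m x.
Proof. by apply: prodr_ge0 => j _; rewrite mulr_ge0 ?flat1_ge0. Qed.

Lemma bump_le1 a b m x : bump a b m x <= 1.
Proof.
apply: prodr_ile1 => j _; rewrite mulr_ge0 ?flat1_ge0//=.
by rewrite mulr_ile1 ?flat1_ge0 ?flat1_le1.
Qed.

Lemma bump_cvg a b x : bump a b m x @[m --> \oo] --> (\1_(obox a b) x : R).
Proof.
rewrite (_ : \1_(obox a b) x = \prod_j ((0 < x ord0 j - a ord0 j)%R%:R *
    (0 < b ord0 j - x ord0 j)%R%:R)).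
  rewrite (_ : (fun m => _) = (fun m => \prod_j
    (flat 1 (m.+1%:R * (x ord0 j - a ord0 j) - 1) *
     flat 1 (m.+1%:R * (b ord0 j - x ord0 j) - 1)))).
    by apply: cvg_prodr => j; apply: cvgM; exact: flat1_cvg.
  by apply/funext => m; exact: bumpE.
rewrite indicE; have [xab|xab] := boolP (x \in obox a b).
  rewrite big1// => j _; rewrite !subr_gt0.
  by have := set_mem xab => /(_ j)/andP[-> ->]; rewrite mulr1.
have [j] : exists j, ~~ (a ord0 j < x ord0 j < b ord0 j).
  apply: contrapT => h; move/negP : xab; apply; rewrite inE => j.
  by apply: contrapT => /negP ?; apply: h; exists j.
rewrite negb_and => H; rewrite (bigD1 j)//= !subr_gt0.
by case/orP : H => /negbTE ->; rewrite ?mul0r ?mulr0 ?mul0r.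
Qed.

Lemma elem_smooth_test f U (C : set E) : elem_smooth f -> compact C -> closed C ->
  C `<=` U -> (forall x, f x != 0 -> C x) -> test_function U f.
Proof.
move=> ef cC clC CU fC.
have sC : closure [set x | f x != 0] `<=` C.
  have CE : C = closure C by exact/closure_id.
  by rewrite CE; exact: closure_subset.
split; first exact: elem_smooth_smooth.
- exact: subclosed_compact (@closed_closure _ _) cC sC.
- exact: subset_trans sC CU.
Qed.

Lemma bump_neq0 a b m x : bump a b m x != 0 ->
  cbox (a + const_mx m.+1%:R^-1) (b - const_mx m.+1%:R^-1) x.
Proof.
rewrite bumpE => /prodf_neq0 h j.
have := h j isT; rewrite mulf_eq0 negb_or !flat1E => /andP[].
have m0 : 0 < m.+1%:R :> R by [].
case: ifP; rewrite ?eqxx// => h1 _; case: ifP; rewrite ?eqxx// => h2 _.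
rewrite in_itv/= !mxE.
have {}h1 : m.+1%:R^-1 < x ord0 j - a ord0 j.
  by rewrite -(ltr_pM2l m0) mulfV ?gt_eqF// -subr_gt0.
have {}h2 : m.+1%:R^-1 < b ord0 j - x ord0 j.
  by rewrite -(ltr_pM2l m0) mulfV ?gt_eqF// -subr_gt0.
by rewrite -lerBrDl (ltW h1)/= lerBrDr addrC -lerBrDr ltW.
Qed.

Lemma cbox_obox a b e : 0 < e ->
  cbox (a + const_mx e) (b - const_mx e) `<=` obox a b.
Proof.
move=> e0 x h j; have := h j; rewrite in_itv/= !mxE => /andP[h1 h2].
by apply/andP; split; lra.
Qed.

Lemma bump_mul_test f a b m U : elem_smooth f -> obox a b `<=` U ->
  test_function U (fun x => bump a b m x * f x).
Proof.
move=> ef abU.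
apply: (@elem_smooth_test _ _ (cbox (a + const_mx m.+1%:R^-1) (b - const_mx m.+1%:R^-1))).
- by apply: elem_mul => //; exact: elem_smooth_bump.
- exact: compact_cbox.
- exact: closed_cbox.
- by apply: subset_trans abU; apply: cbox_obox; rewrite invr_gt0.
- by move=> x; rewrite mulf_eq0 negb_or => /andP[/bump_neq0].
Qed.

Lemma bump_test a b m U : obox a b `<=` U -> test_function U (bump a b m).
Proof.
move=> abU; rewrite (_ : bump a b m = fun x => bump a b m x * 1).
  by apply: bump_mul_test => //; exact: elem_cst.
by apply/funext => x; rewrite mulr1.
Qed.

(** On the hyperplane both flat factors equal [exp (-1)], which [expR 2] normalizes to 1; off it,
    one of them vanishes as soon as [m |dotp x v - c| >= 1]. *)
Definition cut v c (m : nat) x : R := expR 2 *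
  (flat 1 (dotp x (m%:R *: v) + (1 - m%:R * c)) *
   flat 1 (dotp x (- m%:R *: v) + (1 + m%:R * c))).

Lemma elem_smooth_cut v c m : elem_smooth (cut v c m).
Proof.
apply: elem_mul; first exact: elem_cst.
by apply: elem_mul; exact: elem_flat.
Qed.

Lemma cut_ge0 v c m x : 0 <= cut v c m x.
Proof. by rewrite !mulr_ge0 ?expR_ge0 ?flat1_ge0. Qed.

Lemma cut_le v c m x : cut v c m x <= expR 2.
Proof.
rewrite /cut ger_pMr ?expR_gt0//.
by rewrite mulr_ile1 ?flat1_ge0 ?flat1_le1.
Qed.

Lemma cut_cvg v c x :
  cut v c m x @[m --> \oo] --> (\1_[set y | dotp y v = c] x : R).
Proof.
rewrite indicE; have [xv|/eqP xv] := pselect (dotp x v = c).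
  rewrite mem_set//= (_ : (fun m => _) = cst 1); first exact: cvg_cst.
  apply/funext => m; rewrite /cut !dotpZr xv.
  rewrite (_ : _ + (1 - _) = 1); last by ring.
  rewrite (_ : _ + (1 + _) = 1); last by ring.
  by rewrite flat1E ltr01 invr1 -!expRD (_ : 2 + _ = 0) ?expR0//; ring.
rewrite memNset/=; last exact/eqP.
apply/cvgrPdist_le => e e0; near=> m.
have mt : 1 <= m%:R * `|dotp x v - c|.
  rewrite -ler_pdivrMr ?normr_gt0 ?subr_eq0//.
  by near: m; exact: nbhs_infty_ger.
rewrite /cut !dotpZr !flat1E.
have [xc|xc] := lerP c (dotp x v).
  rewrite ger0_norm ?subr_ge0// in mt.
  by rewrite [X in _ * (_ * X)]ifF ?mulr0 ?subrr ?normr0 ?ltW//; apply/negbTE; rewrite -leNgt; lra.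
rewrite ltr0_norm ?subr_lt0// in mt.
by rewrite ifF ?mul0r ?mulr0 ?subrr ?normr0 ?ltW//; apply/negbTE; rewrite -leNgt; lra.
Unshelve. all: by end_near. Qed.

End bumps.

(** * Lebesgue measure and integration by parts *)

Section lebesgue_rV_facts.
Context {R : realType}.

Lemma lebesgue_rV_null_preimage n (A : set 'rV[R]_n.+1) : measurable A ->
  (forall t, lebesgue_rV n ((fun y => rV_cons (t, y)) @^-1` A) = 0%E) ->
  lebesgue_rV n.+1 A = 0%E.
Proof.
move=> mA A0; rewrite /= /lebesgue_step /pushforward.
rewrite /product_measure1 /= integral0_eq// => t _ /=.
by rewrite -[RHS](A0 t); congr (lebesgue_rV n _); apply/seteqP; split=> y;
  rewrite /xsection/= inE.
Qed.

Lemma dotp_rV_cons n (t : R) (y : 'rV[R]_n) (v : 'rV[R]_n.+1) :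
  dotp (rV_cons (t, y)) v = t * v ord0 ord0 + dotp y (rV_uncons v).2.
Proof.
rewrite !dotpE big_ord_recl; congr (_ + _).
  have -> : ord0 = lshift n (ord0 : 'I_1) :> 'I_(1 + n) by apply: val_inj.
  by rewrite rV_cons0.
apply: eq_bigr => j _; have -> : lift ord0 j = rshift 1 j :> 'I_(1 + n).
  exact: val_inj.
by rewrite rV_consS/= !mxE.
Qed.

Lemma closed_hyperplane n (v : 'rV[R]_n) c : closed [set x | dotp x v = c].
Proof.
apply: (@closed_comp _ _ (fun x : 'rV[R]_n => dotp x v) [set c]); last exact: closed_eq.
move=> x _; have [d _] := is_diff_dotp v x; exact: differentiable_continuous.
Qed.

Lemma closed_measurable_rV n (A : set 'rV[R]_n) : closed A -> measurable A.
Proof.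
by move=> /closed_openC oA; rewrite -(setCK A); apply: measurableC; exact: open_measurable_rV.
Qed.

(** If the tail of [v] is nonzero, every slice at a fixed first coordinate is a hyperplane one
    dimension lower. Otherwise the set is a point times the whole space, of measure zero by the
    convention [0 * oo = 0]. *)
Lemma lebesgue_rV_hyperplane n (v : 'rV[R]_n) c : v != 0 ->
  lebesgue_rV n [set x | dotp x v = c] = 0%E.
Proof.
elim: n v c => [|n IH] v c v0.
  by move/eqP : v0; case; apply/rowP => -[].
have mH : measurable [set x | dotp x v = c].
  by apply: closed_measurable_rV; exact: closed_hyperplane.
have [v'0|v'0] := eqVneq (rV_uncons v).2 0; last first.
  apply: lebesgue_rV_null_preimage => // t.
  rewrite -[RHS](IH (rV_uncons v).2 (c - t * v ord0 ord0) v'0).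
  congr (lebesgue_rV n _); apply/seteqP; split=> y /=; rewrite dotp_rV_cons; lra.
have v00 : v ord0 ord0 != 0.
  apply: contra v0 => /eqP v00; apply/eqP/rowP => j; rewrite [RHS]mxE.
  case: (unliftP ord0 j) => [k|] -> //.
  move/rowP/(_ k) : v'0; rewrite !mxE => <-.
  by rewrite (_ : lift ord0 k = rshift 1 k)//; exact: val_inj.
have d0 (y : 'rV[R]_n) : dotp y 0 = 0 by rewrite /dotp trmx0 mulmx0 mxE.
rewrite /= /lebesgue_step /pushforward.
have -> : @rV_cons R n @^-1` [set x | dotp x v = c] =
    ([set c / v ord0 ord0] : set (measurableTypeR R)) `*` (setT : set 'rV[R]_n).
  apply/seteqP; split=> -[t y] /=; rewrite dotp_rV_cons v'0 d0.
    by rewrite addr0 => <-; rewrite mulfK.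
  by move=> [-> _]; rewrite addr0 divfK.
have m1 : measurable ([set c / v ord0 ord0] : set (measurableTypeR R)).
  exact: measurable_set1.
have mT : measurable (setT : set 'rV[R]_n) by exact: measurableT.
apply: etrans (product_measure1E _ _ m1 mT) _.
by rewrite [X in (X * _)%E](lebesgue_measure_set1 _) mul0e.
Qed.

Lemma lebesgue_rV_ball_lty n (r : R) :
  (lebesgue_rV n (cbox (const_mx (- r)%R) (const_mx r)) < +oo)%E.
Proof.
have [r0|r0] := lerP 0 r.
  rewrite /cbox lebesgue_rV_box ?ltry// => j; rewrite !mxE; lra.
apply: (@le_lt_trans _ _ (lebesgue_rV n (cbox 0%R 0%R))).
  apply: le_measure; rewrite ?inE; try exact: measurable_rV_box.
  by move=> x h j; have := h j; rewrite !in_itv/= !mxE => /andP[h1 h2]; exfalso; lra.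
by rewrite /cbox lebesgue_rV_box ?ltry.
Qed.

Lemma cboxN n (x : 'rV[R]_n) r : 0 <= r ->
  ~ cbox (const_mx (- r)) (const_mx r) x -> r < `|x|.
Proof.
move=> r0 nx; rewrite ltNge; apply: contra_notN nx => xr j.
by rewrite !mxE in_itv/= -ler_norml (le_trans (rV_coord_le x j)).
Qed.

Lemma compact_support_bounded n (g : 'rV[R]_n -> R) r : continuous g ->
  (forall x, r < `|x| -> g x = 0) -> exists M, forall x, `|g x| <= M.
Proof.
move=> cg g0; pose K : set 'rV[R]_n := cbox (const_mx (- `|r|)) (const_mx `|r|).
have [||c cK cmax] := @compact_EVT_max _ R (fun x => `|g x|) K _ (@compact_cbox _ _ _ _).
- by exists 0 => j; rewrite !mxE in_itv/= oppr_le0 normr_ge0.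
- apply: continuous_subspaceT => x; apply: continuous_comp; first exact: cg.
  exact: norm_continuous.
exists `|g c| => x; have [xK|xK] := pselect (K x); first by apply: cmax; rewrite inE.
rewrite g0 ?normr0//; apply: le_lt_trans (ler_norm r) _.
exact: cboxN.
Qed.

Lemma compact_support_integrable n (g : 'rV[R]_n -> R) r : continuous g ->
  (forall x, r < `|x| -> g x = 0) -> (lebesgue_rV n).-integrable setT (EFin \o g).
Proof.
move=> cg g0; pose K : set 'rV[R]_n := cbox (const_mx (- `|r|)) (const_mx `|r|).
have mK : measurable K by exact: measurable_rV_box.
have [M gM] := compact_support_bounded cg g0.
rewrite (_ : EFin \o g = (EFin \o g) \_ K).
  rewrite -integrable_mkcond//; apply: measurable_bounded_integrable => //.
  - exact: lebesgue_rV_ball_lty.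
  - by apply: measurable_funTS; exact: continuous_measurable_rV.
  - exists M; split; first exact: num_real.
    by move=> N MN x _ /=; apply: le_trans (gM x) (ltW MN).
apply/funext => x; rewrite patchE; case: ifPn => //= xK.
rewrite g0//; apply: le_lt_trans (ler_norm r) _; apply: cboxN => //.
by move/negP : xK; rewrite inE.
Qed.

Lemma rV_cons_lin n (a t s : R) (y z : 'rV[R]_n) :
  a *: rV_cons (t, y) + rV_cons (s, z) = rV_cons (a * t + s, a *: y + z).
Proof.
apply/rowP => j; rewrite -(splitK (j : 'I_(1 + n))).
case: (fintype.split (j : 'I_(1 + n))) => i /=.
  by rewrite (ord1 i) mxE [X in X + _]mxE !rV_cons0.
by rewrite mxE [X in X + _]mxE !rV_consS !mxE.
Qed.

Lemma ball_rV_cons n (t s e : R) (y z : 'rV[R]_n) : 0 < e ->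
  ball t e s -> ball y e z -> ball (rV_cons (t, y)) e (rV_cons (s, z)).
Proof.
move=> e0 ts [_ yz]; split=> // i j; rewrite (ord1 i) -(splitK (j : 'I_(1 + n))).
by case: (fintype.split (j : 'I_(1 + n))) => k /=;
  rewrite ?(ord1 k) ?rV_cons0 ?rV_consS//; exact: yz.
Qed.

Lemma continuous_rV_consl n (y : 'rV[R]_n) : continuous (fun t : R => rV_cons (t, y)).
Proof.
move=> t; apply/cvg_ballP => e e0; have := nbhsx_ballx t e e0.
by apply: filterS => s ts; apply: ball_rV_cons => //; exact: ballxx.
Qed.

Lemma continuous_rV_consr n (t : R) :
  continuous (fun y : 'rV[R]_n => rV_cons (t, y)).
Proof.
move=> y A /nbhs_ballP[e /= e0 eA]; apply/nbhs_ballP; exists e => //= z yz.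
by apply: eA; apply: ball_rV_cons => //; exact: ballxx.
Qed.

Lemma delta_rV_cons0 n : delta_mx ord0 ord0 = rV_cons (1, 0) :> 'rV[R]_n.+1.
Proof.
apply/rowP => j; rewrite -(splitK (j : 'I_(1 + n))).
case: (fintype.split (j : 'I_(1 + n))) => i /=.
  by rewrite (ord1 i) rV_cons0 mxE eqxx.
by rewrite rV_consS !mxE.
Qed.

Lemma delta_rV_consS n (j : 'I_n) :
  delta_mx ord0 (lift ord0 j) = rV_cons (0, delta_mx ord0 j) :> 'rV[R]_n.+1.
Proof.
apply/rowP => k; rewrite -(splitK (k : 'I_(1 + n))).
case: (fintype.split (k : 'I_(1 + n))) => i /=.
  by rewrite (ord1 i) rV_cons0 mxE.
by rewrite rV_consS !mxE /= (_ : rshift 1 i = lift ord0 i) ?(inj_eq (@lift_inj _ _))//; exact: val_inj.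
Qed.

Lemma derive_rV_consl n (psi : 'rV[R]_n.+1 -> R) t y :
  (fun h => h^-1 *: (psi (rV_cons (h *: 1 + t, y)) - psi (rV_cons (t, y)))) =
  (fun h => h^-1 *: (psi (h *: delta_mx ord0 ord0 + rV_cons (t, y))
    - psi (rV_cons (t, y)))).
Proof.
apply/funext => h; rewrite delta_rV_cons0 rV_cons_lin scaler0 add0r.
by rewrite /GRing.scale/=.
Qed.

Lemma derive_rV_consr n (psi : 'rV[R]_n.+1 -> R) (j : 'I_n) t y :
  (fun h => h^-1 *: (psi (rV_cons (t, h *: delta_mx ord0 j + y)) - psi (rV_cons (t, y)))) =
  (fun h => h^-1 *: (psi (h *: delta_mx ord0 (lift ord0 j) + rV_cons (t, y))
    - psi (rV_cons (t, y)))).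
Proof.
by apply/funext => h; rewrite delta_rV_consS rV_cons_lin mulr0 add0r.
Qed.

Lemma normr_rV_consl n t (y : 'rV[R]_n) : `|t| <= `|rV_cons (t, y)|.
Proof. by have := rV_coord_le (rV_cons (t, y)) (lshift n (ord0 : 'I_1)); rewrite rV_cons0. Qed.

Lemma normr_rV_consr n t (y : 'rV[R]_n) : `|y| <= `|rV_cons (t, y)|.
Proof.
apply: rV_norm_le => // j.
by have := rV_coord_le (rV_cons (t, y)) (rshift 1 j); rewrite rV_consS.
Qed.

Lemma integral_derive_eq0 (F : R -> R) r : (forall t, derivable F t 1) ->
  continuous (fun t => 'D_1 F t) -> (forall t, r < `|t| -> F t = 0) ->
  (\int[lebesgue_measure]_t ('D_1 F t)%:E = 0)%E.
Proof.
move=> dF cF F0; pose s := `|r| + 1.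
have s0 : 0 < s by rewrite ltr_wpDl.
have rs t : s <= `|t| -> r < `|t|.
  by apply: lt_le_trans; rewrite (le_lt_trans (ler_norm r))// ltrDl.
have cF' : continuous F.
  by move=> t; apply/differentiable_continuous/derivable1_diffP.
have DF0 t : s < `|t| -> 'D_1 F t = 0.
  move=> st; rewrite -(derive_cst (0 : R) t (1 : R)).
  apply: near_eq_derive.
  have : \forall u \near t, s < `|u|.
    have ct : {for t, continuous (fun u : R => `|u|)} by exact: norm_continuous.
    by apply: (cvgr_gt _ ct).
  by apply: filterS => u su; rewrite F0// rs// ltW.
have E : (\int[lebesgue_measure]_(t in `[(- s)%R, s]) ('D_1 F t)%:E =
    (F s)%:E - (F (- s)%R)%:E)%E.
  apply: continuous_FTC2.
  - by rewrite gtrN.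
  - exact: continuous_subspaceT.
  - split; first by move=> t _; exact: dF.
    + exact/cvg_at_right_filter/cF'.
    + exact/cvg_at_left_filter/cF'.
  - by move=> t _; rewrite derive1E.
rewrite (F0 s) ?(F0 (- s)) in E; last 2 first.
- by apply: rs; rewrite normrN ler_norm.
- by apply: rs; rewrite ler_norm.
rewrite sube0 in E; rewrite -[RHS]E.
rewrite [RHS]integral_mkcond; apply: eq_integral => t _.
rewrite patchE; case: ifPn => // tI; rewrite DF0//.
rewrite ltNge ler_norml; apply: contra tI => ts; rewrite inE/= in_itv/=.
exact: ts.
Qed.

(* Fubini reduces the claim to the fundamental theorem of calculus on the line *)
Lemma integral_partial_eq0 n (j : 'I_n) (psi : 'rV[R]_n -> R) r :
  (forall x, derivable psi x (delta_mx ord0 j)) ->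
  continuous (partial j psi) -> (forall x, r < `|x| -> psi x = 0) ->
  (\int[lebesgue_rV n]_x (partial j psi x)%:E = 0)%E.
Proof.
elim: n j psi => [[]//|n IH] j psi dpsi cpsi psi0.
have p0 x : r < `|x| -> partial j psi x = 0.
  move=> rx; rewrite /partial -(derive_cst (0 : R) x (delta_mx ord0 j)).
  apply: near_eq_derive.
  have : \forall u \near x, r < `|u|.
    have cx : {for x, continuous (fun u : 'rV[R]_n.+1 => `|u|)} by exact: norm_continuous.
    by apply: (cvgr_gt _ cx).
  by apply: filterS => u su; rewrite psi0.
set g := partial j psi.
have ig : (lebesgue_rV n.+1).-integrable setT (EFin \o g).
  exact: (compact_support_integrable cpsi p0).
have mg : measurable_fun setT (EFin \o g).
  by apply/measurable_EFinP; exact: continuous_measurable_rV.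
have mc : measurable_fun setT (@rV_cons R n) by exact: measurable_rV_cons.
pose m := (@lebesgue_measure R \x lebesgue_rV n)%E.
have ig' : m.-integrable setT ((EFin \o g) \o @rV_cons R n).
  apply/integrableP; split; first exact: measurableT_comp.
  have /integrableP[_] := ig; apply: le_lt_trans.
  rewrite (_ : (\int[lebesgue_rV n.+1]_x `|(EFin \o g) x|)%E =
    (\int[pushforward m (@rV_cons R n)]_x `|(EFin \o g) x|)%E)//.
  rewrite ge0_integral_pushforward//.
  exact: measurableT_comp.
transitivity (\int[pushforward m (@rV_cons R n)]_x (EFin \o g) x)%E; first by [].
rewrite integral_pushforward// preimage_setT.
(* The direction of the derivative decides the order of integration: the tail first, by induction,
   for [lift ord0 k], and the first coordinate first for [ord0]. *)
move: j @g dpsi cpsi p0 ig mg ig' => j; case: (unliftP ord0 j) => [k|] -> g dpsi cpsi p0 ig mg ig'.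
  rewrite -(integral12_prod_meas1 ig') integral0_eq// => t _.
  rewrite -[RHS](IH k (fun y => psi (rV_cons (t, y)))).
  - apply: eq_integral => y _ /=; congr (_%:E).
    by rewrite /g /partial /derive derive_rV_consr.
  - by move=> y; have := dpsi (rV_cons (t, y)); rewrite /derivable derive_rV_consr.
  - rewrite (_ : partial k _ = g \o (fun y => rV_cons (t, y))).
      by move=> y; apply: continuous_comp; [exact: continuous_rV_consr|exact: cpsi].
    by apply/funext => y; rewrite /g /= /partial /derive derive_rV_consr.
  - by move=> y ry; rewrite psi0// (lt_le_trans ry)// normr_rV_consr.
rewrite -(integral21_prod_meas1 ig') integral0_eq// => y _.
rewrite -[RHS](@integral_derive_eq0 (fun t => psi (rV_cons (t, y))) r).
- apply: eq_integral => t _ /=; congr (_%:E).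
  by rewrite /g /partial /derive derive_rV_consl.
- by move=> t; have := dpsi (rV_cons (t, y)); rewrite /derivable derive_rV_consl.
- rewrite (_ : (fun t => _) = g \o (fun t => rV_cons (t, y))).
    by move=> t; apply: continuous_comp; [exact: continuous_rV_consl|exact: cpsi].
  by apply/funext => t; rewrite /g /= /partial /derive derive_rV_consl.
- by move=> t rt; rewrite psi0// (lt_le_trans rt)// normr_rV_consl.
Qed.

End lebesgue_rV_facts.

Lemma continuous_addr (R : realType) (T : topologicalType) (f g : T -> R) :
  continuous f -> continuous g -> continuous (fun x => f x + g x).
Proof. by move=> cf cg x; apply: cvgD; [exact: cf|exact: cg]. Qed.

(** * Test functions and integration by parts against affine maps *)

Section test_functions.
Context {R : realType} {n : nat}.
Local Notation E := 'rV[R]_n.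
Implicit Types (f g phi : E -> R) (a x v : E) (i j : 'I_n) (D U : set E).

Lemma test_partial_off U phi j x : test_function U phi ->
  ~ closure [set y | phi y != 0] x -> partial j phi x = 0.
Proof.
move=> [_ _ _] nx; rewrite /partial -(derive_cst (0 : R) x (delta_mx ord0 j)).
apply: near_eq_derive.
have : open (~` closure [set y | phi y != 0]).
  by apply: closed_openC; exact: closed_closure.
rewrite openE => /(_ x nx); apply: filterS => y ny.
by apply: contra_notP ny => /eqP ?; exact: subset_closure.
Qed.

Lemma test_off U phi x : test_function U phi -> ~ U x -> phi x = 0.
Proof.
move=> [_ _ sU] nx; apply: contra_notP nx => /eqP ?; apply: sU.
exact: subset_closure.
Qed.

Lemma test_partial_offU U phi j x : test_function U phi -> ~ U x ->
  partial j phi x = 0.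
Proof.
move=> tphi nx; apply: (test_partial_off _ tphi).
by move: nx; apply: contra_not; case: tphi => _ _; exact.
Qed.

Lemma test_function_sub U U' phi : U `<=` U' ->
  test_function U phi -> test_function U' phi.
Proof. by move=> UU' [? ? sU]; split=> //; exact: subset_trans UU'. Qed.

Lemma test_radius U phi : test_function U phi ->
  exists r, forall x, r < `|x| -> phi x = 0 /\ forall j, partial j phi x = 0.
Proof.
move=> tphi; have [_ /compact_bounded[M [_ hM]] _] := tphi.
exists (M + 1) => x Mx.
have nx : ~ closure [set y | phi y != 0] x.
  by move=> /(hM (M + 1)); rewrite ltrDl ltr01 => /(_ isT) /=; rewrite leNgt Mx.
split; last by move=> j; exact: (test_partial_off _ tphi nx).
by apply: contra_notP nx => /eqP ?; exact: subset_closure.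
Qed.

Lemma test_continuous U phi : test_function U phi -> continuous phi.
Proof. by move=> [sphi _ _]; exact: smooth_continuous. Qed.

Lemma test_partial_continuous U phi j :
  test_function U phi -> continuous (partial j phi).
Proof. by move=> [sphi _ _]; apply: smooth_continuous; exact: smooth_partial. Qed.

Lemma bounded_measurable_test U phi : test_function U phi ->
  bounded_measurable phi.
Proof.
move=> tphi; have [r hr] := test_radius tphi.
split; first by apply: continuous_measurable_rV; exact: test_continuous tphi.
by apply: (@compact_support_bounded _ _ _ r (test_continuous tphi)) => x /hr[].
Qed.

Lemma bounded_measurable_partial U phi j : test_function U phi ->
  bounded_measurable (partial j phi).
Proof.
move=> tphi; have [r hr] := test_radius tphi.
split; first by apply: continuous_measurable_rV; exact: test_partial_continuous tphi.
by apply: (@compact_support_bounded _ _ _ r (test_partial_continuous tphi)) => x /hr[_].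
Qed.

Lemma Rintegral_setT_off D f : (forall x, ~ D x -> f x = 0) ->
  \int[lebesgue_rV n]_(x in D) f x = \int[lebesgue_rV n]_x f x.
Proof.
move=> f0; rewrite Rintegral_mkcond; apply: eq_Rintegral => x _.
by rewrite patchE; case: ifPn => // /negP; rewrite inE => /f0.
Qed.

Lemma affine_continuous a c : continuous (fun x => dotp x a + c).
Proof.
by move=> x; apply: differentiable_continuous; exact: differentiable_dotp_affine.
Qed.

(** The affine function times [phi] has compact support, so its partial derivative integrates to
    zero. *)
Lemma integral_affine_partial U phi a c j : test_function U phi ->
  \int[lebesgue_rV n]_x ((dotp x a + c) * partial j phi x) =
  - (a ord0 j * \int[lebesgue_rV n]_x phi x).
Proof.
move=> tphi; have [sphi _ _] := tphi; have [r hr] := test_radius tphi.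
pose l x := dotp x a + c.
have dl x : differentiable l x by exact: differentiable_dotp_affine.
have dphi x : differentiable phi x by exact: smooth_differentiable.
have pE : partial j (fun x => l x * phi x) =
    (fun x => l x * partial j phi x + a ord0 j * phi x).
  by rewrite partialM// /l partial_dotp.
have c1 : continuous (fun x => l x * partial j phi x).
  apply: continuous_mulr; first exact: affine_continuous.
  exact: test_partial_continuous tphi.
have c2 : continuous (fun x => a ord0 j * phi x).
  apply: continuous_mulr; last exact: test_continuous tphi.
  by move=> x; exact: cst_continuous.
have i1 := @compact_support_integrable _ _ _ r c1 _.
have i2 := @compact_support_integrable _ _ _ r c2 _.
have i3 := @compact_support_integrable _ _ _ r (test_continuous tphi) _.
have := @integral_partial_eq0 _ _ j (fun x => l x * phi x) r.
rewrite pE => /(_ _ _ _)/(congr1 fine) h.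
have : \int[lebesgue_rV n]_x (l x * partial j phi x + a ord0 j * phi x) = 0.
  apply: h.
  - move=> x; apply: diff_derivable.
    by apply: differentiableM; [exact: dl|exact: dphi].
  - exact: continuous_addr.
  - by move=> x /hr[-> _]; rewrite mulr0.
rewrite RintegralD//; last 2 first.
- by apply: i1 => x /hr[_ ->]; rewrite mulr0.
- by apply: i2 => x /hr[-> _]; rewrite mulr0.
rewrite (RintegralZl _ measurableT); last by apply: i3 => x /hr[].
by move=> /eqP; rewrite addr_eq0 => /eqP.
Qed.

(** The gradient is that of [u] on [D], while affinity holds only on [U]: the support of [phi]
    localizes the integrand to [U]. *)
Lemma dist_gradient_affine D U u (A : 'M[R]_n) (b : E) phi i j :
  measurable D -> measurable U -> U `<=` D -> L1 D u ->
  {ae lebesgue_rV n, forall x, U x -> u x = x *m A^T + b} ->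
  test_function U phi ->
  dist_gradient D u i j phi = A i j * \int[lebesgue_rV n]_(x in D) phi x.
Proof.
move=> mD mU UD uL aeu tphi; rewrite /dist_gradient.
have tD := test_function_sub UD tphi.
rewrite (Rintegral_setT_off (fun x => test_off tD (x := x))).
have mp : measurable_fun setT (partial j phi) by have [] := bounded_measurable_partial j tphi.
have -> : \int[lebesgue_rV n]_(x in D) (u x ord0 i * partial j phi x) =
    \int[lebesgue_rV n]_(x in D) ((dotp x (row i A) + b ord0 i) * partial j phi x).
  congr fine; apply: ae_eq_integral => //.
  - apply/measurable_EFinP; apply: measurable_funM; last exact: measurable_funTS.
    by apply/measurable_EFinP; have /integrableP[] := uL i.
  - apply/measurable_EFinP; apply: measurable_funTS; apply: measurable_funM => //.
    by apply: continuous_measurable_rV; exact: affine_continuous.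
  - apply: filterS aeu => x ux Dx; congr (_%:E).
    have [Ux|nUx] := pselect (U x); last first.
      by rewrite (test_partial_offU j tphi nUx) !mulr0.
    congr (_ * _); rewrite ux// mxE; congr (_ + _).
    by rewrite mxE dotpE; apply: eq_bigr => k _; rewrite !mxE.
rewrite Rintegral_setT_off; last first.
  by move=> x nDx; rewrite (test_partial_offU j tD nDx) mulr0.
by rewrite (integral_affine_partial _ _ _ tphi) opprK mxE.
Qed.

End test_functions.

(** * Symmetrized gradients of piecewise rigid functions *)

Section sym_gradient.
Context {R : realType} {n : nat}.
Local Notation E := 'rV[R]_n.
Local Notation leb := (@lebesgue_rV R n).
Implicit Types (phi chi : E -> R) (C : 'M[R]_n) (u : E -> E) (mu : @mx_charge R n)
  (D U K B : set E) (lam : set E -> R).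

(** Exhaust [U] by countably many boxes and apply Dynkin's lemma inside each one to the restriction
    of [lam]. The factor [K] is the whole space for the interiors of the pieces and a hyperplane for
    their boundaries. *)
Lemma null_on_boxes lam U K : signed_additive lam -> open U -> measurable K ->
  (forall a b, obox a b `<=` U -> lam (obox a b `&` K) = 0) -> null_on lam (U `&` K).
Proof.
move=> sl oU mK h; have [F [UF Fbox]] := open_bigcup_obox oU.
have mF m : measurable (F m).
  have [->|[a [b ->]]] := Fbox m; first exact: measurable0.
  by apply: open_measurable_rV; exact: open_obox.
rewrite UF setI_bigcupl; apply: null_on_bigcup => // m; first exact: measurableI.
have [->|[a [b FE]]] := Fbox m.
  by move=> B mB; rewrite set0I subset0 => ->; have [] := sl.
have abU : obox a b `<=` U by rewrite UF -FE; exact: bigcup_sup.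
have mabK : measurable (obox a b `&` K) by rewrite -FE; exact: measurableI.
move=> B mB; rewrite FE => BF.
rewrite -(setIidl BF); move: B mB {BF}.
apply: (signed_additive_eq0 (signed_additive_restr mabK sl) (@measurable_boxes R n)).
- exact: setI_closed_boxes.
- by rewrite setTI; exact: h.
- move=> _ [a' [b' ->]]; rewrite setIA oboxI; apply: h.
  by rewrite -oboxI; apply: subset_trans abU; exact: subIsetr.
Qed.

Definition lin_charge C mu B : R := mxdot C (mx_charge_val mu B).

Definition lin_integral C mu D phi : R :=
  \sum_i \sum_j C i j * charge_integral (mu i j) D phi.

(** Built from the full gradient; for symmetric [C] it agrees with the pairing against the
    symmetrized one. *)
Definition lin_gradient C D u phi : R :=
  \sum_i \sum_j C i j * dist_gradient D u i j phi.

Lemma lin_chargeE C mu B :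
  lin_charge C mu B = \sum_i \sum_j C i j * fine (mu i j B).
Proof. by apply: eq_bigr => i _; apply: eq_bigr => j _; rewrite mxE. Qed.

Lemma signed_additive_lin_charge C mu : signed_additive (lin_charge C mu).
Proof.
have -> : lin_charge C mu = fun B => \sum_i \sum_j C i j * fine (mu i j B).
  by apply/funext => B; exact: lin_chargeE.
apply: signed_additive_sum => i; apply: signed_additive_sum => j.
by apply: signed_additiveZ; exact: signed_additive_charge.
Qed.

Lemma lin_integral_indic C mu D B : measurable D -> measurable B ->
  lin_integral C mu D \1_B = lin_charge C mu (B `&` D).
Proof.
move=> mD mB; rewrite lin_chargeE; apply: eq_bigr => i _; apply: eq_bigr => j _.
by rewrite charge_integral_indic.
Qed.

Lemma lin_integral_cvg C mu D (f_ : nat -> E -> R) (f : E -> R) M : measurable D ->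
  (forall k, measurable_fun setT (f_ k)) -> measurable_fun setT f ->
  (forall x, D x -> f_ k x @[k --> \oo] --> f x) ->
  (forall k x, `|f_ k x| <= M) ->
  lin_integral C mu D (f_ k) @[k --> \oo] --> lin_integral C mu D f.
Proof.
move=> mD mf_ mf f_f f_M.
apply: cvg_sumr => i; apply: cvg_sumr => j; apply: cvgMr.
exact: charge_integral_cvg f_M.
Qed.

Lemma lin_integral_gradient C mu D u phi : sym_mx C -> is_sym_gradient D u mu ->
  test_function D phi -> lin_integral C mu D phi = lin_gradient C D u phi.
Proof.
move=> symC [_ muE] tphi; have CE i j : C i j = C j i by rewrite -[in LHS]symC mxE.
have E : \sum_i \sum_j C i j * dist_gradient D u j i phi = lin_gradient C D u phi.
  rewrite exchange_big/=; apply: eq_bigr => i _; apply: eq_bigr => j _.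
  by rewrite CE.
transitivity (2^-1 * (lin_gradient C D u phi +
    \sum_i \sum_j C i j * dist_gradient D u j i phi)); last by rewrite E; field.
rewrite /lin_gradient /lin_integral -big_split/= mulr_sumr; apply: eq_bigr => i _.
rewrite -big_split/= mulr_sumr; apply: eq_bigr => j _.
rewrite (muE _ tphi) /dist_sym_gradient [LHS]mulrCA; congr (_ * _).
exact: mulrDr.
Qed.

Lemma measurable_indic_rV B : measurable B -> measurable_fun setT (\1_B : E -> R).
Proof. by move=> mB; exact: measurable_indic. Qed.

Lemma bump_measurable a b m : measurable_fun setT (bump a b m : E -> R).
Proof.
by apply: continuous_measurable_rV; apply: elem_smooth_continuous; exact: elem_smooth_bump.
Qed.

Lemma normr_bump a b m (x : E) : `|bump a b m x| <= 1.
Proof. by rewrite ger0_norm ?bump_ge0 ?bump_le1. Qed.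

(** Reduces nullity to bumps, which converge boundedly to the indicators of boxes; the bump is
    smooth, so the gradient can be moved onto it. *)
Lemma null_on_lin_charge C mu D U K : open D -> open U -> U `<=` D ->
  measurable K ->
  (forall a b m, obox a b `<=` U ->
     lin_integral C mu D (fun x => bump a b m x * \1_K x) = 0) ->
  null_on (lin_charge C mu) (U `&` K).
Proof.
move=> oD oU UD mK h; apply: null_on_boxes => //.
  exact: signed_additive_lin_charge.
move=> a b abU; have mab : measurable (obox a b : set E).
  by apply: open_measurable_rV; exact: open_obox.
have mD : measurable D by exact: open_measurable_rV.
have -> : obox a b `&` K = (obox a b `&` K) `&` D.
  by apply/esym/setIidl => x [/abU/UD].
rewrite -lin_integral_indic//; last exact: measurableI.
have : lin_integral C mu D (fun x => bump a b m x * \1_K x) @[m --> \oo]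
    --> lin_integral C mu D \1_(obox a b `&` K).
  apply: (@lin_integral_cvg _ _ _ _ _ 1) => //.
  - move=> m; apply: measurable_funM; first exact: bump_measurable.
    exact: measurable_indic_rV.
  - by apply: measurable_indic_rV; exact: measurableI.
  - by move=> x _; rewrite indicI; apply: cvgM; [exact: bump_cvg|exact: cvg_cst].
  - move=> m x; rewrite normrM -[leRHS]mulr1 ler_pM//; first exact: normr_bump.
    by rewrite indicE; case: (_ \in _); rewrite ?normr1 ?normr0.
rewrite (_ : (fun m => _) = cst 0); last by apply/funext => m; exact: h.
by move=> H; apply/esym; exact: (cvg_unique _ (@cvg_cst _ _ _ _ _) H).
Qed.

Lemma mxdot_sym_skew C A : sym_mx C -> skew_mx A -> mxdot C A = 0.
Proof.
move=> symC skA; have CE i j : C i j = C j i by rewrite -[in LHS]symC mxE.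
have AE i j : A i j = - A j i.
  by have /matrixP/(_ j i) := skA; rewrite !mxE.
suff : mxdot C A = - mxdot C A by lra.
rewrite {1}/mxdot exchange_big/= /mxdot -sumrN; apply: eq_bigr => i _.
by rewrite -sumrN; apply: eq_bigr => j _; rewrite CE AE mulrN.
Qed.

Lemma lin_gradient_affine C D U u (A : 'M[R]_n) (b : E) phi :
  measurable D -> measurable U -> U `<=` D -> L1 D u ->
  {ae leb, forall x, U x -> u x = x *m A^T + b} -> test_function U phi ->
  lin_gradient C D u phi = mxdot C A * \int[leb]_(x in D) phi x.
Proof.
move=> mD mU UD uL ae tphi; rewrite /lin_gradient /mxdot mulr_suml.
apply: eq_bigr => i _; rewrite mulr_suml; apply: eq_bigr => j _.
by rewrite (dist_gradient_affine _ _ mD mU UD uL ae tphi) mulrA.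
Qed.

Lemma null_on_rigid C mu D U u (A : 'M[R]_n) (b : E) : sym_mx C -> open D ->
  open U -> U `<=` D -> is_sym_gradient D u mu -> L1 D u -> skew_mx A ->
  {ae leb, forall x, U x -> u x = x *m A^T + b} ->
  null_on (lin_charge C mu) U.
Proof.
move=> symC oD oU UD smu uL skA ae; rewrite -[U]setIT.
apply: (null_on_lin_charge oD oU UD measurableT) => a' b' m abU.
have tb : test_function U (bump a' b' m) by exact: bump_test.
rewrite (_ : (fun x => _) = bump a' b' m).
  rewrite (lin_integral_gradient symC smu (test_function_sub UD tb)).
  rewrite (lin_gradient_affine C _ _ UD uL ae tb); try exact: open_measurable_rV.
  by rewrite mxdot_sym_skew ?mul0r.
by apply/funext => x; rewrite indicT mulr1.
Qed.

Lemma integrable_mul_bounded D (f g : E -> R) : measurable D ->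
  leb.-integrable D (EFin \o f) -> bounded_measurable g ->
  leb.-integrable D (EFin \o (fun x => f x * g x)).
Proof.
move=> mD fi [mg [M gM]]; apply: (integrableMl mD fi).
  exact: measurable_funTS.
exists M; split; first exact: num_real.
by move=> N MN x _ /=; apply: le_trans (gM x) (ltW MN).
Qed.

Lemma Rintegral_sum D (I : Type) (r : seq I) (F : I -> E -> R) : measurable D ->
  (forall i, leb.-integrable D (EFin \o F i)) ->
  \int[leb]_(x in D) (\sum_(i <- r) F i x) =
  \sum_(i <- r) \int[leb]_(x in D) F i x.
Proof.
move=> mD iF; have iS s : leb.-integrable D (EFin \o (fun x => \sum_(i <- s) F i x)).
  rewrite (_ : EFin \o _ = fun x => (\sum_(i <- s) (F i x)%:E)%E).
    by apply: integrable_sum => // i _; exact: iF.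
  by apply/funext => x /=; rewrite sumEFin.
elim: r => [|i r IH].
  rewrite big_nil; under eq_Rintegral do rewrite big_nil.
  by rewrite /Rintegral integral0.
rewrite big_cons -IH -RintegralD//; apply: eq_Rintegral => x _.
by rewrite big_cons.
Qed.

(** The sum over [j] is brought under the integral so that [C] acts on the gradient of [phi]
    pointwise; cancellations in that product can then be used before any limit. *)
Lemma lin_gradientE C D u phi U : measurable D -> L1 D u -> test_function U phi ->
  lin_gradient C D u phi = - \sum_i
    \int[leb]_(x in D) (u x ord0 i * \sum_j C i j * partial j phi x).
Proof.
move=> mD uL tphi; rewrite /lin_gradient -sumrN; apply: eq_bigr => i _.
rewrite (_ : \int[leb]_(x in D) _ = \int[leb]_(x in D)
   (\sum_j C i j * (u x ord0 i * partial j phi x))); last first.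
  by apply: eq_Rintegral => x _; rewrite mulr_sumr; apply: eq_bigr => j _; ring.
have ii j : leb.-integrable D (EFin \o (fun x => u x ord0 i * partial j phi x)).
  apply: integrable_mul_bounded => //; first exact: uL.
  exact: bounded_measurable_partial tphi.
rewrite Rintegral_sum//; last first.
  move=> j; have := integrableZl mD (C i j) (ii j).
  by apply: eq_integrable => // x _ /=; rewrite ?EFinM.
rewrite -sumrN; apply: eq_bigr => j _.
by rewrite RintegralZl// /dist_gradient mulrN.
Qed.

(** The gradient of the cut-off is a multiple of [v], hence is annihilated by every symmetric [C]
    with [v *m C = 0]. *)
Lemma partial_cut v c m : exists h, elem_smooth h /\
  forall j, partial j (cut v c m) = (fun x : E => v ord0 j * h x).
Proof.
pose v1 := m%:R *: v; pose v2 := - m%:R *: v.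
pose Q : {poly R} := 'X^2 * (1 - 1^`()).
pose h (x : E) := expR 2 * (flat 1 (dotp x v1 + (1 - m%:R * c)) *
   ((- m%:R) * flat Q (dotp x v2 + (1 + m%:R * c))) +
   (m%:R * flat Q (dotp x v1 + (1 - m%:R * c))) *
   flat 1 (dotp x v2 + (1 + m%:R * c))).
exists h; split.
  apply: elem_mul; first exact: elem_cst.
  by apply: elem_add; apply: elem_mul; try exact: elem_flat;
    apply: elem_mul; [exact: elem_cst|exact: elem_flat|exact: elem_cst|exact: elem_flat].
move=> j; have d P w d x : differentiable (fun x : E => flat P (dotp x w + d)) x.
  by apply: elem_smooth_differentiable; exact: elem_flat.
have d' x : differentiable (fun x : E => flat 1 (dotp x v1 + (1 - m%:R * c)) *
   flat 1 (dotp x v2 + (1 + m%:R * c))) x.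
  by apply: elem_smooth_differentiable; apply: elem_mul; exact: elem_flat.
rewrite /cut partialM// partial_cst partialM// !partial_flat; apply/funext => x.
by rewrite /h /v1 /v2 !mxE -/Q; ring.
Qed.

(* Cutting off near the hyperplane produces no derivative term for a functional
   C with [v C = 0], since the cut-off only varies in the direction v. *)
Lemma null_on_hyperplane C mu D u v c : sym_mx C -> v *m C = 0 -> v != 0 ->
  open D -> is_sym_gradient D u mu -> L1 D u ->
  null_on (lin_charge C mu) (D `&` [set x | dotp x v = c]).
Proof.
move=> symC vC v0 oD smu uL; have mD : measurable D by exact: open_measurable_rV.
set H := [set x | dotp x v = c].
have mH : measurable H by apply: closed_measurable_rV; exact: closed_hyperplane.
have vC' i : \sum_j C i j * v ord0 j = 0.
  have /rowP/(_ i) := vC; rewrite !mxE => vCi; rewrite -[RHS]vCi.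
  apply: eq_bigr => j _.
  by rewrite -[in RHS]symC mxE mulrC.
apply: (null_on_lin_charge oD oD (@subset_refl _ D) mH) => a b m abD; set phi := bump a b m.
have tphi : test_function D phi by exact: bump_test.
have ecut k : elem_smooth (cut v c k : E -> R) by exact: elem_smooth_cut.
have mcut k : measurable_fun setT (cut v c k : E -> R).
  by apply: continuous_measurable_rV; exact: elem_smooth_continuous.
have ncut k (x : E) : `|cut v c k x| <= expR 2.
  by rewrite ger0_norm ?cut_ge0 ?cut_le.
have tk k : test_function D (fun x => phi x * cut v c k x).
  exact: bump_mul_test.
pose d i (x : E) := \sum_j C i j * partial j phi x.
have gradE k : lin_integral C mu D (fun x => phi x * cut v c k x) =
    - \sum_i \int[leb]_(x in D) (u x ord0 i * d i x * cut v c k x).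
  rewrite (lin_integral_gradient symC smu (tk k)) (lin_gradientE _ mD uL (tk k)).
  congr (- _); apply: eq_bigr => i _; apply: eq_Rintegral => x _.
  rewrite -mulrA; congr (_ * _); have [h [_ hE]] := partial_cut v c k.
  transitivity (\sum_j (phi x * h x * (C i j * v ord0 j) +
      C i j * partial j phi x * cut v c k x)).
    apply: eq_bigr => j _; rewrite partialM ?hE; first by ring.
    - by move=> y; apply: elem_smooth_differentiable; exact: elem_smooth_bump.
    - by move=> y; exact: elem_smooth_differentiable.
  by rewrite big_split/= -mulr_sumr vC' mulr0 add0r /d mulr_suml.
(* One sequence has two limits. Against the measure the cut-offs converge to the indicator of [H];
   against Lebesgue measure, dominated by [expR 2] times an integrable function, they leave an
   integral over the null set [H]. *)
have l1 : lin_integral C mu D (fun x => phi x * cut v c k x) @[k --> \oo] -->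
    lin_integral C mu D (fun x => phi x * \1_H x).
  apply: (@lin_integral_cvg _ _ _ _ _ (expR 2)) => //.
  - by move=> k; apply: measurable_funM; [exact: bump_measurable|exact: mcut].
  - by apply: measurable_funM; [exact: bump_measurable|exact: measurable_indic_rV].
  - by move=> x _; apply: cvgM; [exact: cvg_cst|exact: cut_cvg].
  - by move=> k x; rewrite normrM -[leRHS]mul1r ler_pM//; exact: normr_bump.
have iud i : leb.-integrable D (EFin \o (fun x => u x ord0 i * d i x)).
  rewrite (_ : EFin \o _ = fun x =>
     (\sum_j (C i j * (u x ord0 i * partial j phi x))%:E)%E).
    apply: integrable_sum => // j _.
    have := integrable_mul_bounded mD (uL i) (bounded_measurable_partial j tphi).
    by move/(integrableZl mD (C i j)); apply: eq_integrable.
  apply/funext => x /=; rewrite sumEFin; congr (_%:E).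
  by rewrite /d mulr_sumr; apply: eq_bigr => j _; ring.
have mud i : measurable_fun D (fun x => u x ord0 i * d i x).
  by apply/measurable_EFinP; have /integrableP[] := iud i.
have l2 : - (\sum_i \int[leb]_(x in D) (u x ord0 i * d i x * cut v c k x))
   @[k --> \oo] --> - (\sum_i \int[leb]_(x in D) (u x ord0 i * d i x * \1_H x)).
  apply: cvgN; apply: cvg_sumr => i.
  apply: (@Rintegral_dominated_cvg _ _ _ _ _ _ _
    (fun x => expR 2 * `|u x ord0 i * d i x|)) => //.
  - by move=> k; apply: measurable_funM => //; exact: measurable_funTS.
  - by apply: measurable_funM => //; apply: measurable_funTS; exact: measurable_indic_rV.
  - by move=> x _; apply: cvgM; [exact: cvg_cst|exact: cut_cvg].
  - have := integrableZl mD (expR 2) (integrable_norm (iud i)).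
    by apply: eq_integrable => // x _ /=; rewrite ?EFinM.
  - by move=> k x _; rewrite normrM mulrC ler_wpM2r.
have z : - (\sum_i \int[leb]_(x in D) (u x ord0 i * d i x * \1_H x)) = 0.
  rewrite big1 ?oppr0// => i _; rewrite (_ : \int[leb]_(x in D) _ =
     \int[leb]_(x in D) (0 : R)); first by rewrite /Rintegral integral0.
  congr fine; apply: ae_eq_integral => //.
    by apply/measurable_EFinP; apply: measurable_funM.
  have aeH : {ae leb, forall x, ~ H x}.
    by exists H; split => //; [exact: lebesgue_rV_hyperplane|move=> x /= /contrapT].
  by apply: filterS aeH => x xH _; rewrite indicE memNset// mulr0.
have gE : (fun k => lin_integral C mu D (fun x => phi x * cut v c k x)) =
    (fun k => - \sum_i \int[leb]_(x in D) (u x ord0 i * d i x * cut v c k x)).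
  by apply/funext => k; exact: gradE.
rewrite gE in l1; rewrite -[RHS]z.
exact: (cvg_unique _ l1 l2).
Qed.

(** All symmetric [C] with [v *m C = 0] pair to zero with the value on [B], and [odot_orthogonal]
    converts this into the rank-one form. *)
Lemma charge_val_hyperplane mu D u v c B : v != 0 -> open D ->
  is_sym_gradient D u mu -> L1 D u -> measurable B ->
  B `<=` D `&` [set x | dotp x v = c] ->
  exists m, mx_charge_val mu B = odot m v.
Proof.
move=> v0 oD smu uL mB BH; have [symmu _] := smu.
apply: odot_orthogonal => //; first exact: symmu.
move=> C symC vC; rewrite -[LHS]/(lin_charge C mu B).
exact: (null_on_hyperplane symC vC v0 oD smu uL mB BH).
Qed.

End sym_gradient.

(** * Piecewise rigid functions: the bound of the pairing by the variation *)

Section piecewise_rigid.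
Context {R : realType} {n : nat}.
Local Notation E := 'rV[R]_n.
Local Notation leb := (@lebesgue_rV R n).
Implicit Types (phi : E -> R) (C : 'M[R]_n) (u : E -> E) (mu : @mx_charge R n)
  (D U K B G P : set E).

Definition hyperplane_or_empty K :=
  K = set0 \/ exists v c, v != 0 /\ K = [set x | dotp x v = c].

Lemma measurable_hyperplane_or_empty K : hyperplane_or_empty K -> measurable K.
Proof.
move=> [->|[v [c [_ ->]]]]; first exact: measurable0.
by apply: closed_measurable_rV; exact: closed_hyperplane.
Qed.

(** A point of [P] on none of the bounding hyperplanes satisfies its defining inequalities strictly,
    hence in a neighbourhood. Codes that denote no half-space give the empty set. *)
Lemma polyhedral_boundary P : polyhedral P -> exists K : (set E)^nat,
  (forall m, hyperplane_or_empty (K m)) /\ P `<=` P° `|` \bigcup_m K m.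
Proof.
move=> [k [m [H [hH PE]]]].
have {hH} /choice[vc vcP] (p : {i : 'I_k & 'I_(m i)}) : exists w : E * R,
    w.1 != 0 /\ (H (tag p) (tagged p) = [set x | dotp x w.1 < w.2] \/
                 H (tag p) (tagged p) = [set x | dotp x w.1 <= w.2]).
  by have [v [c h]] := hH (tag p) (tagged p); exists (v, c).
pose K l := if unpickle l is Some p then
  [set x : E | dotp x (vc p).1 = (vc p).2] else set0.
exists K; split=> [l|x Px].
  rewrite /K; case: unpickle => [p|]; last by left.
  by right; exists (vc p).1, (vc p).2; split=> //; have [] := vcP p.
have [[l Kx]|nK] := pselect (exists l, K l x); first by right; exists l.
left; have := Px; rewrite {1}PE => -[i _ Hx].
pose O := [set y : E | forall j : 'I_(m i),
  dotp y (vc (Tagged (fun i => 'I_(m i)) j)).1 <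
    (vc (Tagged (fun i => 'I_(m i)) j)).2].
have oO : open O.
  apply: (@open_forall _ _ (fun j => [set y : E |
    dotp y (vc (Tagged (fun i => 'I_(m i)) j)).1 <
      (vc (Tagged (fun i => 'I_(m i)) j)).2])) => j.
  set v := (vc _).1; set c := (vc _).2.
  apply: (@open_comp _ _ (fun y : E => dotp y v) [set t | t < c]); last exact: open_lt.
  by move=> y _; have [d _] := is_diff_dotp v y; exact: differentiable_continuous.
have Ox : O x.
  move=> j; set p := Tagged (fun i => 'I_(m i)) j.
  have nx : dotp x (vc p).1 <> (vc p).2.
    by move=> e; apply: nK; exists (pickle p); rewrite /K pickleK.
  have := Hx j Logic.I; have [_ [] /= hE] := vcP p; rewrite hE /= => le.
    exact: le.
  by rewrite lt_neqAle le andbT; exact/eqP.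
have OP : O `<=` P.
  move=> y Oy; rewrite PE; exists i => // j _.
  by have [_ [] /= ->] := vcP (Tagged (fun i => 'I_(m i)) j) => /=;
    [|apply/ltW]; exact: Oy.
by rewrite /interior/=; apply: filterS OP _; exact: open_nbhs_nbhs.
Qed.

Lemma polyhedral_cover_boundary (P : (set E)^nat) : (forall i, polyhedral (P i)) ->
  exists K : (set E)^nat, (forall m, hyperplane_or_empty (K m)) /\
    forall i, P i `<=` (P i)° `|` \bigcup_m K m.
Proof.
move=> polP; have /choice[K_ hK] i := polyhedral_boundary (polP i).
pose K l := if unpickle l is Some p then K_ p.1 p.2 else set0 : set E.
exists K; split=> [l|i x /(hK i).2 [?|[m _ Kx]]].
- rewrite /K; case: unpickle => [p|]; last by left.
  exact: (hK p.1).1.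
- by left.
- by right; exists (pickle (i, m)) => //; rewrite /K pickleK.
Qed.

(** The sum counts the natural numbers below [s], so it is the ceiling of [s]. The two inductions
    bound partial counts, whence the minima. *)
Lemma level_count (k : nat) (s : R) : 0 <= s -> s <= k%:R ->
  s <= \sum_(m < k) (m%:R < s)%R%:R <= s + 1.
Proof.
move=> s0; have lower j : Num.min s j%:R <= \sum_(m < j) (m%:R < s)%R%:R.
  elim: j => [|j IH]; first by rewrite big_ord0 ge_min lexx orbT.
  rewrite big_ord_recr/=; have [js|sj] := ltrP j%:R s.
    rewrite min_r ?(ltW js)// in IH; rewrite ge_min -natr1 lerD2r IH orbT//.
  by rewrite min_l// in IH; rewrite addr0 ge_min IH.
have upper j : \sum_(m < j) (m%:R < s)%R%:R <= Num.min (s + 1) j%:R.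
  elim: j => [|j IH]; first by rewrite big_ord0 le_min lexx addr_ge0.
  move: IH; rewrite big_ord_recr/= !le_min => /andP[IH1 IH2].
  have [js|sj] := ltrP j%:R s.
    by rewrite -natr1 !lerD2r IH2 (le_trans IH2 (ltW js)).
  by rewrite addr0 IH1 -natr1 (le_trans IH2)// lerDl.
move=> sk; apply/andP; split; first by have := lower k; rewrite min_l.
by have := upper k; rewrite le_min => /andP[].
Qed.

Lemma lin_integral_sum_indic C mu D (A : (set E)^nat) k : measurable D ->
  (forall m, measurable (A m)) ->
  lin_integral C mu D (fun x => \sum_(m < k) \1_(A m) x) =
  \sum_(m < k) lin_charge C mu (A m `&` D).
Proof.
move=> mD mA; have bS j : bounded_measurable (fun x : E => \sum_(m < j) \1_(A m) x : R).
  split; first by apply: measurable_sum => m; exact: measurable_indic_rV.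
  exists j%:R => x; rewrite ger0_norm; last by apply: sumr_ge0.
  apply: (@le_trans _ _ (\sum_(m < j) 1)); last by rewrite sumr_const card_ord.
  by apply: ler_sum => m _; rewrite indicE; case: (_ \in _).
elim: k => [|k IH].
  rewrite big_ord0 (_ : (fun x => _) = \1_set0).
    rewrite lin_integral_indic// set0I.
    by have [] := signed_additive_lin_charge C mu.
  by apply/funext => x; rewrite big_ord0 indic0.
rewrite big_ord_recr/= -IH -lin_integral_indic//.
rewrite /lin_integral -big_split/=; apply: eq_bigr => i _.
rewrite -big_split/=; apply: eq_bigr => j _; rewrite -mulrDr; congr (_ * _).
rewrite -charge_integralD//.
  by congr (charge_integral _ _ _); apply/funext => x; rewrite big_ord_recr.
- exact: bS.
- split; first exact: (measurable_indic_rV (mA _)).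
  by exists 1 => x; rewrite indicE; case: (_ \in _); rewrite ?normr1 ?normr0.
Qed.

(* averages of indicators of superlevel sets approximate phi uniformly *)
Lemma lin_integral_le C mu D phi r : measurable D -> measurable_fun setT phi ->
  (forall x, 0 <= phi x <= 1) ->
  (forall G, measurable G -> G `<=` D -> lin_charge C mu G <= r) ->
  lin_integral C mu D phi <= r.
Proof.
move=> mD mphi phi01 hG.
pose A k (m : nat) : set E := [set x | m%:R < k.+1%:R * phi x].
have mA k m : measurable (A k m).
  have mf : measurable_fun setT (fun x => k.+1%:R * phi x) by exact: measurable_funM.
  rewrite (_ : A k m = (fun x => k.+1%:R * phi x) @^-1` `]m%:R, +oo[).
    by rewrite -[X in measurable X]setTI; apply: mf.
  by apply/seteqP; split=> x /=; rewrite in_itv/= andbT.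
pose S k (x : E) : R := \sum_(m < k.+1) \1_(A k m) x.
have SE k x : k.+1%:R * phi x <= S k x <= k.+1%:R * phi x + 1.
  have /andP[p0 p1] := phi01 x.
  have -> : S k x = \sum_(m < k.+1) (m%:R < k.+1%:R * phi x)%R%:R.
    by apply: eq_bigr => m _; rewrite indicE /A; congr (nat_of_bool _)%:R;
      apply/idP/idP; rewrite inE.
  by apply: level_count; [rewrite mulr_ge0|rewrite ger_pMr].
have mS k : measurable_fun setT (S k).
  by apply: measurable_sum => m; exact: measurable_indic_rV.
have bS k x : `|k.+1%:R^-1 * S k x| <= 2.
  have /andP[p0 p1] := phi01 x; have /andP[s0 s1] := SE k x.
  have k0 : 0 < k.+1%:R :> R by [].
  rewrite ger0_norm; last first.
    by rewrite mulr_ge0 ?invr_ge0// (le_trans _ s0)// mulr_ge0.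
  rewrite ler_pdivrMl// (le_trans s1)// mulr_natr mulr2n lerD ?ger_pMr//.
  by rewrite ler1n.
have lS k : lin_integral C mu D (fun x => k.+1%:R^-1 * S k x) <= r.
  have k0 : 0 < k.+1%:R :> R by [].
  have -> : lin_integral C mu D (fun x => k.+1%:R^-1 * S k x) =
      k.+1%:R^-1 * lin_integral C mu D (S k).
    rewrite /lin_integral mulr_sumr; apply: eq_bigr => i _; rewrite mulr_sumr.
    apply: eq_bigr => j _; rewrite charge_integralZ//; first by rewrite mulrCA.
    split; first exact: mS.
    exists (k.+1%:R * 2) => x; have := bS k x.
    by rewrite normrM gtr0_norm ?invr_gt0// ler_pdivrMl.
  rewrite ler_pdivrMl// lin_integral_sum_indic//.
  apply: (@le_trans _ _ (\sum_(m < k.+1) r)).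
    by apply: ler_sum => m _; apply: hG; [exact: measurableI|exact: subIsetr].
  by rewrite sumr_const card_ord mulr_natl.
have cS : lin_integral C mu D (fun x => k.+1%:R^-1 * S k x) @[k --> \oo] -->
    lin_integral C mu D phi.
  apply: (@lin_integral_cvg _ _ _ _ _ _ _ 2) => //.
    by move=> k; apply: measurable_funM.
  move=> x _; apply/cvgrPdist_le => e e0; near=> k.
  have k0 : 0 < k.+1%:R :> R by [].
  have ke : e^-1 <= k.+1%:R.
    rewrite (@le_trans _ _ (k%:R : R))// ?ler_nat//.
    by near: k; exact: nbhs_infty_ger.
  have {}ke : k.+1%:R^-1 <= e by rewrite -[leRHS]invrK lef_pV2 ?posrE ?invr_gt0.
  apply: le_trans ke; have /andP[s0 s1] := SE k x.
  rewrite distrC ger0_norm; last by rewrite subr_ge0 ler_pdivlMl.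
  by rewrite lerBlDl ler_pdivrMl// mulrDr mulfV ?gt_eqF.
rewrite -(cvg_lim _ cS)//; apply: limr_le; first by apply: cvgP cS.
by apply: nearW => k; exact: lS.
Unshelve. all: by end_near. Qed.

Section dual.
Variables (N : 'M[R]_n -> R) (C : 'M[R]_n).
Hypothesis normN : norm_on_sym N.
Hypothesis N_odot : forall a b : E, N (odot a b) = frob (odot a b).
Hypothesis symC : sym_mx C.
Hypothesis C_dual : forall a b : E, mxdot C (odot a b) <= frob (odot a b).

(* The symmetrized gradient of a piecewise rigid u lives on countably many
   hyperplanes and takes its values in the symmetrized rank-one matrices there. *)
Lemma PR_lin_charge_le mu D u G (r : R) : open D -> L1 D u -> PR u ->
  is_sym_gradient D u mu -> (Defs.variation N mu D <= r%:E)%E ->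
  measurable G -> G `<=` D -> lin_charge C mu G <= r.
Proof.
move=> oD uL [P [A [b [polP _ PT skA uE]]]] smu Vr mG GD.
have [symmu _] := smu; have [N0 _ _ _] := normN.
have sl := signed_additive_lin_charge C mu.
have mD : measurable D by exact: open_measurable_rV.
have [K [hK PK]] := polyhedral_cover_boundary polP.
have mK m : measurable (K m) by apply: measurable_hyperplane_or_empty; exact: hK.
have oZ i : open ((P i)° `&` D) by apply: openI => //; exact: open_interior.
have mZ i : measurable ((P i)° `&` D) by exact: open_measurable_rV.
apply: (signed_additive_le (Z := \bigcup_i ((P i)° `&` D)) sl mK mG).
- exact: bigcup_measurable.
- apply: null_on_bigcup => // i.
  apply: (null_on_rigid symC oD (oZ i) (@subIsetr _ _ _) smu uL (skA i)).
  by apply: filterS (uE i) => x h [Px _]; apply: h; exact: interior_subset.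
- move=> x Gx; have [i _ /PK[Px|Kx]] : (\bigcup_i P i) x by rewrite PT.
    by left; exists i => //; split=> //; exact: GD.
  by right.
move=> m; pose S k := G `&` seqDU K k.
have mS k : measurable (S k).
  by apply: measurableI => //; apply: measurableD => //; exact: bigsetU_measurable.
have SD k : S k `<=` D by move=> x [/GD].
have tS : trivIset setT S by apply: trivIset_setIl; exact: trivIset_seqDU.
have lS k : lin_charge C mu (S k) <= N (mx_charge_val mu (S k)).
  have SK : S k `<=` K k by move=> x [_ []].
  have [K0|[v [c [v0 KE]]]] := hK k.
    have -> : S k = set0 by apply/seteqP; split=> // x /SK; rewrite K0.
    by have [-> _ _] := sl; apply: N0; apply: symmu.
  have [|w wE] := @charge_val_hyperplane _ _ mu D u v c (S k) v0 oD smu uL (mS k).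
    by move=> x Sx; split; [exact: SD Sx|rewrite -KE; exact: SK].
  by rewrite /lin_charge wE N_odot; exact: C_dual.
(* The remainder [T] completes the slices to a finite partition of [D], as [variation] demands; its
   contribution is nonnegative and is dropped at the end. *)
pose T := D `\` \big[setU/set0]_(k < m) S k.
pose F (i : 'I_m.+1) := if (i < m)%N then S i else T.
have mT : measurable T by apply: measurableD => //; exact: bigsetU_measurable.
have FV : (\sum_(i < m.+1) N (mx_charge_val mu (F i)))%:E \in
    [set v | exists (k : nat) (F : 'I_k -> set E),
    [/\ forall i, measurable (F i), trivIset setT F, \bigcup_i F i = D &
        v = (\sum_(i < k) N (mx_charge_val mu (F i)))%:E]].
  rewrite inE; exists m.+1, F; split => //.
  - by move=> i; rewrite /F; case: ifP.
  - move=> i j _ _ [x [Fi Fj]]; apply/val_inj => /=.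
    have im (l : 'I_m.+1) : (l < m)%N = false -> val l = m.
      move=> /negbT; rewrite -leqNgt => ml; apply/eqP.
      by rewrite eqn_leq ml -ltnS ltn_ord.
    have nST (l : 'I_m.+1) y : (l < m)%N -> S l y -> T y -> False.
      move=> lm Sy [_]; apply; rewrite -bigcup_mkord.
      by exists (l : nat).
    move: Fi Fj; rewrite /F; case: ifPn => Hi; case: ifPn => Hj Fi Fj.
    + by apply: (tS i j) => //; exists x.
    + by case: (nST _ _ Hi Fi Fj).
    + by case: (nST _ _ Hj Fj Fi).
    + by rewrite (im i (negbTE Hi)) (im j (negbTE Hj)).
  - apply/seteqP; split=> x.
      by move=> [i _]; rewrite /F; case: ifP => _; [exact: SD|case].
    move=> Dx; have [Sx|nSx] := pselect ((\big[setU/set0]_(k < m) S k) x).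
      move: (Sx); rewrite -bigcup_mkord => -[k /= km Skx].
      have km1 : (k < m.+1)%N by exact: ltnW.
      by exists (Ordinal km1) => //; rewrite /F /= km.
    by exists ord_max => //; rewrite /F /= ltnn.
have := ereal_sup_ubound (set_mem FV).
move/le_trans => /(_ _ Vr); rewrite lee_fin big_ord_recr/=.
have -> : \sum_(i < m) N (mx_charge_val mu (F (widen_ord (leqnSn m) i))) =
    \sum_(i < m) N (mx_charge_val mu (S i)).
  by apply: eq_bigr => i _; rewrite /F /= ltn_ord.
move=> h; apply: le_trans h.
rewrite -[leLHS]addr0 lerD//; first by apply: ler_sum => k _; exact: lS.
by apply: N0; apply: symmu; rewrite /F; case: ifP.
Qed.

Lemma PR_lin_gradient_le D u phi : open D -> L1 D u -> PR u ->
  test_function D phi -> (forall x, 0 <= phi x <= 1) ->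
  ((lin_gradient C D u phi)%:E <= sym_gradient_variation N D u)%E.
Proof.
move=> oD uL pu tphi phi01; rewrite /sym_gradient_variation.
case: pselect => [h|_]; last exact: leey.
set mu := sval _; have smu : is_sym_gradient D u mu := svalP (cid h).
have le r : (Defs.variation N mu D <= r%:E)%E -> lin_gradient C D u phi <= r.
  move=> Vr; rewrite -(lin_integral_gradient symC smu tphi).
  apply: lin_integral_le => //; first exact: open_measurable_rV.
    by have [] := bounded_measurable_test tphi.
  by move=> G mG GD; exact: (PR_lin_charge_le oD uL pu smu Vr mG GD).
case VE : (Defs.variation N mu D) => [r| |]; last 2 first.
- exact: leey.
(* The value [-oo] would bound [lin_gradient C D u phi] by itself minus 1. *)
- have := le (lin_gradient C D u phi - 1); rewrite VE leNye => /(_ isT).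
  by move=> hh; exfalso; clear -hh; lra.
by rewrite lee_fin; apply: le; rewrite VE.
Qed.

End dual.

End piecewise_rigid.

(** * Linear displacements of a cube *)

Section cube.
Context {R : realType} {n : nat}.
Local Notation E := 'rV[R]_n.

Definition cube : set E := obox (const_mx (- 1)) (const_mx 1).

Lemma cubeP (x : E) : cube x <-> forall j, `|x ord0 j| < 1.
Proof. by split=> h j; have := h j; rewrite !mxE ltr_norml. Qed.

Lemma open_cube : open cube.
Proof. exact: open_obox. Qed.

Lemma bounded_cube : bounded_set cube.
Proof.
exists 1; split => // M M1 x /cubeP h /=; apply: rV_norm_le => [|j].
  by rewrite (le_trans _ (ltW M1)).
by rewrite (le_trans (ltW (h j)))// ltW.
Qed.

Lemma closure_cube (x : E) : closure cube x -> forall j, `|x ord0 j| <= 1.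
Proof.
move=> cx j; have : cbox (const_mx (- 1)) (const_mx 1) x.
  suff : closure cube `<=` cbox (const_mx (- 1)) (const_mx 1 : E) by exact.
  have CE := (closure_id (cbox (const_mx (- 1)) (const_mx 1 : E))).1
    (@closed_cbox _ _ _ _).
  rewrite CE; apply: closure_subset => y h k; have := h k.
  by rewrite in_itv/= => /andP[/ltW -> /ltW ->].
by move=> /(_ j); rewrite !mxE in_itv/= ler_norml.
Qed.

Lemma dotp_le_frob (x v : E) : frob v = 1 -> `|dotp x v| <= frob x.
Proof.
move=> v1; rewrite frob_row -[leLHS]sqrtr_sqr ler_wsqrtr// dotpE.
apply: le_trans (CS_sum _ _) _; rewrite !dotpE.
have -> : \sum_i v ord0 i ^+ 2 = 1.
  have : dotp v v = 1 by rewrite -(sqr_sqrtr (dotp_ge0 v)) -frob_row v1 expr1n.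
  by rewrite dotpE => <-; apply: eq_bigr => i _; rewrite expr2.
by rewrite mulr1; apply: ler_sum => i _; rewrite expr2.
Qed.

(* Near a boundary point x0 only the faces [x0_j y_j = 1] with [|x0_j| = 1]
   matter; nu is the normalized sum of their outer normals, and all of these
   faces rise at the same rate along nu. *)
Lemma lipschitz_boundary_cube : lipschitz_boundary cube.
Proof.
move=> x0 [/closure_cube x01 nx0].
pose act := [pred j | `|x0 ord0 j| == 1].
have actE j : j \in act -> x0 ord0 j ^+ 2 = 1.
  by rewrite inE => /eqP h; rewrite -real_normK ?num_real// h expr1n.
have [j0 aj0] : exists j, j \in act.
  apply: contrapT => h; apply: nx0; rewrite /interior/=.
  apply: open_nbhs_nbhs; split; first exact: open_cube.
  apply/cubeP => j; rewrite lt_neqAle x01 andbT.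
  by apply/negP => hj; apply: h; exists j.
pose m := #|act|; have m0 : 0 < m%:R :> R by rewrite ltr0n; apply/card_gt0P; exists j0.
pose s := Num.sqrt (m%:R : R); have s0 : 0 < s by rewrite sqrtr_gt0.
have sn0 : s != 0 by rewrite gt_eqF.
have ss : s ^+ 2 = m%:R by rewrite sqr_sqrtr// ltW.
pose nu : E := \row_j (if j \in act then x0 ord0 j / s else 0).
have nu1 : frob nu = 1.
  rewrite frob_row (_ : dotp nu nu = 1) ?sqrtr1// dotpE.
  rewrite (bigID act)/= [X in _ + X]big1 ?addr0; last first.
    by move=> j /negbTE nj; rewrite mxE ifF ?mul0r.
  rewrite (eq_bigr (fun=> m%:R^-1)); last first.
    move=> j aj; by rewrite mxE ifT// -ss -expr2 expr_div_n actE// mul1r.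
  rewrite sumr_const -[LHS]mulr_natr; exact: (mulVf (lt0r_neq0 m0)).
(* The default of the maximum is itself an active coordinate, so [M] is the true maximum over the
   active ones. *)
pose M (y : E) := \big[Num.max/x0 ord0 j0 * y ord0 j0]_(j | j \in act) (x0 ord0 j * y ord0 j).
have M_le (y : E) c : (forall j, j \in act -> x0 ord0 j * y ord0 j <= c) -> M y <= c.
  by move=> h; apply/bigmax_leP; split; [exact: h|exact: h].
have le_M (y : E) j : j \in act -> x0 ord0 j * y ord0 j <= M y.
  by move=> aj; apply: le_bigmax_cond.
have M_lt (y : E) : M y < 1 <-> forall j, j \in act -> x0 ord0 j * y ord0 j < 1.
  split; first by move=> h j aj; exact: le_lt_trans (le_M y j aj) h.
  by move=> h; apply/bigmax_ltP; split; [exact: h|exact: h].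
(* Near [x0] the cube is [M y < 1]. Along [nu] the function [M] grows with slope [1 / s], so the
   factor [s] makes [g] constant in that direction. *)
pose g (y : E) := dotp y nu + s * (1 - M y).
(* Within [r] the inactive coordinates stay inside []-1, 1[], and [r <= 1] keeps the active ones
   away from the opposite face. *)
pose r := \big[Num.min/1]_(j | j \notin act) (1 - `|x0 ord0 j|).
have r0 : 0 < r.
  apply: lt_bigmin => // j nj; rewrite subr_gt0 lt_neqAle x01 andbT; exact: nj.
have r1 : r <= 1 by exact: bigmin_le_id.
have M_lip (x y : E) : M x - M y <= frob (x - y).
  rewrite lerBlDl; apply: M_le => j aj.
  have : x0 ord0 j * x ord0 j - x0 ord0 j * y ord0 j <= frob (x - y).
    rewrite -mulrBr; apply: le_trans (ler_norm _) _; rewrite normrM.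
    have := aj; rewrite inE => /eqP ->; rewrite mul1r.
    by have := normr_coord_le_frob (x - y) j; rewrite !mxE.
  by have := le_M y j aj; lra.
have M_nu (x : E) t j : j \in act -> x0 ord0 j * (x + t *: nu) ord0 j =
    x0 ord0 j * x ord0 j + t / s.
  by move=> aj; rewrite !mxE aj -[t / s]mul1r -(actE j aj); ring.
exists nu, g, (1 + s), r; split => //.
- move=> x y; have xy : frob (y - x) = frob (x - y).
    by rewrite -opprB !frob_row /dotp linearN/= mulNmx mulmxN opprK.
  have -> : g x - g y = dotp (x - y) nu + s * (M y - M x).
    have -> : dotp (x - y) nu = dotp x nu - dotp y nu.
      by rewrite dotpDl -[- y]scaleN1r dotpZl mulN1r.
    by rewrite /g; ring.
  apply: le_trans (ler_normD _ _) _; rewrite mulrDl mul1r lerD ?dotp_le_frob//.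
  rewrite normrM (gtr0_norm s0) ler_wpM2l ?(ltW s0)// ler_norml.
  by have := M_lip x y; have := M_lip y x; rewrite xy => h1 h2; apply/andP; split; lra.
- move=> x t; rewrite /g dotpDl dotpZl.
  have -> : dotp nu nu = 1 by rewrite -(sqr_sqrtr (dotp_ge0 nu)) -frob_row nu1 expr1n.
  suff -> : M (x + t *: nu) = M x + t / s by field.
  apply/eqP; rewrite eq_le; apply/andP; split.
    by apply: M_le => j aj; rewrite M_nu// lerD2r le_M.
  rewrite -lerBrDr; apply: M_le => j aj.
  by have := le_M (x + t *: nu) j aj; rewrite M_nu//; lra.
move=> y yr; have yx j : `|y ord0 j - x0 ord0 j| < r.
  apply: le_lt_trans yr; have := normr_coord_le_frob (y - x0) j.
  by rewrite !mxE.
rewrite /g ltrDl pmulr_rgt0// subr_gt0; apply: (iff_trans (cubeP y)).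
apply: iff_sym; apply: (iff_trans (M_lt y)); split => h j.
  have [aj|nj] := boolP (j \in act); last first.
    have : r <= 1 - `|x0 ord0 j| by exact: bigmin_le_cond.
    have := yx j; have := ler_normD (y ord0 j - x0 ord0 j) (x0 ord0 j).
    by rewrite subrK; lra.
  have := yx j; have := h j aj; rewrite ltr_norml => h1 /andP[h2 h3].
  have := aj; rewrite inE eqr_norml ler01 andbT => /orP[]/eqP E1;
    rewrite E1 in h1 h2 h3; rewrite ltr_norml; apply/andP; split; lra.
move=> aj; apply: le_lt_trans (h j); apply: le_trans (ler_norm _) _.
by rewrite normrM; have := aj; rewrite inE => /eqP ->; rewrite mul1r.
Qed.

End cube.

(** * The symmetrized gradient of a linear field, and passage to the limit in [L1] *)

Section linear_field.
Context {R : realType} {n : nat}.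
Local Notation E := 'rV[R]_n.
Local Notation leb := (@lebesgue_rV R n).
Implicit Types (phi f : E -> R) (A C : 'M[R]_n) (D : set E) (mu : @mx_charge R n).

Lemma Rintegral_mscale (m : {finite_measure set E -> \bar R}) (k : {nonneg R}) D f :
  measurable D -> bounded_measurable f ->
  \int[mscale k m]_(x in D) f x = k%:num * \int[m]_(x in D) f x.
Proof.
move=> mD bf; have fi := bounded_measurable_integrable m mD bf.
have mf : measurable_fun D (EFin \o f) by have /integrableP[] := fi.
have fp := integrable_pos_fin_num mD fi.
have fn := integrable_neg_fin_num mD fi.
rewrite /Rintegral integralE [in RHS]integralE.
rewrite !ge0_integral_mscale//; [|exact: measurable_funeneg|exact: measurable_funepos].
by rewrite -(fineK fp) -(fineK fn) /= mulrBr.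
Qed.

Lemma charge_integral_cscale a (m : {finite_measure set E -> \bar R}) D f :
  measurable D -> bounded_measurable f ->
  charge_integral (cscale a (charge_of_finite_measure m)) D f =
    a * \int[m]_(x in D) f x.
Proof.
move=> mD bf.
have p0 : 0 <= Num.max a 0 by rewrite le_max lexx orbT.
have q0 : 0 <= Num.max (- a) 0 by rewrite le_max lexx orbT.
pose p := NngNum p0; pose q := NngNum q0.
rewrite (@charge_integralE _ _ _ D f (mscale p m) (mscale q m))//.
  by rewrite !Rintegral_mscale// -mulrBl -posnegE.
move=> B mB; change (a%:E * m B =
  (Num.max a 0)%R%:E * m B - (Num.max (- a) 0)%R%:E * m B)%E.
have mf : m B \is a fin_num by exact: fin_num_measure.
by rewrite -(fineK mf) -!EFinM -EFinB -mulrBl -posnegE.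
Qed.

Lemma charge_bump_cvg (nu : {charge set E -> \bar R}) D a b : open D ->
  obox a b `<=` D -> charge_integral nu D (bump a b m) @[m --> \oo] -->
    fine (nu (obox a b)).
Proof.
move=> oD abD; have mD : measurable D by exact: open_measurable_rV.
have mab : measurable (obox a b : set E).
  by apply: open_measurable_rV; exact: open_obox.
rewrite -[X in nu X](setIidl abD) -charge_integral_indic//.
apply: (@charge_integral_cvg _ _ _ _ _ _ 1) => //.
- by move=> m; exact: bump_measurable.
- by move=> x _; exact: bump_cvg.
- by move=> m x; exact: normr_bump.
Qed.

(** [sym_gradient_variation] works with an arbitrarily chosen [mu]; uniqueness identifies it on [D]
    with an explicit measure. *)
Lemma sym_gradient_unique D u mu mu' : open D -> is_sym_gradient D u mu ->
  is_sym_gradient D u mu' -> forall i j B, measurable B -> B `<=` D ->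
  fine (mu i j B) = fine (mu' i j B).
Proof.
move=> oD [_ muE] [_ muE'] i j B mB BD.
(* The difference of the two charges, written as a sum with signs so that the closure properties of
   [signed_additive] apply. *)
pose lam B := \sum_(b : bool) (-1) ^+ b * fine ((if b then mu' i j else mu i j) B).
have lamE B' : lam B' = fine (mu i j B') - fine (mu' i j B').
  by rewrite /lam big_bool/= expr1 expr0 mulN1r mul1r addrC.
have sl : signed_additive lam.
  apply: signed_additive_sum => b; apply: signed_additiveZ.
  by case: b; exact: signed_additive_charge.
suff : null_on lam (D `&` setT).
  by rewrite setIT => /(_ B mB BD); rewrite lamE => /subr0_eq.
apply: null_on_boxes => // a b abD; rewrite setIT lamE.
apply/eqP; rewrite subr_eq0; apply/eqP.
have h1 := charge_bump_cvg (nu := mu i j) oD abD.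
have h2 := charge_bump_cvg (nu := mu' i j) oD abD.
have muE_bump : (fun m => charge_integral (mu i j) D (bump a b m)) =
    (fun m => charge_integral (mu' i j) D (bump a b m)).
  by apply/funext => m; rewrite muE ?muE'//; exact: bump_test.
rewrite muE_bump in h1; exact: (cvg_unique _ h1 h2).
Qed.

Lemma cube_lty : (leb cube < +oo)%E.
Proof.
apply: le_lt_trans (lebesgue_rV_ball_lty n 1); apply: le_measure; rewrite ?inE.
- by apply: open_measurable_rV; exact: open_cube.
- exact: measurable_rV_box.
- by move=> x h j; have /andP[/ltW h1 /ltW h2] := h j; rewrite in_itv/= h1 h2.
Qed.

Lemma cube_gt0 : 0 < fine (leb cube).
Proof.
have h : (1%:E <= leb cube)%E.
  have -> : 1%:E = leb (cbox (const_mx (- 2^-1)) (const_mx 2^-1)).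
    rewrite /cbox lebesgue_rV_box => [|j]; last by rewrite !mxE; lra.
    by rewrite big1// => j _; rewrite !mxE; field.
  apply: le_measure; rewrite ?inE.
  - exact: measurable_rV_box.
  - by apply: open_measurable_rV; exact: open_cube.
  - move=> x h j; have := h j; rewrite in_itv/= !mxE => /andP[h1 h2].
    by apply/andP; split; lra.
rewrite -lte_fin fineK; first by apply: lt_le_trans h; rewrite lte_fin.
by rewrite ge0_fin_numE// cube_lty.
Qed.

Definition mcube : measurable (cube : set E) := open_measurable_rV open_cube.

Let lin A (x : E) := x *m A.

Lemma L1_lin A : L1 cube (lin A).
Proof.
move=> j; have -> : (fun x : E => (lin A x ord0 j)%:E) =
    EFin \o (fun x => dotp x (row j A^T) + 0).
  apply/funext => x /=; rewrite addr0 mxE dotpE; congr (_%:E).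
  by apply: eq_bigr => k _; rewrite !mxE.
apply: measurable_bounded_integrable; first exact: mcube.
- exact: cube_lty.
- by apply: measurable_funTS; apply: continuous_measurable_rV; exact: affine_continuous.
- exists (\sum_k `|A k j|); split; first exact: num_real.
  move=> M SM x /cubeP hx /=; apply: le_trans (ltW SM).
  rewrite addr0 dotpE; apply: le_trans (ler_norm_sum _ _ _) _.
  apply: ler_sum => k _; rewrite !mxE normrM -[leRHS]mul1r ler_wpM2r//.
  by rewrite ltW.
Qed.

Lemma dist_gradient_lin A phi i j : test_function cube phi ->
  dist_gradient cube (lin A) i j phi = A j i * \int[leb]_(x in cube) phi x.
Proof.
move=> tphi.
rewrite (@dist_gradient_affine _ _ cube cube (lin A) A^T 0)//; last 4 first.
- exact: mcube.
- exact: mcube.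
- exact: L1_lin.
- by apply: aeW => x _; rewrite trmxK addr0.
by rewrite mxE.
Qed.

Definition lin_sym_gradient A : @mx_charge R n := fun i j =>
  cscale (A i j) (charge_of_finite_measure (mfrestr mcube cube_lty)).

Lemma is_sym_gradient_lin A : sym_mx A ->
  is_sym_gradient cube (lin A) (lin_sym_gradient A).
Proof.
move=> symA; have AE i j : A i j = A j i by rewrite -[in LHS]symA mxE.
split=> [B mB|phi tphi i j].
  by apply/matrixP => i j; rewrite !mxE /lin_sym_gradient /cscale/= AE.
rewrite /lin_sym_gradient charge_integral_cscale; last 2 first.
- exact: mcube.
- exact: bounded_measurable_test tphi.
rewrite /dist_sym_gradient !dist_gradient_lin// -(AE i j).
have -> : \int[mfrestr mcube cube_lty]_(x in cube) phi x =
    \int[leb]_(x in cube) phi x.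
  congr fine; apply: eq_measure_integral => B mB Bc.
  by rewrite /= /mfrestr /mrestr setIidl.
by field.
Qed.

Lemma sym_gradient_lin_val A mu B : sym_mx A -> is_sym_gradient cube (lin A) mu ->
  measurable B -> B `<=` cube -> mx_charge_val mu B = fine (leb B) *: A.
Proof.
move=> symA smu mB Bc; apply/matrixP => i j; rewrite !mxE.
rewrite (sym_gradient_unique open_cube smu (is_sym_gradient_lin symA) i j mB Bc).
have -> : lin_sym_gradient A i j B = ((A i j)%:E * leb (B `&` cube))%E by [].
rewrite setIidl// fineM//; first by rewrite mulrC.
rewrite ge0_fin_numE//; apply: le_lt_trans cube_lty.
by apply: le_measure; rewrite ?inE//; exact: mcube.
Qed.

Lemma sym_gradient_variation_lin (N : 'M[R]_n -> R) A : norm_on_sym N -> sym_mx A ->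
  (sym_gradient_variation N cube (lin A) <= (N A * fine (leb cube))%:E)%E.
Proof.
move=> [_ _ NZ _] symA; rewrite /sym_gradient_variation.
case: pselect => [h|nh]; last by case: nh; exists (lin_sym_gradient A); exact: is_sym_gradient_lin.
set mu := sval _; have smu : is_sym_gradient cube (lin A) mu := svalP (cid h).
apply: ge_ereal_sup => _ [k [F [mF tF UF ->]]]; rewrite lee_fin.
have Fc i : F i `<=` cube by rewrite -UF; exact: bigcup_sup.
have lF i : leb (F i) \is a fin_num.
  rewrite ge0_fin_numE//; apply: le_lt_trans cube_lty.
  by apply: le_measure; rewrite ?inE//; exact: mcube.
have -> : leb cube = (\sum_(i < k) leb (F i))%E.
  rewrite -(measure_bigsetU_ord _ xpredT mF tF) -UF -bigcup_seq; congr (leb _).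
  by apply: eq_bigcupl; split=> i _ //=; rewrite mem_index_enum.
rewrite -sum_fine// mulr_sumr; apply: ler_sum => i _.
rewrite (sym_gradient_lin_val symA smu (mF i) (Fc i)) NZ//.
by rewrite ger0_norm ?fine_ge0// mulrC.
Qed.

Lemma lin_gradient_lin C A phi : sym_mx A -> test_function cube phi ->
  lin_gradient C cube (lin A) phi = mxdot C A * \int[leb]_(x in cube) phi x.
Proof.
move=> symA tphi; have AE i j : A i j = A j i by rewrite -[in LHS]symA mxE.
rewrite /lin_gradient /mxdot mulr_suml; apply: eq_bigr => i _.
rewrite mulr_suml; apply: eq_bigr => j _.
by rewrite dist_gradient_lin// -AE mulrA.
Qed.

Lemma integral_bump_cube :
  \int[leb]_(x in cube) bump (const_mx (- 1)) (const_mx 1) m x @[m --> \oo] -->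
    fine (leb cube).
Proof.
have -> : fine (leb cube) = \int[leb]_(x in cube) \1_cube x.
  by rewrite /Rintegral integral_indic ?setIid//; exact: mcube.
apply: (@Rintegral_dominated_cvg _ _ _ _ _ _ _ (cst 1)).
- exact: mcube.
- by move=> m; apply: measurable_funTS; exact: bump_measurable.
- by apply: measurable_funTS; apply: measurable_indic_rV; exact: mcube.
- by move=> x _; exact: bump_cvg.
- apply: measurable_bounded_integrable; [exact: mcube|exact: cube_lty|exact: measurable_cst|].
  exists 1; split; first exact: num_real.
  by move=> M M1 x _ /=; rewrite normr1 ltW.
- by move=> m x _; exact: normr_bump.
Qed.

(** The derivative sits on [phi] and is bounded, so each entry changes by at most a constant times
    the [L1] distance. *)
Lemma lin_gradient_cvg C D (u_ : nat -> E -> E) u phi : measurable D ->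
  L1 D u -> cvg_L1 D u_ u -> test_function D phi ->
  lin_gradient C D (u_ k) phi @[k --> \oo] --> lin_gradient C D u phi.
Proof.
move=> mD uL [ukL cu] tphi.
apply: cvg_sumr => i; apply: cvg_sumr => j; apply: cvgMr; apply: cvgN.
have bp := bounded_measurable_partial j tphi; have [_ [M pM]] := bp.
have M0 : 0 <= M by apply: le_trans (pM 0).
have iu := integrable_mul_bounded mD (uL i) bp.
have iuk k := integrable_mul_bounded mD (ukL k i) bp.
have idif k l : leb.-integrable D (EFin \o (fun x => u_ k x ord0 l - u x ord0 l)).
  have := integrableB mD (ukL k l) (uL l).
  by apply: eq_integrable => // x _ /=; rewrite EFinB.
have ifrob k : leb.-integrable D (EFin \o (fun x => frob (u_ k x - u x))).
  (* The sum of absolute coordinates dominates the Euclidean norm and is integrable by [L1]. *)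
  have iS : leb.-integrable D (EFin \o
      (fun x => \sum_l `|u_ k x ord0 l - u x ord0 l|)).
    rewrite (_ : EFin \o _ = fun x => (\sum_l `|u_ k x ord0 l - u x ord0 l|%:E)%E).
      by apply: integrable_sum => // l _; exact: (integrable_norm (idif k l)).
    by apply/funext => x /=; rewrite sumEFin.
  apply: le_integrable iS => //.
    apply/measurable_EFinP.
    pose h l x := (u_ k x ord0 l - u x ord0 l) * (u_ k x ord0 l - u x ord0 l).
    rewrite (_ : (fun x => _) = (fun x => Num.sqrt (\sum_l h l x))).
      apply: measurableT_comp.
        by apply: continuous_measurable_fun; exact: sqrt_continuous.
      apply: measurable_sum => l.
      have md : measurable_fun D (fun x => u_ k x ord0 l - u x ord0 l).
        by apply/measurable_EFinP; have /integrableP[] := idif k l.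
      exact: measurable_funM.
    apply/funext => x; rewrite frob_row dotpE; congr Num.sqrt.
    by apply: eq_bigr => l _; rewrite !mxE.
  move=> x _ /=; rewrite lee_fin ger0_norm ?frob_ge0// ger0_norm ?sumr_ge0//.
  rewrite frob_row dotpE -[leRHS]ger0_norm ?sumr_ge0// -sqrtr_sqr ler_wsqrtr//.
  rewrite expr2 mulr_suml; apply: ler_sum => l _; rewrite -expr2 !mxE.
  rewrite -real_normK ?num_real// expr2 ler_wpM2l// (bigD1 l)//= lerDl.
  by rewrite sumr_ge0.
have bnd k : `|\int[leb]_(x in D) (u x ord0 i * partial j phi x) -
    \int[leb]_(x in D) (u_ k x ord0 i * partial j phi x)| <=
    M * fine (\int[leb]_(x in D) (frob (u_ k x - u x))%:E).
  rewrite distrC -RintegralB//.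
  have ib : leb.-integrable D (EFin \o (fun x =>
      u_ k x ord0 i * partial j phi x - u x ord0 i * partial j phi x)).
    have := integrableB mD (iuk k) iu.
    by apply: eq_integrable => // x _ /=; rewrite EFinB.
  apply: le_trans (le_normr_Rintegral mD ib) _.
  rewrite -[X in _ <= M * X]/(\int[leb]_(x in D) frob (u_ k x - u x)).
  rewrite -RintegralZl//; apply: le_Rintegral => //.
  - exact: (integrable_norm ib).
  - have := integrableZl mD M (ifrob k).
    by apply: eq_integrable => // x _ /=; rewrite ?EFinM.
  - move=> x _ /=; rewrite -mulrBl normrM mulrC ler_pM//.
    by have := normr_coord_le_frob (u_ k x - u x) i; rewrite !mxE.
have c0 : M * fine (\int[leb]_(x in D) (frob (u_ k x - u x))%:E) @[k --> \oo] --> (0 : R).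
  rewrite -(mulr0 M); apply: cvgMr; exact: (fine_cvg cu).
apply/cvgrPdist_le => e e0; near=> k; apply: le_trans (bnd k) _.
near: k; move/cvgrPdist_le : c0 => /(_ _ e0); apply: filterS => k.
by rewrite sub0r normrN; apply: le_trans; exact: ler_norm.
Unshelve. all: by end_near. Qed.

End linear_field.

(** * Equality of the two norms, by approximating a linear field on the cube *)

Unset Implicit Arguments.
Set Strict Implicit.
Set Printing Implicit Defensive.

Theorem proposition3p6 (R : realType) (n : nat) (N : 'M[R]_n -> R)
    (normN : norm_on_sym N)
    (N_odot : forall a b : 'rV[R]_n, N (odot a b) = frob (odot a b))
    (approx : forall Omega : set 'rV[R]_n,
      open Omega -> bounded_set Omega -> lipschitz_boundary Omega ->
      forall u : 'rV[R]_n -> 'rV[R]_n, BD Omega u ->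
      exists u_ : nat -> 'rV[R]_n -> 'rV[R]_n,
        [/\ forall k, PR (u_ k),
            cvg_L1 Omega u_ u &
            sym_gradient_variation N Omega (u_ k) @[k --> \oo] -->
              sym_gradient_variation N Omega u]) :
  forall A : 'M[R]_n, sym_mx A -> N A = sym_schatten A.
Proof.
move=> A symA; apply/eqP; rewrite eq_le; apply/andP; split.
  exact: norm_le_schatten.
have [S0|S0] := lerP (sym_schatten A) 0.
  by apply: le_trans S0 _; case: normN => N0 _ _ _; exact: N0.
have [C [symC CA C_dual]] := sym_schatten_dual symA S0.
pose u (x : 'rV[R]_n) := x *m A.
have uBD : BD cube u.
  split; first exact: L1_lin.
  by exists (lin_sym_gradient A); exact: is_sym_gradient_lin.
have [u_ [PRu cu cV]] := approx cube open_cube bounded_cube lipschitz_boundary_cube u uBD.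
have mc : measurable (cube : set 'rV[R]_n) by exact: mcube.
pose b m : 'rV[R]_n -> R := bump (const_mx (- 1)) (const_mx 1) m.
have tb m : test_function cube (b m) by exact: bump_test.
have b01 m x : 0 <= b m x <= 1 by rewrite bump_ge0 bump_le1.
(* For a fixed bump the limit in [k] comes first, since convergence of gradients holds only against
   a test function; afterwards [m] tends to infinity and the bump fills the cube, whose measure is
   positive and cancels. *)
have le_b m : sym_schatten A * \int[lebesgue_rV n]_(x in cube) b m x <=
    N A * fine (lebesgue_rV n (cube : set 'rV[R]_n)).
  rewrite -CA -(lin_gradient_lin C symA (tb m)) -lee_fin.
  apply: le_trans (sym_gradient_variation_lin normN symA).
  have cg : (lin_gradient C cube (u_ k) (b m))%:E @[k --> \oo] -->
      (lin_gradient C cube u (b m))%:E.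
    apply: cvg_EFin; first exact: nearW.
    by apply: lin_gradient_cvg => //; exact: L1_lin.
  rewrite -(cvg_lim _ cg)// -(cvg_lim _ cV)//.
  apply: lee_lim; [by apply: cvgP cg|by apply: cvgP cV|].
  apply: nearW => k; have [ukL _] := cu.
  exact: (PR_lin_gradient_le normN N_odot symC C_dual open_cube (ukL k) (PRu k) (tb m) (b01 m)).
rewrite -(ler_pM2r (@cube_gt0 R n)).
have cb : sym_schatten A * \int[lebesgue_rV n]_(x in cube) b m x @[m --> \oo] -->
    sym_schatten A * fine (lebesgue_rV n (cube : set 'rV[R]_n)).
  by apply: cvgMr; exact: integral_bump_cube.
rewrite -(cvg_lim _ cb)//; apply: limr_le; first by apply: cvgP cb.
by apply: nearW => m; exact: le_b.
Qed.
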